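(* Let $r,h\in\mathbb{N}$. As $n\to\infty$, $$\Delta_h^{[r]}(\mathrm{pp})(n)\sim C_1\left(\frac{2hA}3\right)^r\frac{e^{An^{2/3}}}{n^{\frac r3+\frac{25}{36}}},$$ where $C_1:=\frac{\zeta(3)^{7/36}e^{\zeta'(-1)}}{2^{11/36}\sqrt{3\pi}}$, $A:=\frac{3\zeta(3)^{1/3}}{2^{2/3}}$, and $\zeta$ is the Riemann zeta function.
   Context: A plane partition of size $n$ is a two-dimensional array of $\pi_{j,k}\in\mathbb{N}_0$ ($j,k\in\mathbb{N}$) with $\sum_{j,k}\pi_{j,k}=n$, $\pi_{j,k}\ge\pi_{j,k+1}$ and $\pi_{j,k}\ge\pi_{j+1,k}$; $\mathrm{pp}(n)$ denotes the number of plane partitions of $n$. For $h\in\mathbb{N}$, $\Delta_h^{[1]}(a)(n):=a(n)-a(n-h)$, and for $r\ge2$, $\Delta_h^{[r]}(a)(n):=\Delta_h^{[1]}\left(\Delta_h^{[r-1]}(a)\right)(n)$ (considered for $n\ge hr$). *)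

(* Defs.v *)
From Stdlib Require Import Reals.
From Coquelicot Require Import Coquelicot.
From mathcomp Require Import all_boot.
From mathcomp Require Import finmap boolp classical_sets cardinality.

Local Open Scope nat_scope.

(* Rows and columns are indexed from 0.  A family of naturals indexed by N x N
   has sum n exactly when its support lies in some square [0, N) x [0, N) and
   the sum over that square is n. *)
Definition plane_partition (n : nat) (pi : nat -> nat -> nat) : Prop :=
  [/\ forall j k, (pi j k.+1 <= pi j k)%nat,
      forall j k, (pi j.+1 k <= pi j k)%nat
    & exists N : nat,
        (forall j k, (N <= j)%nat || (N <= k)%nat -> pi j k = 0%nat) /\
        (\sum_(j < N) \sum_(k < N) pi j k)%nat = n].

(* fset_set returns the empty set on an infinite set; finite_plane_partitions
   below shows that this case does not arise. *)
Definition pp (n : nat) : nat :=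
  #|` fset_set [set pi | plane_partition n pi]%classic |.

Lemma plane_partition_row_le {n pi j j' k} :
  plane_partition n pi -> (j <= j')%nat -> (pi j' k <= pi j k)%nat.
Proof.
case=> _ H _ /subnK <-; elim: (j' - j)%nat => [|d IH] //.
by apply: leq_trans IH; rewrite addSn.
Qed.

Lemma plane_partition_col_le {n pi j k k'} :
  plane_partition n pi -> (k <= k')%nat -> (pi j k' <= pi j k)%nat.
Proof.
case=> H _ _ /subnK <-; elim: (k' - k)%nat => [|d IH] //.
by apply: leq_trans IH; rewrite addSn.
Qed.

Lemma plane_partition_bound {n pi j k} :
  plane_partition n pi -> pi j k <> 0%nat ->
  [/\ (j < n)%nat, (k < n)%nat & (pi j k <= n)%nat].
Proof.
move=> pip /eqP pi_neq0; have [_ _ [N [supp sumN]]] := pip.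
have /norP[] : ~~ ((N <= j)%nat || (N <= k)%nat).
  by apply/negP => /supp; apply/eqP.
rewrite -!ltnNge => ltjN ltkN.
have pi_gt0 : (0 < pi j k)%nat by rewrite lt0n.
have sum_ord1 m : (m = \sum_(i < m) 1)%nat by rewrite sum1_card card_ord.
have widen m (F : nat -> nat) :
    (m <= N)%nat -> (\sum_(i < m) F i <= \sum_(i < N) F i)%nat.
  move=> lemN; rewrite (big_ord_widen N F lemN).
  by rewrite [leqRHS](bigID (fun i : 'I_N => (i < m)%nat)) leq_addr.
split; rewrite -sumN.
- rewrite [leqLHS]sum_ord1.
  apply: leq_trans (widen _ (fun i => \sum_(k' < N) pi i k')%nat ltjN).
  apply: leq_sum => i _; rewrite (bigD1 (Ordinal ltkN)) //=.
  apply: leq_trans (leq_addr _ _); apply: leq_trans pi_gt0 _.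
  by apply: plane_partition_row_le pip _; rewrite -ltnS.
- rewrite (bigD1 (Ordinal ltjN)) //=; apply: leq_trans (leq_addr _ _).
  rewrite [leqLHS]sum_ord1; apply: leq_trans (widen _ (pi j) ltkN).
  apply: leq_sum => i _; apply: leq_trans pi_gt0 _.
  by apply: plane_partition_col_le pip _; rewrite -ltnS.
- rewrite (bigD1 (Ordinal ltjN)) //= (bigD1 (Ordinal ltkN)) //=.
  by rewrite -addnA leq_addr.
Qed.

Lemma finite_plane_partitions (n : nat) :
  finite_set [set pi | plane_partition n pi]%classic.
Proof.
pose f (g : {ffun 'I_n * 'I_n -> 'I_n.+1}) (j k : nat) : nat :=
  if insub j is Some j' then if insub k is Some k' then val (g (j', k')) else 0
  else 0.
apply: (@sub_finite_set _ _ (f @` setT)%classic); last first.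
  exact/finite_image/finite_finset.
move=> pi /= pip; exists [ffun p : 'I_n * 'I_n => inord (pi p.1 p.2)] => //.
apply/funext => j; apply/funext => k; rewrite /f.
have [/eqP pi0|/eqP/(plane_partition_bound pip)[ltjn ltkn le_n]] :=
    boolP (pi j k == 0%nat).
  case: insubP => [j' _ ej|//]; case: insubP => [k' _ ek|//].
  by rewrite ffunE /= ej ek pi0 inordK.
by rewrite !insubT ffunE /= inordK.
Qed.

Local Open Scope R_scope.

(* Subtraction on nat is truncated, so bdiff h r a n is the r-fold backward
   difference of a with step h only when h * r <= n. *)
Definition bdiff1 (h : nat) (a : nat -> R) (n : nat) : R :=
  a n - a (n - h)%nat.

Fixpoint bdiff (h r : nat) (a : nat -> R) : nat -> R :=
  match r with
  | O => a
  | S r' => bdiff1 h (bdiff h r' a)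
  end.

Definition Cexp (z : C) : C :=
  (exp (Re z) * cos (Im z), exp (Re z) * sin (Im z)).

Definition analytic_at (f : C -> C) (s : C) : Prop :=
  exists a : nat -> C,
    locally (T := C_UniformSpace) s
      (fun z => is_pseries (K := C_AbsRing) (V := C_NormedModule)
                  a (z - s)%C (f z)).

(* zeta is the analytic continuation to C \ {1} of the sum over m >= 1 of
   m^{-s}, 1 < Re s, where m^{-s} = exp (- s * ln m).  The value at 1 is
   arbitrary. *)
Definition is_riemann_zeta (zeta : C -> C) : Prop :=
  (forall s : C, 1 < Re s ->
     is_series (K := C_AbsRing) (V := C_NormedModule)
       (fun i : nat => Cexp (- s * RtoC (ln (INR (S i))))%C) (zeta s)) /\
  (forall s : C, s <> RtoC 1 -> analytic_at zeta s).

Definition zeta3 (zeta : C -> C) : R := Re (zeta (RtoC 3)).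

Definition zeta'_m1 (zeta : C -> C) : R := Re (C_derive zeta (RtoC (-1))).

Definition constA (zeta : C -> C) : R :=
  3 * Rpower (zeta3 zeta) (1 / 3) / Rpower 2 (2 / 3).

Definition constC1 (zeta : C -> C) : R :=
  Rpower (zeta3 zeta) (7 / 36) * exp (zeta'_m1 zeta) /
  (Rpower 2 (11 / 36) * sqrt (3 * PI)).

Definition asymp_equiv (u v : nat -> R) : Prop :=
  is_lim_seq (fun n => u n / v n) 1.

(* Main.v *)
(* By MacMahon, sum_n pp(n) q^n = prod_(m >= 1) (1 - q^m)^(-m) = exp (sum_n (sigma_2(n)/n) q^n);
   the product formula is obtained by splitting a plane partition along its diagonal
   into two chains of interlacing partitions and iterating a toggle bijection (the
   skew Cauchy identity).  Euler-Maclaurin summation of the logarithm at q = exp(-x)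
   gives zeta(3)/x^2 + (ln x)/12 + zeta'(-1) + o(1), and, by convexity in x, the
   asymptotics of its first derivatives.

   The r-th difference is the n-th Fourier coefficient of the generating function
   times (1 - q^h)^r.  With x = (2 zeta(3)/n)^(1/3) and y = x^2 t, the integrand at
   q = exp(-x + iy) tends, after normalisation, to (h x)^r exp(-3 zeta(3) t^2), and
   is dominated because sigma_2(n)/n >= n forces the modulus to decay like
   exp(- c |t|) on the whole circle; the Gaussian integral finishes the proof.

   The constants zeta(3) and zeta'(-1) appear as explicit series.  The second one is
   identified by continuing zeta to Re s > -3/2 with Euler-Maclaurin and invoking
   the identity theorem along a path avoiding 1. *)

Require Import Defs.
From Stdlib Require Import Reals Lra Lia Arith.
From Coquelicot Require Import Coquelicot.
From mathcomp Require all_boot all_order all_algebra zify.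
From mathcomp Require boolp classical_sets functions fsbigop.
From mathcomp Require reals ereal normedtype sequences esum Rstruct.
Local Open Scope R_scope.

(** * MacMahon's product for plane partitions *)

(** The r-th difference is smaller than pp(n) by a factor of order n^(-r/3), so it cannot be read
    off from a formula for pp(n) with relative error o(1): the factor (1 - q^h)^r has to enter the
    integrand. On the saddle scale the angle y is of order x^2, negligible against x, so this factor
    is close to (h x)^r.

    That scale dictates the precision. Let L(x) be the logarithm at q = exp(-x). The phase requires
    L' up to o(x^(-2)), finer than its leading order x^(-3); L'' is needed up to o(x^(-4)), and L'''
    only as O(x^(-5)). An o(1) error in L yields this by convexity, using secants of length e x^2
    with e small. Hence Euler-Maclaurin is carried out at real q only.

    Away from the saddle no arcs are separated: sigma_2(n)/n >= n compares the loss in Re L with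
    that of the series of n q^n, which is q/(1 - q)^2 and explicit at every angle.

    MacMahon's product is also proved at real q only; the recursion for pp(n) and a differential
    equation along rays carry it to complex q without complex logarithms. *)

Module PlanePartitionSum.
Import all_boot all_order all_algebra zify.
Import boolp classical_sets functions fsbigop.
Import reals ereal normedtype sequences esum.
Import Order.TTheory GRing.Theory Num.Theory.
Local Open Scope classical_set_scope.
Local Open Scope ring_scope.
Local Open Scope ereal_scope.

Set Implicit Arguments.
Unset Strict Implicit.
Unset Printing Implicit Defensive.

(** * Sums of nonnegative extended reals over arbitrary sets *)

Section EsumGeneral.
Context {R : realType}.

(** For infinite [c], either [f] vanishes on [S], or a single positive term makes both sides
    infinite. *)
Lemma esumZl (T : choiceType) (S : set T) (f : T -> \bar R) (c : \bar R) :
  0 <= c -> (forall i, 0 <= f i) ->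
  \esum_(i in S) (c * f i) = c * \esum_(i in S) f i.
Proof.
case: c => [c| |]// c0 f0.
  rewrite /esum -ereal_supZl//; last first.
    by apply/set0P; exists (\sum_(x \in set0) f x); exists set0 => //; exact: fsets_set0.
  congr ereal_sup; rewrite image_comp; apply: eq_imagel => A _ /=.
  by rewrite ge0_mule_fsumr.
have [/existsNP[i /not_implyP[Si fi]]|fS0] := pselect (~ forall i, S i -> f i = 0); last first.
  move/contrapT : fS0 => fS0; rewrite (esum1 fS0) mule0.
  by apply: esum1 => i Si; rewrite fS0// mule0.
have fi0 : 0 < f i by rewrite lt0e f0 andbT; apply/eqP.
have ge1 (g : T -> \bar R) : (forall i, 0 <= g i) -> g i <= \esum_(j in S) g j.
  by move=> g0; apply: esum_ge; exists [set i]; [split=> // _ -> | rewrite fsbig_set1].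
rewrite gt0_mulye; last by rewrite (lt_le_trans fi0)// ge1.
apply/eqP; rewrite -leye_eq; apply: le_trans (ge1 (fun i => +oo * f i) _).
  by rewrite gt0_mulye.
by move=> j; rewrite mule_ge0.
Qed.

Lemma bij_of_inv (T T' : Type) (P : set T) (Q : set T') (e : T -> T') (g : T' -> T) :
  (forall x, P x -> Q (e x)) -> (forall y, Q y -> P (g y)) ->
  (forall x, P x -> g (e x) = x) -> (forall y, Q y -> e (g y) = y) ->
  set_bij P Q e.
Proof.
move=> PQ QP ge eg; split=> //.
- by move=> x y /set_mem Px /set_mem Py exy; rewrite -(ge x) // exy ge.
- by move=> y Qy; exists (g y); [exact: QP | exact: eg].
Qed.

Lemma esum_bij (T T' : choiceType) (P : set T) (Q : set T') (e : T -> T')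
    (g : T' -> T) (a : T' -> \bar R) (b : T -> \bar R) :
  (forall x, P x -> Q (e x)) -> (forall y, Q y -> P (g y)) ->
  (forall x, P x -> g (e x) = x) -> (forall y, Q y -> e (g y) = y) ->
  (forall x, P x -> a (e x) = b x) ->
  \esum_(j in Q) a j = \esum_(i in P) b i.
Proof.
move=> PQ QP ge eg ab; rewrite (@reindex_esum R T T' P Q e a (bij_of_inv PQ QP ge eg)).
exact: eq_esum.
Qed.

Lemma esum_geometric (z : R) : (0 <= z < 1)%R ->
  \esum_(k in [set: nat]) (z ^+ k)%:E = ((1 - z)^-1)%:E.
Proof.
move=> /andP[z0 z1].
rewrite -nneseries_esumT; last by move=> n; rewrite lee_fin exprn_ge0.
apply/cvg_lim => //; apply: cvg_EFin.
  by apply: nearW => n; rewrite sumEFin.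
rewrite [X in X @ _ --> _](_ : _ = series (geometric 1 z)).
  by rewrite -[X in _ --> X]mul1r; apply: cvg_geometric_series; rewrite ger0_norm.
apply/funext => n /=; rewrite sumEFin /= /series /=.
by apply: eq_bigr => i _; rewrite mul1r.
Qed.

End EsumGeneral.

(** * Interlacing sequences and the toggle bijection *)

(** That is, [l 0 >= m 0 >= l 1 >= m 1 >= ...]: the skew shape [l/m] is a horizontal strip. Both
    sequences are then weakly decreasing, so being a partition is never stated separately. *)
Definition interlaces (l m : nat -> nat) : Prop :=
  forall i, (m i <= l i)%N && (l i.+1 <= m i)%N.

Definition supp_lt (M : nat) (l : nat -> nat) : Prop := forall i, (M <= i)%N -> l i = 0%N.

Definition psize (M : nat) (l : nat -> nat) : nat := \sum_(i < M) l i.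

Lemma interlaces_supp {M l m} : interlaces l m -> supp_lt M l -> supp_lt M m.
Proof. by move=> lm lM i /lM li; have /andP[+ _] := lm i; rewrite li; case: (m i). Qed.

Lemma interlaces_suppr {M l m} : interlaces l m -> supp_lt M m -> supp_lt M.+1 l.
Proof.
by move=> lm lM [|i]// /lM mi; have /andP[_ +] := lm i; rewrite mi; case: (l i.+1).
Qed.

Lemma interlaces_size {M l m} : interlaces l m -> (psize M m <= psize M l)%N.
Proof. by move=> lm; apply: leq_sum => i _; case/andP: (lm i). Qed.

Section Toggle.
Variables l n : nat -> nat.

(** If [l] and [n] both interlace [k], then [k j] ranges over the interval from
    [max (l (j+1)) (n (j+1))] to [min (l j) (n j)]. If [m] interlaces both [l] and [n], then
    [m (j+1)] ranges over the same interval. The toggle reflects this interval. The entry [m 0] is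
    bounded only from below, and its excess over that bound is the additional parameter [c]. *)
Definition toggle_up (kc : (nat -> nat) * nat) : nat -> nat := fun i =>
  if i is j.+1 then (minn (l j) (n j) + maxn (l j.+1) (n j.+1) - kc.1 j)%N
  else (maxn (l 0) (n 0) + kc.2)%N.

Definition toggle_down (m : nat -> nat) : (nat -> nat) * nat :=
  (fun j => (minn (l j) (n j) + maxn (l j.+1) (n j.+1) - m j.+1)%N,
   (m 0 - maxn (l 0) (n 0))%N).

Lemma toggle_upP kc : interlaces l kc.1 /\ interlaces n kc.1 ->
  interlaces (toggle_up kc) l /\ interlaces (toggle_up kc) n.
Proof.
move=> [lk nk]; split=> -[|i] /=.
- by have := lk 0%N; have := nk 0%N; lia.
- by have := lk i; have := nk i; have := lk i.+1; have := nk i.+1; lia.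
- by have := lk 0%N; have := nk 0%N; lia.
- by have := lk i; have := nk i; have := lk i.+1; have := nk i.+1; lia.
Qed.

Lemma toggle_downP m : interlaces m l /\ interlaces m n ->
  interlaces l (toggle_down m).1 /\ interlaces n (toggle_down m).1.
Proof.
by move=> [ml mn]; split=> i /=; have := ml i; have := mn i;
  have := ml i.+1; have := mn i.+1; lia.
Qed.

Lemma toggle_upK kc : interlaces l kc.1 /\ interlaces n kc.1 ->
  toggle_down (toggle_up kc) = kc.
Proof.
case: kc => k c [/= lk nk]; rewrite /toggle_down /=; congr pair; last by lia.
by apply/funext => j; have := lk j; have := nk j; lia.
Qed.

Lemma toggle_downK m : interlaces m l /\ interlaces m n ->
  toggle_up (toggle_down m) = m.
Proof.
move=> [ml mn]; apply/funext => -[|j] /=.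
- by have := ml 0%N; have := mn 0%N; lia.
- by have := ml j; have := mn j; have := ml j.+1; have := mn j.+1; lia.
Qed.

(** The reflection preserves the sum of the two endpoints of each interval, and a minimum and a
    maximum of the same two entries add up to their sum. As [n] vanishes at [M], the last minimum is
    zero, so the window of length [M + 1] contains all the entries that matter. *)
Lemma toggle_size M k c : interlaces l k -> interlaces n k ->
  supp_lt M.+1 l -> supp_lt M n ->
  (psize M.+1 (toggle_up (k, c)) + psize M.+1 k = psize M.+1 l + psize M.+1 n + c)%N.
Proof.
move=> lk nk lM nM.
have kM0 : k M = 0%N by have := nk M; rewrite nM //; lia.
rewrite /psize [X in (X + _)%N]big_ord_recl [X in (_ + X)%N]big_ord_recr /= kM0 addn0.
have e0 : (\sum_(i < M) toggle_up (k, c) (lift ord0 i) + \sum_(i < M) k i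
   = \sum_(i < M) minn (l i) (n i) + \sum_(i < M) maxn (l i.+1) (n i.+1))%N.
  rewrite -!big_split /=; apply: eq_bigr => i _.
  by rewrite ?add0n; have := lk i; have := nk i; lia.
have mM : minn (l M) (n M) = 0%N by rewrite nM // minn0.
have e1 : (\sum_(i < M) minn (l i) (n i) = \sum_(i < M.+1) minn (l i) (n i))%N.
  by rewrite big_ord_recr /= mM addn0.
have e2 : (maxn (l 0) (n 0) + \sum_(i < M) maxn (l i.+1) (n i.+1)
   = \sum_(i < M.+1) maxn (l i) (n i))%N.
  by rewrite big_ord_recl.
have e3 : (\sum_(i < M.+1) minn (l i) (n i) + \sum_(i < M.+1) maxn (l i) (n i)
   = \sum_(i < M.+1) l i + \sum_(i < M.+1) n i)%N.
  by rewrite -!big_split /=; apply: eq_bigr => i _; lia.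
by move: e0 e1 e2 e3; rewrite /toggle_up /=; lia.
Qed.

End Toggle.

(** * Chains of interlacing sequences and the Cauchy identity *)

(** The successive diagonals on one side of a plane partition whose main diagonal is [l]. *)
Definition chains (k : nat) (l : nat -> nat) : set (nat -> nat -> nat) :=
  [set c | [/\ c 0%N = l, forall i, interlaces (c i) (c i.+1) &
    forall i, (k <= i)%N -> c i = (fun=> 0%N)]].

(** Abel summation. With [b = 0] the weight counts the members after [c 0] once each; with [b = 1]
    it counts [c 0] as well. This is how the main diagonal will be counted exactly once. *)
Lemma chain_weight M b k l c : chains k l c ->
  (\sum_(j < k) (b + j) * (psize M (c j) - psize M (c j.+1)) =
   b * psize M (c 0) + \sum_(j < k) psize M (c j.+1))%N.
Proof.
elim: k b l c => [|k IH] b l c [c0 cc ck].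
  rewrite !big_ord0 (_ : psize M (c 0%N) = 0%N) ?muln0//.
  by rewrite /psize big1// => i _; rewrite ck.
rewrite [LHS]big_ord_recl [in RHS]big_ord_recl addn0.
have h : chains k (c 1%N) (fun j => c j.+1) by split=> // i ki; rewrite ck.
have e1 : (\sum_(i < k) (b + lift ord0 i) * (psize M (c (lift ord0 i)) - psize M (c (lift ord0 i).+1)) =
    \sum_(i < k) (b.+1 + i) * (psize M (c i.+1) - psize M (c i.+2)))%N.
  by apply: eq_bigr => i _; rewrite lift0 addnS addSn.
have e2 : (\sum_(i < k) psize M (c (lift ord0 i).+1) = \sum_(i < k) psize M (c i.+2))%N.
  by apply: eq_bigr => i _; rewrite lift0.
rewrite e1 e2 (IH b.+1 _ _ h).
have := interlaces_size (M := M) (cc 0%N).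
move: (psize M (c 0%N)) (psize M (c 1%N)) (\sum_(i < k) _)%N => x y z; rewrite /=; nia.
Qed.

(** Going backwards from the zero sequence, each member is at most one entry longer than its
    successor. *)
Lemma chains_supp k l c i : chains k l c -> supp_lt (k - i) (c i).
Proof.
move=> [_ cc ck]; have [ki|/ltnW] := leqP k i; first by rewrite ck.
move=> ik; rewrite -{2}(subKn ik).
have : (k - i <= k)%N by lia.
elim: (k - i)%N => [|j IH] jk; first by rewrite subn0 ck.
have := cc (k - j.+1)%N; rewrite (_ : (k - j.+1).+1 = k - j)%N; last by lia.
by move=> h; apply: interlaces_suppr h _; apply: IH; lia.
Qed.

Section Cauchy.
Context {R : realType}.
Variables (q : R) (M : nat).
Hypothesis q01 : (0 <= q < 1)%R.
Local Notation sz := (psize M.+1).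

Lemma qX_ge0 k : (0 <= q ^+ k)%R.
Proof. by rewrite exprn_ge0//; case/andP: q01. Qed.

(** Under the toggle the exponent on the left becomes the exponent on the right plus [(a + b) * c],
    by [toggle_size]; summing over the free parameter [c] gives the geometric factor. *)
Lemma toggle_sum (l n : nat -> nat) (a b : nat) : supp_lt M.+1 l -> supp_lt M n ->
  (0 < a + b)%N ->
  \esum_(m in [set m | interlaces m l /\ interlaces m n])
     (q ^+ (a * (sz m - sz l) + b * (sz m - sz n)))%:E
  = ((1 - q ^+ (a + b))^-1)%:E *
    \esum_(k in [set k | interlaces l k /\ interlaces n k])
      (q ^+ (b * (sz l - sz k) + a * (sz n - sz k)))%:E.
Proof.
move=> lM nM ab0.
have qab : (0 <= q ^+ (a + b) < 1)%R.
  by rewrite qX_ge0 exprn_ilt1 -?lt0n//; case/andP: q01.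
rewrite -esumZl ?lee_fin ?invr_ge0 ?subr_ge0; last 2 first.
- by case/andP: qab => _ /ltW.
- by move=> i; rewrite lee_fin qX_ge0.
transitivity (\esum_(p in [set p | interlaces l p /\ interlaces n p]) \esum_(c in [set: nat])
    ((q ^+ (b * (sz l - sz p) + a * (sz n - sz p)))%:E * ((q ^+ (a + b)) ^+ c)%:E)); last first.
  apply: eq_esum => p _; rewrite muleC -esum_geometric// -esumZl ?lee_fin ?qX_ge0//.
  by move=> i; rewrite lee_fin exprn_ge0// qX_ge0.
rewrite esum_esum; last first.
  by move=> k i _ _; rewrite -EFinM lee_fin mulr_ge0 ?qX_ge0// exprn_ge0// qX_ge0.
apply: (@esum_bij R _ _ _ _ (toggle_up l n) (toggle_down l n)).
- by move=> kc [/= h _]; exact: toggle_upP h.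
- by move=> m h; split=> //=; exact: toggle_downP h.
- by move=> kc [/= h _]; exact: toggle_upK h.
- by move=> m h; exact: toggle_downK h.
- move=> [k c] [/= [lk nk] _]; rewrite -EFinM -exprM -exprD; congr ((_ ^+ _)%:E).
  have := toggle_size c lk nk lM nM.
  have := interlaces_size (M := M.+1) lk; have := interlaces_size (M := M.+1) nk.
  move: (sz _) (sz l) (sz n) (sz k) => x y z w h1 h2 e.
  have -> : (x - y = (z - w) + c)%N by lia.
  have -> : (x - z = (y - w) + c)%N by lia.
  lia.
Qed.

(** For [k] at most [M + 1] this is the Schur polynomial of [l] at the variables
    [q^b, ..., q^(b+k-1)], written through its branching rule. *)
Fixpoint chain_sum (b k : nat) (l : nat -> nat) : \bar R :=
  match k with
  | 0 => (if `[< l = (fun=> 0%N) >] then 1 else 0)%R%:E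
  | k'.+1 => \esum_(m in [set m | interlaces l m])
               ((q ^+ (b * (sz l - sz m)))%:E * chain_sum b.+1 k' m)
  end.

Lemma chain_sum_ge0 b k l : 0 <= chain_sum b k l.
Proof.
elim: k b l => [|k IH] b l /=; first by rewrite lee_fin; case: ifP.
by apply: esum_ge0 => m _; rewrite mule_ge0 ?lee_fin ?qX_ge0.
Qed.

Lemma chain_sum_supp b k l : chain_sum b k l != 0 -> supp_lt k l.
Proof.
elim: k b l => [|k IH] b l /=.
  case: asboolP => [->//|]; by rewrite eqxx.
move=> /eqP h.
have [//|nsupp] := pselect (supp_lt k.+1 l); exfalso; apply: h.
apply: esum1 => m lm; have [->|/IH mk] := eqVneq (chain_sum b.+1 k m) 0.
  by rewrite mule0.
by case: nsupp; exact: interlaces_suppr lm mk.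
Qed.

Lemma esum_exchange (T1 T2 : choiceType) (P : set T1) (Q : T1 -> set T2)
    (P' : set T2) (Q' : T2 -> set T1) (f : T1 -> T2 -> \bar R) :
  (forall i j, P i /\ Q i j <-> P' j /\ Q' j i) -> (forall i j, 0 <= f i j) ->
  \esum_(i in P) \esum_(j in Q i) f i j = \esum_(j in P') \esum_(i in Q' j) f i j.
Proof.
move=> PQ f0; rewrite !esum_esum//.
apply: (@esum_bij _ _ _ _ _ (fun x => (x.2, x.1)) (fun x => (x.2, x.1))) => //=.
- by move=> [x y] /= h; apply/PQ.
- by move=> [x y] /= h; apply/PQ.
- by move=> [x y].
- by move=> [x y].
Qed.

(* The skew Cauchy identity with one variable on one side. *)
Lemma chain_sum_eigen (a b k : nat) (l : nat -> nat) : (k <= M)%N -> (0 < a + b)%N ->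
  \esum_(m in [set m | interlaces m l]) ((q ^+ (a * (sz m - sz l)))%:E * chain_sum b k m)
  = (\prod_(j < k) (1 - q ^+ (a + b + j))^-1)%:E * chain_sum b k l.
Proof.
elim: k b l => [|k IH] b l kM ab0.
  rewrite big_ord0 mul1e /=; case: asboolP => [->|l0].
    rewrite (esumID [set (fun=> 0%N)]) ?[X in _ + X]esum1 ?adde0//=.
    - rewrite [X in esum X _](_ : _ = [set (fun=> 0%N)]).
        rewrite esum_set1 asboolT// mule1 ?lee_fin ?qX_ge0//.
        by rewrite subnn muln0 expr0.
      by apply/seteqP; split=> [m []//|m /= ->]; split=> // i; rewrite leqnn.
    - by move=> m [_ /= m0]; rewrite asboolF// mule0.
    - by move=> m _; rewrite mule_ge0 ?lee_fin ?qX_ge0//; case: ifP.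
  apply: esum1 => m /= ml; rewrite asboolF ?mule0// => m0; apply: l0.
  by apply/funext => i; have := ml i; rewrite m0; lia.
(* When [l] is too long both sides vanish: a nonzero chain sum bounds the length of its argument,
   and any [m] above [l] is at least as long as [l]. *)
have [lM|nlM] := pselect (supp_lt M.+1 l); last first.
  have z1 b' k' : (k' <= M)%N -> chain_sum b' k' l = 0.
    move=> k'M; apply/eqP; apply: contra_notT nlM => /chain_sum_supp lk i Mi.
    by apply: lk; lia.
  rewrite z1// mule0; apply: esum1 => m ml; apply/eqP.
  have [->|/chain_sum_supp mk] := eqVneq (chain_sum b k.+1 m) 0; first by rewrite mule0.
  have [] := nlM; apply: (interlaces_supp ml) => i Mi.
  by apply: mk; lia.
(* The first link of the chain from [m] leads to some [n]. Exchanging the two sums fixes [l] and [n]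
   and leaves an inner sum over the [m] above both. *)
transitivity (\esum_(n in [set: nat -> nat]) (chain_sum b.+1 k n *
   \esum_(m in [set m | interlaces m l /\ interlaces m n])
     (q ^+ (a * (sz m - sz l) + b * (sz m - sz n)))%:E)).
  transitivity (\esum_(m in [set m | interlaces m l]) \esum_(n in [set n | interlaces m n])
      (chain_sum b.+1 k n * (q ^+ (a * (sz m - sz l) + b * (sz m - sz n)))%:E)).
    apply: eq_esum => m ml; rewrite -esumZl ?lee_fin ?qX_ge0//; last first.
      by move=> i; rewrite mule_ge0 ?chain_sum_ge0 ?lee_fin ?qX_ge0.
    by apply: eq_esum => n _; rewrite muleA -EFinM -exprD muleC.
  rewrite (@esum_exchange _ _ _ _ setT (fun n => [set m | interlaces m l /\ interlaces m n])).
  - apply: eq_esum => n _; rewrite esumZl ?chain_sum_ge0//.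
    by move=> i; rewrite lee_fin qX_ge0.
  - by move=> m n /=; tauto.
  - by move=> m n; rewrite mule_ge0 ?chain_sum_ge0 ?lee_fin ?qX_ge0.
(* The toggle replaces the [m] above both [l] and [n] by the [p] below both and releases one factor.
   After exchanging back, [p] is the first link below [l], and the induction hypothesis applies at
   [p]. *)
transitivity (((1 - q ^+ (a + b))^-1)%:E * \esum_(n in [set: nat -> nat]) (chain_sum b.+1 k n *
   \esum_(p in [set p | interlaces l p /\ interlaces n p])
      (q ^+ (b * (sz l - sz p) + a * (sz n - sz p)))%:E)).
  rewrite -esumZl.
  - apply: eq_esum => n _.
    have [->|/chain_sum_supp nk] := eqVneq (chain_sum b.+1 k n) 0; first by rewrite !mul0e mule0.
    rewrite toggle_sum//; first by rewrite !muleA [X in X * _]muleC.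
    by move=> i Mi; apply: nk; lia.
  - rewrite lee_fin invr_ge0 subr_ge0 exprn_ile1//; first by case/andP: q01.
    by case/andP: q01 => _ /ltW.
  - by move=> n; rewrite mule_ge0 ?chain_sum_ge0// esum_ge0// => p _; rewrite lee_fin qX_ge0.
rewrite big_ord_recl addn0 EFinM -muleA; congr (_ * _).
transitivity (\esum_(n in [set: nat -> nat]) \esum_(p in [set p | interlaces l p /\ interlaces n p])
   (chain_sum b.+1 k n * (q ^+ (b * (sz l - sz p) + a * (sz n - sz p)))%:E)).
  apply: eq_esum => n _; rewrite -esumZl ?chain_sum_ge0//.
  by move=> i; rewrite lee_fin qX_ge0.
rewrite (@esum_exchange _ _ _ _ [set p | interlaces l p] (fun p => [set n | interlaces n p])).
- transitivity (\esum_(p in [set p | interlaces l p]) ((q ^+ (b * (sz l - sz p)))%:E *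
    \esum_(n in [set n | interlaces n p]) ((q ^+ (a * (sz n - sz p)))%:E * chain_sum b.+1 k n))).
    apply: eq_esum => p _; rewrite -esumZl ?lee_fin ?qX_ge0//; last first.
      by move=> i; rewrite mule_ge0 ?chain_sum_ge0 ?lee_fin ?qX_ge0.
    by apply: eq_esum => n _; rewrite muleA -EFinM -exprD muleC.
  rewrite -[RHS]esumZl.
  + apply: eq_esum => p _; rewrite IH ?addnS//; last by lia.
    rewrite !muleA -!EFinM; congr (_%:E * _); rewrite mulrC; congr (_ * _)%R.
    by apply: eq_bigr => i _; rewrite /bump /= addSn addnS.
  + rewrite lee_fin prodr_ge0// => i _; rewrite invr_ge0 subr_ge0 exprn_ile1//.
      by case/andP: q01.
    by case/andP: q01 => _ /ltW.
  + by move=> i; rewrite mule_ge0 ?chain_sum_ge0 ?lee_fin ?qX_ge0.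
- by move=> n p /=; tauto.
- by move=> m n; rewrite mule_ge0 ?chain_sum_ge0 ?lee_fin ?qX_ge0.
Qed.

Lemma chain_sum0 b k : chain_sum b k (fun=> 0%N) = 1.
Proof.
elim: k b => [|k IH] b /=; first by rewrite asboolT.
rewrite (_ : [set m | _] = [set (fun=> 0%N)]).
  rewrite esum_set1 IH mule1; last by rewrite lee_fin qX_ge0.
  by rewrite subnn muln0 expr0.
apply/seteqP; split=> [m h|m /= ->]; last by move=> i.
by apply/funext => i; have := h i; lia.
Qed.

(** Cauchy's identity for Schur polynomials at [x_i = q^(a+i)] and [y_j = q^(b+j)]. Each induction
    step strips one variable [x_i] by [chain_sum_eigen]. *)
Lemma chain_sum_cauchy (a b k N : nat) : (N <= M)%N -> (0 < a + b)%N ->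
  \esum_(l in [set: nat -> nat]) (chain_sum a k l * chain_sum b N l)
  = (\prod_(i < k) \prod_(j < N) (1 - q ^+ (a + b + i + j))^-1)%:E.
Proof.
move=> NM; elim: k a => [|k IH] a ab0.
  rewrite big_ord0 (esumID [set (fun=> 0%N)]); last first.
    by move=> l _; rewrite mule_ge0// chain_sum_ge0.
  rewrite setTI esum_set1 ?mule_ge0 ?chain_sum_ge0// !chain_sum0 mule1.
  by rewrite esum1 ?adde0// => m [_ /= m0]; rewrite asboolF// mul0e.
transitivity (\esum_(m in [set: nat -> nat]) ((\prod_(j < N) (1 - q ^+ (a + b + j))^-1)%:E *
    (chain_sum a.+1 k m * chain_sum b N m))); last first.
  rewrite esumZl.
  - rewrite IH ?addSn// -EFinM big_ord_recl addn0; congr ((_ * _)%R%:E).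
    by apply: eq_bigr => i _; apply: eq_bigr => j _; rewrite /bump /= addnS.
  - rewrite lee_fin prodr_ge0// => i _; rewrite invr_ge0 subr_ge0 exprn_ile1//.
      by case/andP: q01.
    by case/andP: q01 => _ /ltW.
  - by move=> m; rewrite mule_ge0// chain_sum_ge0.
transitivity (\esum_(l in [set: nat -> nat]) \esum_(m in [set m | interlaces l m])
   (((q ^+ (a * (sz l - sz m)))%:E * chain_sum a.+1 k m) * chain_sum b N l)).
  apply: eq_esum => l _ /=; rewrite muleC -esumZl ?chain_sum_ge0//.
    by apply: eq_esum => m _; rewrite muleC.
  by move=> i; rewrite mule_ge0 ?chain_sum_ge0 ?lee_fin ?qX_ge0.
rewrite (@esum_exchange _ _ _ _ setT (fun m => [set l | interlaces l m])).
- apply: eq_esum => m _.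
  transitivity (\esum_(l in [set l | interlaces l m]) (chain_sum a.+1 k m *
      ((q ^+ (a * (sz l - sz m)))%:E * chain_sum b N l))).
    by apply: eq_esum => l _; rewrite muleA; congr (_ * _); rewrite muleC.
  rewrite esumZl ?chain_sum_ge0//; last first.
    by move=> i; rewrite mule_ge0 ?chain_sum_ge0 ?lee_fin ?qX_ge0.
  by rewrite chain_sum_eigen// muleCA.
- by move=> l m /=; tauto.
- by move=> l m; rewrite !mule_ge0 ?chain_sum_ge0 ?lee_fin ?qX_ge0.
Qed.

Lemma chain_sumE b k l : chain_sum b k l =
  \esum_(c in chains k l) (q ^+ (\sum_(j < k) (b + j) * (sz (c j) - sz (c j.+1))))%:E.
Proof.
elim: k b l => [|k IH] b l.
  rewrite /=; case: asboolP => [->|l0].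
    rewrite (_ : chains _ _ = [set (fun _ _ => 0%N)]).
      by rewrite esum_set1 big_ord0 expr0.
    apply/seteqP; split=> [c [_ _ h]|c /= ->]; first by apply/funext => i; exact: h.
    by split=> // i j.
  rewrite (_ : chains _ _ = set0) ?esum_set0//.
  by apply/seteqP; split=> // c [c0 _ h]; case: l0; rewrite -c0; exact: h.
rewrite /=.
transitivity (\esum_(m in [set m | interlaces l m]) \esum_(c in chains k m)
   ((q ^+ (b * (sz l - sz m)))%:E *
    (q ^+ (\sum_(j < k) (b.+1 + j) * (sz (c j) - sz (c j.+1))))%:E)).
  apply: eq_esum => m _; rewrite IH esumZl ?lee_fin ?qX_ge0//.
  by move=> c; rewrite lee_fin qX_ge0.
rewrite esum_esum; last by move=> *; rewrite mule_ge0// lee_fin qX_ge0.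
apply/esym; apply: (@esum_bij R _ _ _ _ (fun mc j => if j is i.+1 then mc.2 i else l)
    (fun c => (c 1%N, fun j => c j.+1))).
- move=> [m c] [/= lm [c0 cc ck]]; split=> //.
  + by move=> [|i] //=; rewrite c0.
  + by move=> [|i] // /ck.
- move=> c [<- cc ck]; split=> /=; first exact: cc.
  by split=> // i ki; rewrite ck.
- by move=> [m c] [/= lm [<- cc ck]].
- by move=> c [/= <- cc ck]; apply/funext => -[|j].
- move=> [m c] [/= lm [c0 cc ck]]; rewrite -EFinM -exprD big_ord_recl addn0.
  congr ((_ ^+ (_ + _))%:E); first by rewrite /= c0.
  apply: eq_bigr => i _.
  by rewrite lift0 /= addSn addnS.
Qed.

End Cauchy.

(** * MacMahon's formula for plane partitions in a square *)

Definition pp_square (N : nat) : set (nat -> nat -> nat) :=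
  [set p | [/\ forall j k, (p j k.+1 <= p j k)%N, forall j k, (p j.+1 k <= p j k)%N
    & forall j k, (N <= j)%N || (N <= k)%N -> p j k = 0%N]].

Definition square_sum (N : nat) (p : nat -> nat -> nat) : nat :=
  \sum_(j < N) \sum_(k < N) p j k.

Lemma sum_ord_shift (N j : nat) (g : nat -> nat) : (forall k, (N <= k)%N -> g k = 0%N) ->
  (\sum_(k < N | (j <= k)%N) g k = \sum_(d < N) g (d + j))%N.
Proof.
move=> gN; elim: j => [|j IH]; first by apply: eq_big => // i _; rewrite addn0.
have [Nj|jN] := leqP N j.
  by rewrite !big1// => i; [move=> _; apply: gN; lia | have := ltn_ord i; lia].
move: IH; rewrite (bigD1 (Ordinal jN)) //=.
rewrite (eq_bigl (fun k : 'I_N => (j.+1 <= k)%N)); last first.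
  by move=> k; rewrite -val_eqE /=; lia.
move=> IH.
have : (\sum_(d < N.+1) g (d + j) = g j + \sum_(d < N) g (d + j.+1))%N.
  rewrite big_ord_recl add0n; congr addn; apply: eq_bigr => i _.
  by rewrite lift0 addnS addSn.
by rewrite big_ord_recr /= gN ?addn0; last lia; rewrite -IH => /eqP; rewrite eqn_add2l => /eqP.
Qed.

Lemma square_sum_diag (N : nat) (p : nat -> nat -> nat) :
  (forall j k, (N <= j)%N || (N <= k)%N -> p j k = 0%N) ->
  square_sum N p = (\sum_(d < N) \sum_(i < N) p i (d + i) +
                    \sum_(d < N) \sum_(i < N) p (d + i.+1) i)%N.
Proof.
move=> pN; rewrite /square_sum.
under eq_bigr => j _ do rewrite (bigID (fun k : 'I_N => (j <= k)%N)) /=.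
rewrite big_split /=; congr addn.
  rewrite [RHS]exchange_big /=; apply: eq_bigr => j _.
  by rewrite -(@sum_ord_shift N j (p j)) // => k Nk; apply: pN; rewrite Nk orbT.
under eq_bigr => j _ do rewrite big_mkcond /=.
rewrite exchange_big /= [RHS]exchange_big /=; apply: eq_bigr => k _.
rewrite -big_mkcond /= -(@sum_ord_shift N k.+1 (p^~ k)); last first.
  by move=> j Nj; apply: pN; rewrite Nj.
by apply: eq_bigl => j; rewrite -ltnNge.
Qed.

Section MacMahonSquare.
Context {R : realType}.
Variable (q : R).
Hypothesis q01 : (0 <= q < 1)%R.

Lemma pp_square_chains N p : pp_square N p ->
  chains N (fun i => p i i) (fun d i => p i (d + i)%N) /\
  chains N (fun i => p i i) (fun d i => p (d + i)%N i).
Proof.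
case=> pc pr pN; split; split=> //.
- move=> d i; rewrite addSn pc /=; apply: leq_trans (pr _ _) _.
  by rewrite addnS.
- by move=> d Nd; apply/funext => i; apply: pN; apply/orP; right; lia.
- by move=> d i; rewrite addSn pr /=; apply: leq_trans (pc _ _) _; rewrite addnS.
- by move=> d Nd; apply/funext => i; apply: pN; apply/orP; left; lia.
Qed.

(** The entry at [(j, k)] is entry number [min j k] of the diagonal at distance [|j - k|] from the
    main one. *)
Definition glue_chains (c d : nat -> nat -> nat) (j k : nat) : nat :=
  if (j <= k)%N then c (k - j)%N j else d (j - k)%N k.

Lemma glue_chainsP N l c d : chains N l c -> chains N l d -> pp_square N (glue_chains c d).
Proof.
move=> hc hd; have := hc; have := hd; move=> [d0 dd dk] [c0 cc ck]; rewrite /glue_chains; split.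
- move=> j k; have [jk|kj] := leqP j k.
    rewrite (leq_trans jk)// subSn//; by case/andP: (cc (k - j)%N j).
  move: kj; rewrite leq_eqVlt => /orP[/eqP <-|kj].
    rewrite leqnn subnn c0 -d0 subSnn; by case/andP: (dd 0%N k).
  rewrite [(j <= k.+1)%N]leqNgt kj /=; have := dd (j - k.+1)%N k.
  by rewrite (_ : (j - k.+1).+1 = j - k)%N => [/andP[]|]; lia.
- move=> j k; have [kj|jk] := leqP k j.
    rewrite subSn//; have /andP[dle _] := dd (j - k)%N k.
    move: kj; rewrite leq_eqVlt => /orP[/eqP kj|kj]; last by rewrite [(j <= k)%N]leqNgt kj.
    by rewrite kj leqnn; move: dle; rewrite kj subnn d0 c0.
  rewrite (ltnW jk); have := cc (k - j.+1)%N j.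
  by rewrite (_ : (k - j.+1).+1 = k - j)%N => [/andP[]|]; lia.
- move=> j k h; have [jk|kj] := leqP j k.
    by apply: (chains_supp (i := (k - j)%N) hc); lia.
  by apply: (chains_supp (i := (j - k)%N) hd); lia.
Qed.

(** Cutting along the main diagonal turns the left side into pairs of chains with a common start.
    The chain below the diagonal is weighted with [b = 0] and the one above with [b = 1], so the
    main diagonal is counted once. *)
Lemma esum_pp_square N : \esum_(p in pp_square N) (q ^+ square_sum N p)%:E
  = (\prod_(i < N) \prod_(j < N) (1 - q ^+ (i + j).+1)^-1)%:E.
Proof.
(* The exponent [i + j + 1] is that of Cauchy's identity for the starting weights [a = 0] and
   [b = 1]. *)
have -> : (\prod_(i < N) \prod_(j < N) (1 - q ^+ (i + j).+1)^-1)%R =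
   (\prod_(i < N) \prod_(j < N) (1 - q ^+ (0 + 1 + i + j))^-1)%R.
  by apply: eq_bigr => i _; apply: eq_bigr => j _; rewrite add0n add1n addSn.
rewrite -(chain_sum_cauchy q01 N (leqnn N))//.
pose w b (c : nat -> nat -> nat) := (\sum_(j < N) (b + j) * (psize N.+1 (c j) - psize N.+1 (c j.+1)))%N.
transitivity (\esum_(l in [set: nat -> nat]) \esum_(x in chains N l `*`` (fun=> chains N l))
    (q ^+ (w 0%N x.1 + w 1%N x.2))%:E); last first.
  apply: eq_esum => l _; rewrite [in RHS]chain_sumE// muleC -esumZl ?chain_sum_ge0//; last first.
    by move=> c; rewrite lee_fin qX_ge0.
  transitivity (\esum_(c in chains N l) \esum_(d in chains N l) (q ^+ (w 0%N c + w 1%N d))%:E).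
    by rewrite esum_esum// => *; rewrite lee_fin qX_ge0.
  apply: eq_esum => c _; rewrite chain_sumE// muleC -esumZl ?lee_fin ?qX_ge0//; last first.
    by move=> d; rewrite lee_fin qX_ge0.
  by apply: eq_esum => d _; rewrite -EFinM exprD.
rewrite esum_esum; last by move=> *; rewrite lee_fin qX_ge0.
apply: (@esum_bij R _ _ _ _ (fun x => glue_chains x.2.2 x.2.1)
   (fun p => (fun i => p i i, (fun d i => p (d + i)%N i, fun d i => p i (d + i)%N)))).
- by move=> [l [c d]] [/= _ [hc hd]]; exact: glue_chainsP hd hc.
- by move=> p /pp_square_chains[].
- move=> [l [c d]] [/= _ [[c0 cc ck] [d0 dd dk]]]; rewrite /glue_chains.
  congr (_, (_, _)).
  + by apply/funext => i; rewrite leqnn subnn d0.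
  + apply/funext => i; apply/funext => j; rewrite addnK.
    case: i => [|i]; first by rewrite add0n leqnn subnn c0 d0.
    by rewrite leqNgt addSn ltnS leq_addl.
  + by apply/funext => i; apply/funext => j; rewrite leq_addl addnK.
- move=> p _; apply/funext => j; apply/funext => k; rewrite /glue_chains /=.
  by case: leqP => [jk|/ltnW kj]; rewrite subnK.
- move=> [l [c d]] [/= _ [hc hd]]; congr ((_ ^+ _)%:E).
  rewrite /w (chain_weight N.+1 0 hc) (chain_weight N.+1 1 hd) mul0n mul1n add0n.
  rewrite square_sum_diag; last by case: (glue_chainsP hd hc).
  have [c0 cc ck] := hc; have [d0 dd dk] := hd.
  have sN e i : chains N l e -> psize N.+1 (e i) = (\sum_(j < N) e i j)%N.
    move=> he; rewrite /psize big_ord_recr /= (chains_supp (i := i) he) ?addn0//.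
    by lia.
  rewrite addnC; congr addn.
    apply: eq_bigr => e _; rewrite (sN c)//; apply: eq_bigr => i _.
    rewrite /glue_chains ifF; last by lia.
    by congr (c _ _); lia.
  transitivity (\sum_(e < N) psize N.+1 (d e))%N.
    apply: eq_bigr => e _; rewrite (sN d)//; apply: eq_bigr => i _.
    by rewrite /glue_chains leq_addl addnK.
  have : (\sum_(e < N.+1) psize N.+1 (d e) =
          psize N.+1 (d 0%N) + \sum_(e < N) psize N.+1 (d e.+1))%N.
    by rewrite big_ord_recl; congr addn; apply: eq_bigr => i _; rewrite lift0.
  by rewrite big_ord_recr /= (sN d)// dk// big1_eq addn0.
Qed.

(** By [plane_partition_bound] the support lies in the corner of side [n], hence in every square of
    side [N >= n], whichever bound witnesses [plane_partition]. *)
Lemma plane_partition_square n N p : (n <= N)%N ->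
  plane_partition n p <-> pp_square N p /\ square_sum N p = n.
Proof.
have widen (K L : nat) (f : nat -> nat) : (forall k, (K <= k)%N -> f k = 0%N) -> (K <= L)%N ->
    (\sum_(k < K) f k = \sum_(k < L) f k)%N.
  move=> fK KL; rewrite (big_ord_widen L f KL) [RHS](bigID (fun i : 'I_L => (i < K)%N)) /=.
  by rewrite [X in (_ = _ + X)%N]big1 ?addn0// => i; rewrite -leqNgt => /fK.
have sq (K L : nat) : (K <= L)%N -> (forall j k, (K <= j)%N || (K <= k)%N -> p j k = 0%N) ->
    square_sum K p = square_sum L p.
  move=> KL pK; rewrite /square_sum (widen K L (fun j => \sum_(k < K) p j k)%N)//.
    apply: eq_bigr => j _; apply: widen => // k Kk; apply: pK; rewrite Kk orbT//.
  by move=> j Kj; rewrite big1// => k _; apply: pK; rewrite Kj.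
move=> nN; split=> [pp_n|[[pc pr pN] psum]]; last by split=> //; exists N.
have pn j k : (n <= j)%N || (n <= k)%N -> p j k = 0%N.
  move=> h; apply: contrapT => pjk.
  by have [jn kn _] := plane_partition_bound pp_n pjk; lia.
have [pc pr [K [pK sumK]]] := pp_n.
have pN j k : (N <= j)%N || (N <= k)%N -> p j k = 0%N by move=> h; apply: pn; lia.
split=> //; rewrite -sumK -/(square_sum K p).
have pmin j k : (minn K N <= j)%N || (minn K N <= k)%N -> p j k = 0%N.
  move=> h; have [/pK//|/pN//] : (K <= j)%N || (K <= k)%N \/ (N <= j)%N || (N <= k)%N.
  by lia.
by rewrite -(sq _ _ (geq_minr K N) pmin) (sq _ _ (geq_minl K N) pmin).
Qed.

Definition pp_fiber (N n : nat) : set (nat -> nat -> nat) :=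
  [set p | pp_square N p /\ square_sum N p = n].

Lemma pp_fiberE N n : (n <= N)%N -> [set p | plane_partition n p] = pp_fiber N n.
Proof.
by move=> nN; apply/seteqP; split=> p /=; rewrite (plane_partition_square _ nN).
Qed.

Lemma pp_fiber_sub N n : pp_fiber N n `<=` [set p | plane_partition n p].
Proof. by move=> p [[pc pr pN] psum]; split=> //; exists N. Qed.

Lemma esum_plane_partition n (x : R) : (0 <= x)%R ->
  \esum_(p in [set p | plane_partition n p]) x%:E = ((pp n)%:R * x)%:E.
Proof.
move=> x0; rewrite esum_fset//; last exact: finite_plane_partitions.
rewrite fsbig_finite//=; last exact: finite_plane_partitions.
by rewrite sumEFin big_const_seq count_predT iter_addr addr0 mulr_natl.
Qed.

Lemma esum_pp_square_fibers N : \esum_(p in pp_square N) (q ^+ square_sum N p)%:E =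
  \esum_(n in [set: nat]) \esum_(p in pp_fiber N n) (q ^+ n)%:E.
Proof.
rewrite esum_esum; last by move=> *; rewrite lee_fin qX_ge0.
apply: (@esum_bij R _ _ _ _ (fun x => x.2) (fun p => (square_sum N p, p))) => //=.
- by move=> [n p] /= [_ []].
- by move=> [n p] /= [_ [_ <-]].
- by move=> [n p] /= [_ [_ <-]].
Qed.

(** Every plane partition of [n <= N] fits into the square of side [N]. Together with the next
    lemma, this brackets the generating function between finite products, so no infinite product has
    to be formed. *)
Lemma sum_pp_le N : (\sum_(n < N.+1) (pp n)%:R * q ^+ n <=
  \prod_(i < N) \prod_(j < N) (1 - q ^+ (i + j).+1)^-1)%R.
Proof.
rewrite -lee_fin -esum_pp_square esum_pp_square_fibers.
apply: esum_ge; exists `I_N.+1; first by split=> //; exact: finite_II.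
rewrite -fsbig_ord -sumEFin; apply: lee_sum => n _.
by rewrite -pp_fiberE ?esum_plane_partition ?qX_ge0// -ltnS.
Qed.

Lemma prod_le_sum_pp N (B : R) :
  (forall K, (\sum_(n < K) (pp n)%:R * q ^+ n <= B)%R) ->
  (\prod_(i < N) \prod_(j < N) (1 - q ^+ (i + j).+1)^-1 <= B)%R.
Proof.
move=> sumB; rewrite -lee_fin -esum_pp_square esum_pp_square_fibers.
rewrite -nneseries_esumT; last by move=> n; apply: esum_ge0 => p _; rewrite lee_fin qX_ge0.
apply: lime_le.
  by apply: is_cvg_nneseries => n _ _; apply: esum_ge0 => p _; rewrite lee_fin qX_ge0.
apply: nearW => K; apply: le_trans (_ : (\sum_(n < K) (pp n)%:R * q ^+ n)%:E <= _); last first.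
  by rewrite lee_fin.
rewrite big_mkord -sumEFin; apply: lee_sum => n _.
rewrite -esum_plane_partition ?qX_ge0//.
rewrite -(setIidr (@pp_fiber_sub N n)) esum_mkcondr.
by apply: le_esum => p _; case: ifP => // _; rewrite lee_fin qX_ge0.
Qed.

End MacMahonSquare.

(** * Transfer to the Stdlib reals *)

Import Rstruct.
Delimit Scope R_scope with coqR.

Lemma sum_f_R0_ord (f : nat -> R) (n : nat) : sum_f_R0 f n = (\sum_(k < n.+1) f k)%R.
Proof. by rewrite sum_f_R0E big_mkord. Qed.

Lemma prod_geometric_exp (q : R) (N : nat) : (0 <= q < 1)%coqR ->
  (\prod_(i < N.+1) \prod_(j < N.+1) (1 - q ^+ (i + j).+1)^-1)%R =
  exp (sum_f_R0 (fun i => sum_f_R0 (fun j => (- ln (1 - q ^ (S (i + j))))%coqR) N) N).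
Proof.
move=> q01; rewrite sum_f_R0_ord (big_morph exp (id1 := 1%R) (op1 := *%R)); last 2 first.
- exact: exp_plus.
- exact: exp_0.
apply: eq_bigr => i _; rewrite sum_f_R0_ord (big_morph exp (id1 := 1%R) (op1 := *%R)); last 2 first.
- exact: exp_plus.
- exact: exp_0.
apply: eq_bigr => j _; rewrite exp_Ropp exp_ln; first by rewrite RinvE RpowE.
have := pow_lt_1_compat q (S (i + j)) q01 (PeanoNat.Nat.lt_0_succ _).
by move=> [_ h]; exact: (Rlt_Rminus _ _ h).
Qed.

Lemma sum_pp_le_exp (q : R) (N : nat) : (0 <= q < 1)%coqR ->
  (sum_f_R0 (fun n => INR (pp n) * q ^ n)%coqR N <=
   exp (sum_f_R0 (fun i => sum_f_R0 (fun j => (- ln (1 - q ^ (S (i + j))))%coqR) N) N))%coqR.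
Proof.
move=> q01; have q01' : (0 <= q < 1)%R.
  by case: q01 => h1 h2; apply/andP; split; [apply/RleP | apply/RltP].
rewrite -prod_geometric_exp// sum_f_R0_ord; apply/RleP.
rewrite (eq_bigr (fun n : 'I_N.+1 => (pp n)%:R * q ^+ n)%R); last first.
  by move=> n _; rewrite INRE RpowE.
apply: le_trans (sum_pp_le q01' N.+1).
by rewrite [leRHS]big_ord_recr /= lerDl mulr_ge0// qX_ge0.
Qed.

Lemma exp_le_sum_pp (q : R) (N : nat) (B : R) : (0 <= q < 1)%coqR ->
  (forall K, (sum_f_R0 (fun n => INR (pp n) * q ^ n)%coqR K <= B)%coqR) ->
  (exp (sum_f_R0 (fun i => sum_f_R0 (fun j => (- ln (1 - q ^ (S (i + j))))%coqR) N) N) <= B)%coqR.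
Proof.
move=> q01 sumB; have q01' : (0 <= q < 1)%R.
  by case: q01 => h1 h2; apply/andP; split; [apply/RleP | apply/RltP].
rewrite -prod_geometric_exp//; apply/RleP; apply: prod_le_sum_pp => // K.
apply: le_trans (_ : (\sum_(n < K.+1) (pp n)%:R * q ^+ n <= B)%R).
  by rewrite [leRHS]big_ord_recr /= lerDl mulr_ge0// qX_ge0.
have /RleP := sumB K; rewrite sum_f_R0_ord.
by under eq_bigr => n _ do rewrite INRE RpowE.
Qed.

End PlanePartitionSum.

(** * The generating function as an exponential *)

Lemma exp_le_compat (x y : R) : x <= y -> exp x <= exp y.
Proof. intros [H| ->]; [left; now apply exp_increasing|lra]. Qed.

Lemma sum_le_is_series (a : nat -> R) (l : R) (N : nat) :
  (forall n, 0 <= a n) -> is_series a l -> sum_f_R0 a N <= l.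
Proof.
  intros Ha Hl. rewrite <- sum_n_Reals.
  refine (is_lim_seq_incr_compare (sum_n a) l Hl _ N).
  intro n. rewrite sum_Sn. unfold plus; simpl. specialize (Ha (S n)). lra.
Qed.

Lemma is_series_lub (a : nat -> R) (l : R) :
  (forall n, 0 <= a n) -> (forall N, sum_f_R0 a N <= l) ->
  (forall B, (forall N, sum_f_R0 a N <= B) -> l <= B) -> is_series a l.
Proof.
  intros Ha Hle Hlub.
  destruct (ex_finite_lim_seq_incr (sum_n a) l) as [l' Hl'].
  - intro n. rewrite sum_Sn. unfold plus; simpl. specialize (Ha (S n)). lra.
  - intro n. rewrite sum_n_Reals. apply Hle.
  - assert (Hs : is_series a l') by exact Hl'.
    assert (l <= l') by (apply Hlub; intro N; now apply sum_le_is_series).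
    assert (Rbar_le l' l).
    { apply (is_lim_seq_le (sum_n a) (fun _ => l) l' l).
      intro n; rewrite sum_n_Reals; apply Hle. exact Hl'. apply is_lim_seq_const. }
    simpl in H0. replace l with l' by lra. exact Hs.
Qed.

Lemma is_series_bounded (a : nat -> R) (B : R) :
  (forall n, 0 <= a n) -> (forall N, sum_f_R0 a N <= B) ->
  exists l, is_series a l /\ l <= B.
Proof.
  intros Ha Hle.
  destruct (ex_finite_lim_seq_incr (sum_n a) B) as [l Hl].
  - intro n. rewrite sum_Sn. unfold plus; simpl. specialize (Ha (S n)). lra.
  - intro n. rewrite sum_n_Reals. apply Hle.
  - exists l. split; [exact Hl|].
    apply (is_lim_seq_le (sum_n a) (fun _ => B) l B).
    intro n; rewrite sum_n_Reals; apply Hle. exact Hl. apply is_lim_seq_const.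
Qed.

Lemma is_series_sum_f (a : nat -> nat -> R) (s : nat -> R) (K : nat) :
  (forall k, is_series (a k) (s k)) ->
  is_series (fun m => sum_f_R0 (fun k => a k m) K) (sum_f_R0 s K).
Proof.
  intro Hs. induction K as [|K IH]; simpl.
  - apply (is_series_ext (a 0%nat)); [easy|apply Hs].
  - apply (is_series_plus _ (a (S K)) _ (s (S K)) IH (Hs (S K))).
Qed.

Lemma is_series_le (a b : nat -> R) (la lb : R) :
  (forall n, a n <= b n) -> is_series a la -> is_series b lb -> la <= lb.
Proof.
  intros Hab Ha Hb.
  apply (is_lim_seq_le (sum_n a) (sum_n b) la lb); [|exact Ha|exact Hb].
  intro n. rewrite !sum_n_Reals. apply sum_Rle. intros; apply Hab.
Qed.

Lemma tonelli_aux (a : nat -> nat -> R) (r s : nat -> R) (A : R) :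
  (forall m k, 0 <= a m k) -> (forall m, is_series (a m) (r m)) ->
  is_series r A -> (forall k, is_series (fun m => a m k) (s k)) ->
  exists l, is_series s l /\ l <= A.
Proof.
  intros Ha Hr HA Hs. apply is_series_bounded.
  - intro k. apply Rle_trans with (sum_f_R0 (fun m => a m k) 0); [simpl; apply Ha|].
    apply sum_le_is_series; [intro; apply Ha|apply Hs].
  - intro K.
    apply (is_series_le (fun m => sum_f_R0 (fun k => a m k) K) r).
    + intro m. apply sum_le_is_series; auto.
    + apply (is_series_sum_f (fun k m => a m k)). exact Hs.
    + exact HA.
Qed.

(** A finite number of columns can be summed against the rows, so the column total is at most the
    row total; exchanging the roles gives equality. *)
Lemma tonelli (a : nat -> nat -> R) (r s : nat -> R) (A : R) :
  (forall m k, 0 <= a m k) -> (forall m, is_series (a m) (r m)) ->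
  is_series r A -> (forall k, is_series (fun m => a m k) (s k)) -> is_series s A.
Proof.
  intros Ha Hr HA Hs.
  destruct (tonelli_aux a r s A Ha Hr HA Hs) as [l [Hl Hle]].
  destruct (tonelli_aux (fun k m => a m k) s r l (fun k m => Ha m k) Hs Hl Hr) as [A' [HA' Hle']].
  assert (A = A') by (rewrite <- (is_series_unique _ _ HA), <- (is_series_unique _ _ HA'); easy).
  replace A with l by lra. exact Hl.
Qed.

Lemma is_series_multiples (d : nat) (f : nat -> R) (l : R) : (0 < d)%nat ->
  is_series f l ->
  is_series (fun n => if Nat.eqb (n mod d) 0 then f (n / d)%nat else 0) l.
Proof.
  intros Hd Hf.
  assert (Hsum : forall N, sum_f_R0 (fun n => if Nat.eqb (n mod d) 0 then f (n / d)%nat else 0) N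
    = sum_f_R0 f (N / d)).
  { induction N as [|N IH].
    - rewrite Nat.Div0.div_0_l. simpl. rewrite Nat.Div0.mod_0_l, Nat.Div0.div_0_l. easy.
    - rewrite tech5, IH.
      pose proof (Nat.div_mod N d ltac:(lia)) as E. pose proof (Nat.mod_upper_bound N d ltac:(lia)) as Hr.
      destruct (Nat.eqb_spec (S N mod d) 0) as [H0|H0].
      + pose proof (Nat.div_mod (S N) d ltac:(lia)) as E'. rewrite H0 in E'.
        replace (S N / d)%nat with (S (N / d))%nat; [now rewrite tech5|].
        assert (d * (S N / d) = d * (N / d) + S (N mod d))%nat by lia.
        assert (S (N mod d) = d)%nat.
        { destruct (Nat.eq_dec (S (N mod d)) d) as [e|ne]; [exact e|].
          exfalso. apply ne.
          assert ((S N / d) = (N / d))%nat by (symmetry; apply (Nat.div_unique (S N) d (N/d) (S (N mod d))); lia).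
          rewrite H1 in H. lia. }
        nia.
      + replace (S N / d)%nat with (N / d)%nat; [ring|].
        apply (Nat.div_unique (S N) d (N / d) (S (N mod d))); [|lia].
        destruct (Nat.eq_dec (S (N mod d)) d) as [e|ne]; [|lia].
        exfalso; apply H0. symmetry. apply (Nat.mod_unique (S N) d (S (N / d)) 0); lia. }
  refine (is_lim_seq_ext (fun N => sum_n f (N / d)) _ l _ _).
  - intro N. now rewrite !sum_n_Reals, Hsum.
  - refine (is_lim_seq_subseq (sum_n f) l (fun N => (N / d)%nat) _ Hf).
    intros P [M HM]. exists (M * d)%nat. intros n Hn. apply HM.
    apply Nat.div_le_lower_bound; lia.
Qed.

Lemma radius_gt_r (a : nat -> R) (r x : R) :
  (forall q, 0 <= q < r -> ex_series (fun n => a n * q ^ n)) ->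
  Rabs x < r -> Rbar_lt (Rabs x) (CV_radius a).
Proof.
  intros Ha Hx. set (q := (Rabs x + r) / 2).
  assert (Hq : 0 <= Rabs x < q /\ q < r) by (pose proof (Rabs_pos x); unfold q; lra).
  apply Rbar_lt_le_trans with q; [simpl; lra|].
  apply Rbar_not_lt_le. intro H. apply (CV_disk_outside a q).
  - rewrite Rabs_pos_eq by lra. exact H.
  - apply ex_series_lim_0, Ha. lra.
Qed.

Lemma radius_gt (a : nat -> R) (x : R) :
  (forall q, 0 <= q < 1 -> ex_series (fun n => a n * q ^ n)) ->
  Rabs x < 1 -> Rbar_lt (Rabs x) (CV_radius a).
Proof. apply radius_gt_r. Qed.

Lemma is_derive_zero_eq (f : R -> R) (b : R) : 0 <= b ->
  (forall t, 0 <= t <= b -> is_derive f t 0) -> f b = f 0.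
Proof.
  intros Hb Hf. destruct (Rle_lt_or_eq_dec 0 b Hb) as [H|<-]; [|easy].
  symmetry. apply (eq_is_derive f 0 b); [exact Hf|exact H].
Qed.

(** * The logarithm of MacMahon's product as a power series *)

(** The value 0 at [n = 0] lets sums over [n >= 1] be written as series and power series indexed
    from 0. *)
Definition harmonic_coef (n : nat) : R := match n with O => 0 | S _ => / INR n end.

Lemma ex_series_harmonic_coef (q : R) : 0 <= q < 1 ->
  ex_series (fun n => harmonic_coef n * q ^ n).
Proof.
  intro Hq. apply (ex_series_le (V := R_CompleteNormedModule)) with (fun n => q ^ n).
  - intro n. unfold norm; simpl; unfold abs; simpl.
    rewrite Rabs_mult, (Rabs_pos_eq (q ^ n)) by (apply pow_le; lra).
    rewrite <- (Rmult_1_l (q ^ n)) at 2. apply Rmult_le_compat_r; [apply pow_le; lra|].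
    destruct n; unfold harmonic_coef; [rewrite Rabs_R0; lra|].
    assert (1 <= INR (S n)) by (apply (le_INR 1); lia).
    rewrite Rabs_pos_eq; [|left; apply Rinv_0_lt_compat; lra].
    rewrite <- Rinv_1. apply Rinv_le_contravar; lra.
  - apply ex_series_geom. rewrite Rabs_pos_eq; lra.
Qed.

Lemma PS_derive_harmonic_coef (n : nat) : PS_derive harmonic_coef n = 1.
Proof. unfold PS_derive, harmonic_coef. apply Rinv_r. apply not_0_INR. lia. Qed.

(** The power series and [- ln (1 - t)] have the same derivative, the geometric series, and agree at
    0. *)
Lemma is_series_ln (q : R) : 0 <= q < 1 ->
  is_series (fun n => harmonic_coef n * q ^ n) (- ln (1 - q)).
Proof.
  intro Hq.
  assert (Hrad : forall x, Rabs x < 1 -> Rbar_lt (Rabs x) (CV_radius harmonic_coef))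
    by (intros x Hx; apply radius_gt; [apply ex_series_harmonic_coef|exact Hx]).
  assert (E : PSeries harmonic_coef q + ln (1 - q) = PSeries harmonic_coef 0 + ln (1 - 0)).
  { apply (is_derive_zero_eq (fun t => PSeries harmonic_coef t + ln (1 - t))); [lra|].
    intros t Ht.
    assert (Hat : Rabs t < 1) by (rewrite Rabs_pos_eq; lra).
    replace 0 with (/ (1 - t) + - / (1 - t)) by ring.
    apply (is_derive_plus (V := R_NormedModule)).
    - replace (/ (1 - t)) with (PSeries (PS_derive harmonic_coef) t).
      + apply is_derive_PSeries. now apply Hrad.
      + rewrite (PSeries_ext _ (fun _ => 1)) by apply PS_derive_harmonic_coef.
        apply is_series_unique. apply is_series_ext with (2 := is_series_geom t Hat).
        intro n. now rewrite Rmult_1_l.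
    - auto_derive; [lra|]. field. lra. }
  rewrite PSeries_0 in E. simpl in E. rewrite Rminus_0_r, ln_1 in E.
  replace (- ln (1 - q)) with (PSeries harmonic_coef q) by lra.
  unfold PSeries. apply Series_correct.
  apply ex_pseries_R, CV_radius_inside, Hrad. rewrite Rabs_pos_eq; lra.
Qed.

(* [n * sig_coef n] is the sum of the squares of the divisors of [n]. *)
Definition sig_term (n m : nat) : R :=
  if Nat.eqb (n mod S m) 0 then INR (S m) * INR (S m) * harmonic_coef n else 0.

Definition sig_coef (n : nat) : R := sum_f_R0 (sig_term n) n.

Lemma harmonic_coef_ge0 (n : nat) : 0 <= harmonic_coef n.
Proof. destruct n; simpl; [lra|]. left. apply Rinv_0_lt_compat, (lt_0_INR (S n)). lia. Qed.

Lemma sig_term_ge0 (n m : nat) : 0 <= sig_term n m.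
Proof.
  unfold sig_term. destruct (Nat.eqb _ 0); [|lra].
  pose proof (pos_INR (S m)). pose proof (harmonic_coef_ge0 n).
  apply Rmult_le_pos; [nra|easy].
Qed.

Lemma sum_f_R0_ge_term (a : nat -> R) (N k : nat) :
  (forall n, 0 <= a n) -> (k <= N)%nat -> a k <= sum_f_R0 a N.
Proof.
  intros Ha Hk. induction N as [|N IH].
  - replace k with 0%nat by lia. simpl. lra.
  - simpl. pose proof (Ha (S N)). destruct (Nat.eq_dec k (S N)) as [->|Hne].
    + assert (0 <= sum_f_R0 a N) by (apply cond_pos_sum; intro; apply Ha). lra.
    + specialize (IH ltac:(lia)). lra.
Qed.

(** The divisor [n] alone contributes [n^2 / n]. The decay of the generating function off the real
    axis rests on this bound. *)
Lemma sig_coef_ge (n : nat) : INR n <= sig_coef n.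
Proof.
  destruct n as [|n].
  - simpl. apply cond_pos_sum. intro; apply sig_term_ge0.
  - apply Rle_trans with (sig_term (S n) n).
    + unfold sig_term. rewrite Nat.Div0.mod_same. simpl (Nat.eqb 0 0).
      unfold harmonic_coef. cbv iota. apply Req_le. field. apply not_0_INR. lia.
    + apply sum_f_R0_ge_term; [intro; apply sig_term_ge0|lia].
Qed.

Lemma sig_coef_ge0 (n : nat) : 0 <= sig_coef n.
Proof. apply Rle_trans with (2 := sig_coef_ge n). apply pos_INR. Qed.

Lemma sig_coef_0 : sig_coef 0 = 0.
Proof. unfold sig_coef, sig_term; simpl. ring. Qed.

Lemma is_series_finite (a : nat -> R) (N : nat) :
  (forall n, (N < n)%nat -> a n = 0) -> is_series a (sum_f_R0 a N).
Proof.
  intro Ha.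
  refine (is_lim_seq_ext_loc (fun _ => sum_f_R0 a N) (sum_n a) _ _ (is_lim_seq_const _)).
  exists N. intros n Hn. rewrite sum_n_Reals.
  induction Hn as [|n Hn IH]; [easy|]. simpl. rewrite <- IH, Ha by lia. ring.
Qed.

Definition pp_log_term (q : R) (m : nat) : R := INR (S m) * - ln (1 - q ^ S m).

Lemma pow_S_01 (q : R) (m : nat) : 0 <= q < 1 -> 0 <= q ^ S m < 1.
Proof. intro Hq. apply pow_lt_1_compat; [exact Hq|lia]. Qed.

Lemma neg_ln_ge0 (t : R) : 0 <= t < 1 -> 0 <= - ln (1 - t).
Proof.
  intro Ht. destruct (Req_dec t 0) as [->|]; [rewrite Rminus_0_r, ln_1; lra|].
  assert (ln (1 - t) < ln 1) by (apply ln_increasing; lra). rewrite ln_1 in H0. lra.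
Qed.

Lemma neg_ln_le (t : R) : 0 <= t < 1 -> - ln (1 - t) <= t / (1 - t).
Proof.
  intro Ht. assert (Hu : 0 <= t / (1 - t)).
  { apply Rmult_le_pos; [lra|]. left; apply Rinv_0_lt_compat; lra. }
  rewrite <- Rpower.ln_Rinv by lra.
  replace (/ (1 - t)) with (1 + t / (1 - t)) by (field; lra).
  generalize dependent (t / (1 - t)). intros u Hu.
  destruct (Req_dec u 0) as [->|]; [rewrite Rplus_0_r, ln_1; lra|].
  left. apply exp_lt_inv. rewrite exp_ln by lra. apply exp_ineq1. lra.
Qed.

Lemma pp_log_term_ge0 (q : R) (m : nat) : 0 <= q < 1 -> 0 <= pp_log_term q m.
Proof.
  intro Hq. apply Rmult_le_pos; [apply pos_INR|]. now apply neg_ln_ge0, pow_S_01.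
Qed.

Lemma ex_series_pow_INR (q : R) : 0 <= q < 1 -> ex_series (fun n => INR (S n) * q ^ n).
Proof.
  intro Hq. assert (H := is_series_geom q ltac:(rewrite Rabs_pos_eq; lra)).
  exists (/ (1 - q) * / (1 - q)).
  refine (is_series_ext _ _ _ _ (is_series_mult_pos _ _ _ _ H H _ _));
    try (intro; apply pow_le; lra).
  intro n. cbv beta.
  rewrite (sum_eq _ (fun _ => q ^ n)).
  - rewrite sum_cte. apply Rmult_comm.
  - intros i Hi. rewrite <- pow_add. f_equal. lia.
Qed.

Lemma ex_series_pp_log (q : R) : 0 <= q < 1 -> ex_series (pp_log_term q).
Proof.
  intro Hq.
  apply (ex_series_le (V := R_CompleteNormedModule)) with
    (fun n => scal (q / (1 - q)) (INR (S n) * q ^ n)).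
  - intro n. unfold norm; simpl; unfold abs; simpl. unfold scal; simpl; unfold mult; simpl.
    rewrite Rabs_pos_eq by (now apply pp_log_term_ge0).
    unfold pp_log_term. pose proof (pow_S_01 q n Hq).
    replace (q / (1 - q) * ((match n with 0%nat => 1 | S _ => INR n + 1 end) * q ^ n))
      with (INR (S n) * (q ^ S n / (1 - q))) by (simpl; field; lra).
    apply Rmult_le_compat_l; [apply pos_INR|].
    apply Rle_trans with (1 := neg_ln_le _ H).
    apply Rmult_le_compat_l; [lra|]. apply Rinv_le_contravar; [lra|].
    simpl. assert (q ^ n <= 1). { rewrite <- (pow1 n). apply pow_incr. lra. }
    assert (0 <= q ^ n) by (apply pow_le; lra). nra.
  - apply (ex_series_scal_l (V := R_NormedModule) (q / (1 - q)) (fun n => INR (S n) * q ^ n)).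
    now apply ex_series_pow_INR.
Qed.

(** Lambert series: the term [- m ln (1 - q^m)] expands into [m q^(m k) / k], and for [n = m k] the
    coefficient is [m^2 / n]. All terms are nonnegative, so the double series may be summed by
    powers of [q]. *)
Lemma is_series_sig_coef (q : R) : 0 <= q < 1 ->
  is_series (fun n => sig_coef n * q ^ n) (Series (pp_log_term q)).
Proof.
  intro Hq.
  apply (tonelli (fun m n => sig_term n m * q ^ n) (pp_log_term q)).
  - intros m n. apply Rmult_le_pos; [apply sig_term_ge0|apply pow_le; lra].
  - intro m.
    assert (Hm := pow_S_01 q m Hq).
    apply is_series_ext with
      (fun n => if Nat.eqb (n mod S m) 0 then
         (fun k => scal (INR (S m)) (harmonic_coef k * (q ^ S m) ^ k)) (n / S m)%nat else 0).
    + intro n. unfold sig_term. destruct (Nat.eqb_spec (n mod S m) 0) as [H0|H0]; [|symmetry; apply Rmult_0_l].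
      assert (En : n = (S m * (n / S m))%nat)
        by (pose proof (Nat.div_mod n (S m) ltac:(lia)); lia).
      clear H0. set (k := (n / S m)%nat) in *. clearbody k. subst n.
      change (INR (S m) * (harmonic_coef k * (q ^ S m) ^ k) =
              INR (S m) * INR (S m) * harmonic_coef (S m * k) * q ^ (S m * k)).
      rewrite pow_mult. generalize ((q ^ S m) ^ k). intro x.
      destruct k as [|k]; [rewrite Nat.mul_0_r; simpl harmonic_coef; ring|].
      assert (E : harmonic_coef (S m * S k) = / INR (S m * S k)) by easy.
      rewrite E, mult_INR. unfold harmonic_coef. field. split; apply not_0_INR; lia.
    + apply (is_series_multiples (S m) (fun k => INR (S m) * (harmonic_coef k * (q ^ S m) ^ k)));
        [lia|].
      apply (is_series_scal_l (INR (S m)) _ (- ln (1 - q ^ S m))). now apply is_series_ln.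
  - apply Series_correct. now apply ex_series_pp_log.
  - intro n.
    apply is_series_ext with (fun m => sig_term n m * q ^ n); [easy|].
    replace (sig_coef n * q ^ n) with (sum_f_R0 (fun m => sig_term n m * q ^ n) n)
      by (unfold sig_coef; rewrite (Rmult_comm _ (q ^ n)); now rewrite scal_sum).
    apply is_series_finite. intros m Hm. unfold sig_term.
    destruct n as [|n]; [destruct (Nat.eqb _ 0); simpl; ring|].
    rewrite Nat.mod_small by lia. simpl. ring.
Qed.

Lemma triangle_sum (g : nat -> R) (N : nat) :
  sum_f_R0 (fun i => sum_f_R0 (fun j => g (i + j)%nat) (N - i)) N =
  sum_f_R0 (fun m => INR (S m) * g m) N.
Proof.
  induction N as [|N IH]; [simpl; ring|].
  rewrite (tech5 _ N), Nat.sub_diag.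
  rewrite (sum_eq _ (fun i => sum_f_R0 (fun j => g (i + j)%nat) (N - i) + g (S N))).
  - rewrite sum_plus, IH, sum_cte, (tech5 _ N). simpl sum_f_R0 at 2.
    rewrite Nat.add_0_r. rewrite (S_INR (S N)). ring.
  - intros i Hi. replace (S N - i)%nat with (S (N - i)) by lia. simpl.
    f_equal. f_equal. lia.
Qed.

Lemma sum_f_R0_le_extend (a : nat -> R) (N M : nat) :
  (forall n, 0 <= a n) -> (N <= M)%nat -> sum_f_R0 a N <= sum_f_R0 a M.
Proof.
  intros Ha HNM. induction HNM as [|M H IH]; [lra|]. simpl. specialize (Ha (S M)). lra.
Qed.

(** There are [m + 1] pairs with [i + j = m], which produces the exponent of each factor. The square
    [i, j <= N] contains the triangle [i + j <= N] and lies in the triangle [i + j <= 2 N], so both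
    finite inequalities pass to the limit. *)
Lemma is_series_pp (q : R) : 0 <= q < 1 ->
  is_series (fun n => INR (pp n) * q ^ n) (exp (Series (pp_log_term q))).
Proof.
  intro Hq. set (g := fun m => - ln (1 - q ^ S m)).
  assert (Hg : forall m, 0 <= g m) by (intro m; now apply neg_ln_ge0, pow_S_01).
  assert (HL := Series_correct _ (ex_series_pp_log q Hq)).
  assert (Hpos := fun m => pp_log_term_ge0 q m Hq).
  apply is_series_lub.
  - intro n. apply Rmult_le_pos; [apply pos_INR|apply pow_le; lra].
  - intro N. apply Rle_trans with (1 := PlanePartitionSum.sum_pp_le_exp N Hq).
    apply exp_le_compat.
    change (sum_f_R0 (fun i => sum_f_R0 (fun j => g (i + j)%nat) N) N <= Series (pp_log_term q)).
    apply Rle_trans with (sum_f_R0 (pp_log_term q) (2 * N)); [|now apply sum_le_is_series].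
    change (sum_f_R0 (pp_log_term q) (2 * N))
      with (sum_f_R0 (fun m => INR (S m) * g m) (2 * N)).
    rewrite <- triangle_sum.
    apply Rle_trans with (sum_f_R0 (fun i => sum_f_R0 (fun j => g (i + j)%nat) (2 * N - i)) N).
    + apply sum_Rle. intros i Hi. apply sum_f_R0_le_extend; [intro; apply Hg|lia].
    + apply sum_f_R0_le_extend; [|lia]. intro i. apply cond_pos_sum. intro; apply Hg.
  - intros B HB. apply Rle_trans with (exp (ln B)); [apply exp_le_compat|].
    + apply (is_lim_seq_le (sum_n (pp_log_term q)) (fun _ => ln B) (Series (pp_log_term q)) (ln B));
        [|exact HL|apply is_lim_seq_const].
      intro N. rewrite sum_n_Reals.
      assert (E := PlanePartitionSum.exp_le_sum_pp N Hq HB).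
      apply Rle_trans with (sum_f_R0 (fun i => sum_f_R0 (fun j => g (i + j)%nat) N) N).
      * change (sum_f_R0 (fun m => INR (S m) * g m) N <=
          sum_f_R0 (fun i => sum_f_R0 (fun j => g (i + j)%nat) N) N).
        rewrite <- triangle_sum. apply sum_Rle. intros i Hi.
        apply sum_f_R0_le_extend; [intro; apply Hg|lia].
      * rewrite <- (ln_exp (sum_f_R0 _ N)). apply ln_le; [apply exp_pos|exact E].
    + rewrite exp_ln; [lra|].
      apply Rlt_le_trans with (2 := PlanePartitionSum.exp_le_sum_pp 0 Hq HB). apply exp_pos.
Qed.

Lemma ex_series_sig_coef (q : R) : 0 <= q < 1 -> ex_series (fun n => sig_coef n * q ^ n).
Proof. intro Hq. exists (Series (pp_log_term q)). now apply is_series_sig_coef. Qed.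

Lemma ex_series_pp (q : R) : 0 <= q < 1 -> ex_series (fun n => INR (pp n) * q ^ n).
Proof. intro Hq. eexists. now apply is_series_pp. Qed.

(** * The exponential formula at complex arguments *)

(** Continuity at 0 kills the constant coefficient; dividing by [x] shifts the next one into its
    place. *)
Lemma PSeries_zero_coef (d : nat -> R) :
  (forall x, Rabs x < 1 -> Rbar_lt (Rabs x) (CV_radius d)) ->
  (forall x, 0 < x < 1 -> PSeries d x = 0) -> forall n, d n = 0.
Proof.
  assert (Hzero : forall d, (forall x, Rabs x < 1 -> Rbar_lt (Rabs x) (CV_radius d)) ->
    (forall x, 0 < x < 1 -> PSeries d x = 0) -> d 0%nat = 0).
  { clear d. intros d Hrad H0. destruct (Req_dec (d 0%nat) 0) as [E|E]; [exact E|exfalso].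
    assert (Hc : continuity_pt (PSeries d) 0)
      by (apply PSeries_continuity, Hrad; rewrite Rabs_R0; lra).
    destruct (Hc (Rabs (d 0%nat)) (Rabs_pos_lt _ E)) as [del [Hdel Hd]].
    set (x := Rmin (del / 2) (1 / 2)).
    assert (Hx : 0 < x < 1 /\ x < del).
    { unfold x. pose proof (Rmin_l (del / 2) (1 / 2)). pose proof (Rmin_r (del / 2) (1 / 2)).
      assert (0 < Rmin (del / 2) (1 / 2)) by (apply Rmin_pos; lra). lra. }
    specialize (Hd x). simpl in Hd. unfold Rdist in Hd.
    rewrite PSeries_0, H0 in Hd by lra.
    rewrite Rminus_0_l, Rabs_Ropp in Hd.
    assert (Rabs (d 0%nat) < Rabs (d 0%nat)); [|lra].
    apply Hd. split.
    - unfold D_x, no_cond. split; [easy|lra].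
    - rewrite Rminus_0_r, Rabs_pos_eq; lra. }
  intros Hrad H0 n. revert d Hrad H0. induction n as [|n IH]; intros d Hrad H0; [now apply Hzero|].
  apply (IH (PS_decr_1 d)).
  - intros x Hx. rewrite CV_radius_decr_1. now apply Hrad.
  - intros x Hx. assert (E := H0 x Hx).
    rewrite PSeries_decr_1_aux in E by now apply Hzero.
    apply Rmult_integral in E. destruct E; [lra|easy].
Qed.

Lemma pp_radius (x : R) : Rabs x < 1 -> Rbar_lt (Rabs x) (CV_radius (fun n => INR (pp n))).
Proof. apply radius_gt. exact ex_series_pp. Qed.

Lemma sig_radius (x : R) : Rabs x < 1 -> Rbar_lt (Rabs x) (CV_radius sig_coef).
Proof. apply radius_gt. exact ex_series_sig_coef. Qed.

Lemma PSeries_pp (q : R) : 0 <= q < 1 ->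
  PSeries (fun n => INR (pp n)) q = exp (PSeries sig_coef q).
Proof.
  intro Hq. unfold PSeries.
  rewrite (is_series_unique _ _ (is_series_pp q Hq)).
  now rewrite (is_series_unique _ _ (is_series_sig_coef q Hq)).
Qed.

Lemma pp_0 : INR (pp 0) = 1.
Proof.
  assert (H := PSeries_pp 0 ltac:(lra)). rewrite !PSeries_0, sig_coef_0, exp_0 in H. exact H.
Qed.

(** Coefficients of [P' = L' P], where [P = exp L] on the real interval. In this form the relation
    no longer involves [q], so it can be used along any complex ray. *)
Lemma pp_recursion (n : nat) :
  PS_derive (fun n => INR (pp n)) n = PS_mult (PS_derive sig_coef) (fun n => INR (pp n)) n.
Proof.
  set (p := fun n => INR (pp n)).
  set (d := PS_minus (PS_derive p) (PS_mult (PS_derive sig_coef) p)).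
  assert (Hp := pp_radius). fold p in Hp.
  assert (Hc : forall x, Rabs x < 1 -> Rbar_lt (Rabs x) (CV_radius (PS_derive sig_coef)))
    by (intros; rewrite CV_radius_derive; now apply sig_radius).
  assert (Hex : forall x, Rabs x < 1 -> ex_pseries (PS_derive p) x)
    by (intros; apply ex_pseries_derive; now apply Hp).
  assert (Hex' : forall x, Rabs x < 1 -> ex_pseries (PS_mult (PS_derive sig_coef) p) x)
    by (intros; apply ex_pseries_mult; auto).
  assert (Hd : d n = 0).
  { apply PSeries_zero_coef.
    - intros x Hx. apply radius_gt; [|exact Hx]. intros q Hq.
      apply ex_pseries_R. apply (ex_pseries_minus (V := R_NormedModule));
        [apply Hex|apply Hex']; rewrite Rabs_pos_eq; lra.
    - intros x Hx. assert (Hax : Rabs x < 1) by (rewrite Rabs_pos_eq; lra).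
      unfold d. rewrite PSeries_minus by auto. rewrite PSeries_mult by auto.
      assert (D1 := is_derive_PSeries p x (Hp x Hax)).
      assert (D2 : is_derive (fun t => exp (PSeries sig_coef t)) x
         (PSeries (PS_derive sig_coef) x * exp (PSeries sig_coef x))).
      { apply (is_derive_comp exp (PSeries sig_coef)); [apply is_derive_exp|].
        apply is_derive_PSeries. now apply sig_radius. }
      assert (D3 : is_derive (PSeries p) x
         (PSeries (PS_derive sig_coef) x * exp (PSeries sig_coef x))).
      { refine (is_derive_ext_loc _ _ _ _ _ D2).
        assert (Hpos : 0 < Rmin x (1 - x)) by (apply Rmin_pos; lra).
        exists (mkposreal _ Hpos). intros y Hy.
        unfold ball in Hy; simpl in Hy; unfold AbsRing_ball, abs, minus, plus, opp in Hy; simpl in Hy.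
        pose proof (Rmin_l x (1 - x)). pose proof (Rmin_r x (1 - x)).
        apply Rabs_lt_between' in Hy. symmetry. apply PSeries_pp. lra. }
      apply is_derive_unique in D1. apply is_derive_unique in D3.
      rewrite <- D1, D3. unfold p. rewrite PSeries_pp by lra. ring. }
  unfold d, PS_minus, PS_plus, PS_opp, plus, opp in Hd. simpl in Hd. unfold p in *. lra.
Qed.

(** The function [W = U + i V] solves [W' = (A + i B)' W], hence [W exp (- A - i B)] is constant.
    The two assertions [E1] and [E2] are its real and imaginary parts. *)
Lemma complex_exp_ode (A B U V A' B' : R -> R) (b : R) : 0 <= b ->
  (forall t, 0 <= t <= b -> is_derive A t (A' t)) ->
  (forall t, 0 <= t <= b -> is_derive B t (B' t)) ->
  (forall t, 0 <= t <= b -> is_derive U t (A' t * U t - B' t * V t)) ->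
  (forall t, 0 <= t <= b -> is_derive V t (B' t * U t + A' t * V t)) ->
  A 0 = 0 -> B 0 = 0 -> U 0 = 1 -> V 0 = 0 ->
  U b = exp (A b) * cos (B b) /\ V b = exp (A b) * sin (B b).
Proof.
  intros Hb HA HB HU HV A0 B0 U0 V0.
  assert (HD : forall t, 0 <= t <= b -> Derive (fun x : R => A x) t = A' t /\
    Derive (fun x : R => B x) t = B' t /\
    Derive (fun x : R => U x) t = A' t * U t - B' t * V t /\
    Derive (fun x : R => V x) t = B' t * U t + A' t * V t)
    by (intros t Ht; repeat split; apply is_derive_unique; auto).
  assert (E1 : exp (- A b) * (U b * cos (B b) + V b * sin (B b)) = 1).
  { rewrite (is_derive_zero_eq (fun t => exp (- A t) * (U t * cos (B t) + V t * sin (B t))) b Hb);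
      [|intros t Ht; specialize (HA t Ht); specialize (HB t Ht);
        specialize (HU t Ht); specialize (HV t Ht);
        auto_derive; [repeat split; eexists; eassumption|];
        destruct (HD t Ht) as [-> [-> [-> ->]]]; ring].
    rewrite A0, B0, U0, V0, Ropp_0, exp_0, cos_0, sin_0. ring. }
  assert (E2 : exp (- A b) * (V b * cos (B b) - U b * sin (B b)) = 0).
  { rewrite (is_derive_zero_eq (fun t => exp (- A t) * (V t * cos (B t) - U t * sin (B t))) b Hb);
      [|intros t Ht; specialize (HA t Ht); specialize (HB t Ht);
        specialize (HU t Ht); specialize (HV t Ht);
        auto_derive; [repeat split; eexists; eassumption|];
        destruct (HD t Ht) as [-> [-> [-> ->]]]; ring].
    rewrite A0, B0, U0, V0, Ropp_0, exp_0, cos_0, sin_0. ring. }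
  assert (Hpos := exp_pos (A b)). rewrite exp_Ropp in E1, E2.
  assert (F1 : U b * cos (B b) + V b * sin (B b) = exp (A b)).
  { apply Rmult_eq_reg_l with (/ exp (A b)); [|apply Rinv_neq_0_compat; lra].
    rewrite E1. field. lra. }
  assert (F2 : V b * cos (B b) - U b * sin (B b) = 0).
  { apply Rmult_eq_reg_l with (/ exp (A b)); [|apply Rinv_neq_0_compat; lra].
    rewrite E2. ring. }
  assert (S1 := sin2_cos2 (B b)). unfold Rsqr in S1.
  rewrite <- F1. split.
  - transitivity (U b * (sin (B b) * sin (B b) + cos (B b) * cos (B b))
      + sin (B b) * (V b * cos (B b) - U b * sin (B b))); [rewrite S1, F2; ring|ring].
  - transitivity (V b * (sin (B b) * sin (B b) + cos (B b) * cos (B b))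
      - cos (B b) * (V b * cos (B b) - U b * sin (B b))); [rewrite S1, F2; ring|ring].
Qed.

(** Real part of [a n * exp (i n y)]; with [sin_coef] it describes a complex power series along the
    ray of angle [y] as two real power series in the radius. *)
Definition cos_coef (a : nat -> R) (y : R) (n : nat) : R := a n * cos (INR n * y).
Definition sin_coef (a : nat -> R) (y : R) (n : nat) : R := a n * sin (INR n * y).

Lemma ex_series_cos_coef (a : nat -> R) (y q : R) : (forall n, 0 <= a n) -> 0 <= q ->
  ex_series (fun n => a n * q ^ n) -> ex_series (fun n => cos_coef a y n * q ^ n).
Proof.
  intros Ha Hq. apply (ex_series_le (V := R_CompleteNormedModule)). intro n.
  unfold norm; simpl; unfold abs; simpl. unfold cos_coef.
  assert (0 <= q ^ n) by now apply pow_le. specialize (Ha n).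
  rewrite !Rabs_mult, (Rabs_pos_eq (q ^ n)), (Rabs_pos_eq (a n)) by easy.
  apply Rmult_le_compat_r; [easy|]. rewrite <- (Rmult_1_r (a n)) at 2.
  apply Rmult_le_compat_l; [easy|]. apply Rabs_le. apply COS_bound.
Qed.

Lemma ex_series_sin_coef (a : nat -> R) (y q : R) : (forall n, 0 <= a n) -> 0 <= q ->
  ex_series (fun n => a n * q ^ n) -> ex_series (fun n => sin_coef a y n * q ^ n).
Proof.
  intros Ha Hq. apply (ex_series_le (V := R_CompleteNormedModule)). intro n.
  unfold norm; simpl; unfold abs; simpl. unfold sin_coef.
  assert (0 <= q ^ n) by now apply pow_le. specialize (Ha n).
  rewrite !Rabs_mult, (Rabs_pos_eq (q ^ n)), (Rabs_pos_eq (a n)) by easy.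
  apply Rmult_le_compat_r; [easy|]. rewrite <- (Rmult_1_r (a n)) at 2.
  apply Rmult_le_compat_l; [easy|]. apply Rabs_le. apply SIN_bound.
Qed.

Lemma PS_derive_cos_sin (y : R) (n : nat) :
  let p := fun n => INR (pp n) in
  PS_derive (cos_coef p y) n =
    PS_minus (PS_mult (PS_derive (cos_coef sig_coef y)) (cos_coef p y))
      (PS_mult (PS_derive (sin_coef sig_coef y)) (sin_coef p y)) n /\
  PS_derive (sin_coef p y) n =
    PS_plus (PS_mult (PS_derive (sin_coef sig_coef y)) (cos_coef p y))
      (PS_mult (PS_derive (cos_coef sig_coef y)) (sin_coef p y)) n.
Proof.
  intro p. assert (H := pp_recursion n). fold p in H.
  unfold PS_minus, PS_plus, PS_opp, plus, opp; simpl.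
  unfold PS_mult, PS_derive, cos_coef, sin_coef in *.
  assert (Hang : forall k, (k <= n)%nat -> INR (S n) * y = INR (S k) * y + INR (n - k) * y).
  { intros k Hk. rewrite <- Rmult_plus_distr_r, <- plus_INR. do 2 f_equal. lia. }
  rewrite <- !Rmult_assoc, H. split.
  - match goal with |- _ = ?a + - ?b => change (a + - b) with (a - b) end.
    rewrite Rmult_comm, scal_sum, <- minus_sum. apply sum_eq. intros k Hk.
    rewrite (Hang k Hk), cos_plus. ring.
  - rewrite Rmult_comm, scal_sum, <- sum_plus. apply sum_eq. intros k Hk.
    rewrite (Hang k Hk), sin_plus. ring.
Qed.

(** Multiplying the recursion by [exp (i (n + 1) y)] gives a linear differential equation along the
    ray of angle [y], solved from radius 0, where the generating function is 1. *)
Lemma pp_complex_gf (y b : R) : 0 <= b < 1 ->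
  let p := fun n => INR (pp n) in
  let A := PSeries (cos_coef sig_coef y) b in
  let B := PSeries (sin_coef sig_coef y) b in
  PSeries (cos_coef p y) b = exp A * cos B /\ PSeries (sin_coef p y) b = exp A * sin B.
Proof.
  intros Hb p A B.
  assert (Hp : forall n, 0 <= p n) by (intro; apply pos_INR).
  assert (rA : forall x, Rabs x < 1 -> Rbar_lt (Rabs x) (CV_radius (cos_coef sig_coef y))).
  { intro x. apply radius_gt. intros q Hq. apply ex_series_cos_coef; [exact sig_coef_ge0|lra|].
    now apply ex_series_sig_coef. }
  assert (rB : forall x, Rabs x < 1 -> Rbar_lt (Rabs x) (CV_radius (sin_coef sig_coef y))).
  { intro x. apply radius_gt. intros q Hq. apply ex_series_sin_coef; [exact sig_coef_ge0|lra|].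
    now apply ex_series_sig_coef. }
  assert (rU : forall x, Rabs x < 1 -> Rbar_lt (Rabs x) (CV_radius (cos_coef p y))).
  { intro x. apply radius_gt. intros q Hq. apply ex_series_cos_coef; [exact Hp|lra|].
    now apply ex_series_pp. }
  assert (rV : forall x, Rabs x < 1 -> Rbar_lt (Rabs x) (CV_radius (sin_coef p y))).
  { intro x. apply radius_gt. intros q Hq. apply ex_series_sin_coef; [exact Hp|lra|].
    now apply ex_series_pp. }
  assert (rA' : forall x, Rabs x < 1 -> Rbar_lt (Rabs x) (CV_radius (PS_derive (cos_coef sig_coef y))))
    by (intros; rewrite CV_radius_derive; auto).
  assert (rB' : forall x, Rabs x < 1 -> Rbar_lt (Rabs x) (CV_radius (PS_derive (sin_coef sig_coef y))))
    by (intros; rewrite CV_radius_derive; auto).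
  apply (complex_exp_ode (PSeries (cos_coef sig_coef y)) (PSeries (sin_coef sig_coef y))
    (PSeries (cos_coef p y)) (PSeries (sin_coef p y))
    (PSeries (PS_derive (cos_coef sig_coef y))) (PSeries (PS_derive (sin_coef sig_coef y))));
    try (intros t Ht; assert (Hat : Rabs t < 1) by (rewrite Rabs_pos_eq; lra)).
  - lra.
  - apply is_derive_PSeries; auto.
  - apply is_derive_PSeries; auto.
  - rewrite <- !PSeries_mult, <- PSeries_minus by (auto using ex_pseries_mult).
    refine (eq_ind _ (is_derive (PSeries (cos_coef p y)) t)
      (is_derive_PSeries _ t (rU t Hat)) _ _).
    apply PSeries_ext. intro n. apply PS_derive_cos_sin.
  - rewrite <- !PSeries_mult, <- PSeries_plus by (auto using ex_pseries_mult).
    refine (eq_ind _ (is_derive (PSeries (sin_coef p y)) t)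
      (is_derive_PSeries _ t (rV t Hat)) _ _).
    apply PSeries_ext. intro n. apply PS_derive_cos_sin.
  - rewrite PSeries_0. unfold cos_coef. rewrite sig_coef_0. ring.
  - rewrite PSeries_0. unfold sin_coef. rewrite sig_coef_0. ring.
  - rewrite PSeries_0. unfold cos_coef, p. rewrite pp_0. simpl. rewrite Rmult_0_l, cos_0. ring.
  - rewrite PSeries_0. unfold sin_coef. simpl. rewrite Rmult_0_l, sin_0. ring.
Qed.

(** * Euler-Maclaurin error terms *)

Lemma derive_le_incr (f f' : R -> R) (a b : R) : a <= b ->
  (forall t, a <= t <= b -> is_derive f t (f' t)) ->
  (forall t, a <= t <= b -> 0 <= f' t) -> f a <= f b.
Proof.
  intros Hab Hf Hpos.
  destruct (Rle_lt_or_eq_dec a b Hab) as [H| ->]; [|lra].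
  destruct (MVT_cor2 f f' a b H) as [c [E Hc]].
  - intros c Hc. apply is_derive_Reals. now apply Hf.
  - assert (0 <= f' c) by (apply Hpos; lra). nra.
Qed.

Lemma derive_abs_le (f f' g g' : R -> R) (a b : R) : a <= b ->
  (forall t, a <= t <= b -> is_derive f t (f' t)) ->
  (forall t, a <= t <= b -> is_derive g t (g' t)) ->
  (forall t, a <= t <= b -> Rabs (f' t) <= g' t) -> Rabs (f b - f a) <= g b - g a.
Proof.
  intros Hab Hf Hg Hle.
  assert (H1 : g a - f a <= g b - f b).
  { apply (derive_le_incr (fun t => g t - f t) (fun t => g' t - f' t)); [easy| |].
    - intros t Ht. apply (is_derive_minus (V := R_NormedModule)); auto.
    - intros t Ht. specialize (Hle t Ht). apply Rabs_le_between in Hle. lra. }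
  assert (H2 : g a + f a <= g b + f b).
  { apply (derive_le_incr (fun t => g t + f t) (fun t => g' t + f' t)); [easy| |].
    - intros t Ht. apply (is_derive_plus (V := R_NormedModule)); auto.
    - intros t Ht. specialize (Hle t Ht). apply Rabs_le_between in Hle. lra. }
  apply Rabs_le. lra.
Qed.

(* With [F1], [F2] the first two derivatives of [F], this is the local error of
   the Euler-Maclaurin formula for [F1] on [[m, m + 1]]. *)
Definition em_error (F F1 F2 : R -> R) (m : R) : R :=
  - (F (m + 1) - F m) + (F1 m + F1 (m + 1)) / 2 - (F2 (m + 1) - F2 m) / 12.

(** The weights 1/2 and 1/12 are such that the error vanishes for [F] of degree at most 3, so only
    the Taylor remainders at [m] contribute. Since [F] itself is given, no integral appears. *)
Lemma em_error_bound (F F1 F2 F3 F4 : R -> R) (m M : R) :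
  (forall t, m <= t <= m + 1 -> is_derive F t (F1 t)) ->
  (forall t, m <= t <= m + 1 -> is_derive F1 t (F2 t)) ->
  (forall t, m <= t <= m + 1 -> is_derive F2 t (F3 t)) ->
  (forall t, m <= t <= m + 1 -> is_derive F3 t (F4 t)) ->
  (forall t, m <= t <= m + 1 -> Rabs (F4 t) <= M) ->
  Rabs (em_error F F1 F2 m) <= M.
Proof.
  intros H1 H2 H3 H4 HM.
  assert (B3 : forall t, m <= t <= m + 1 -> Rabs (F3 t - F3 m) <= M * (t - m)).
  { intros t Ht. replace (M * (t - m)) with (M * (t - m) - M * (m - m)) by ring.
    apply (derive_abs_le F3 F4 (fun t => M * (t - m)) (fun _ => M)); [lra| | |];
      intros s Hs; [apply H4; lra|auto_derive; [easy|ring]|apply HM; lra]. }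
  assert (B2 : forall t, m <= t <= m + 1 ->
    Rabs (F2 t - F2 m - F3 m * (t - m)) <= M * (t - m) ^ 2 / 2).
  { intros t Ht.
    replace (F2 t - F2 m - F3 m * (t - m)) with
      ((F2 t - F3 m * (t - m)) - (F2 m - F3 m * (m - m))) by ring.
    replace (M * (t - m) ^ 2 / 2) with (M * (t - m) ^ 2 / 2 - M * (m - m) ^ 2 / 2) by (field).
    apply (derive_abs_le (fun t => F2 t - F3 m * (t - m)) (fun t => F3 t - F3 m)
      (fun t => M * (t - m) ^ 2 / 2) (fun t => M * (t - m))); [lra| | |]; intros s Hs.
    - apply (is_derive_minus (V := R_NormedModule)); [apply H3; lra|auto_derive; [easy|ring]].
    - auto_derive; [easy|field].
    - apply B3; lra. }
  assert (B1 : forall t, m <= t <= m + 1 ->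
    Rabs (F1 t - F1 m - F2 m * (t - m) - F3 m * (t - m) ^ 2 / 2) <= M * (t - m) ^ 3 / 6).
  { intros t Ht.
    replace (F1 t - F1 m - F2 m * (t - m) - F3 m * (t - m) ^ 2 / 2) with
      ((F1 t - (F2 m * (t - m) + F3 m * (t - m) ^ 2 / 2)) -
       (F1 m - (F2 m * (m - m) + F3 m * (m - m) ^ 2 / 2))) by field.
    replace (M * (t - m) ^ 3 / 6) with (M * (t - m) ^ 3 / 6 - M * (m - m) ^ 3 / 6) by (field).
    apply (derive_abs_le (fun t => F1 t - (F2 m * (t - m) + F3 m * (t - m) ^ 2 / 2))
      (fun t => F2 t - F2 m - F3 m * (t - m))
      (fun t => M * (t - m) ^ 3 / 6) (fun t => M * (t - m) ^ 2 / 2)); [lra| | |]; intros s Hs.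
    - replace (F2 s - F2 m - F3 m * (s - m)) with (F2 s - (F2 m + F3 m * (s - m))) by ring.
      apply (is_derive_minus (V := R_NormedModule)); [apply H2; lra|auto_derive; [easy|field]].
    - auto_derive; [easy|field].
    - apply B2; lra. }
  assert (B0 : Rabs (F (m + 1) - F m - F1 m - F2 m / 2 - F3 m / 6) <= M / 24).
  { replace (F (m + 1) - F m - F1 m - F2 m / 2 - F3 m / 6) with
      ((F (m + 1) - (F1 m * (m + 1 - m) + F2 m * (m + 1 - m) ^ 2 / 2 + F3 m * (m + 1 - m) ^ 3 / 6)) -
       (F m - (F1 m * (m - m) + F2 m * (m - m) ^ 2 / 2 + F3 m * (m - m) ^ 3 / 6))) by field.
    replace (M / 24) with (M * (m + 1 - m) ^ 4 / 24 - M * (m - m) ^ 4 / 24) by field.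
    apply (derive_abs_le
      (fun t => F t - (F1 m * (t - m) + F2 m * (t - m) ^ 2 / 2 + F3 m * (t - m) ^ 3 / 6))
      (fun t => F1 t - F1 m - F2 m * (t - m) - F3 m * (t - m) ^ 2 / 2)
      (fun t => M * (t - m) ^ 4 / 24) (fun t => M * (t - m) ^ 3 / 6)); [lra| | |]; intros s Hs.
    - replace (F1 s - F1 m - F2 m * (s - m) - F3 m * (s - m) ^ 2 / 2) with
        (F1 s - (F1 m + F2 m * (s - m) + F3 m * (s - m) ^ 2 / 2)) by ring.
      apply (is_derive_minus (V := R_NormedModule)); [apply H1; lra|auto_derive; [easy|field]].
    - auto_derive; [easy|field].
    - apply B1; lra. }
  (* The three remainders at [m + 1] contribute [M / 24], [M / 12] and [M / 24], which is less than
     [M] in total. *)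
  specialize (B1 (m + 1) ltac:(lra)). specialize (B2 (m + 1) ltac:(lra)).
  replace (m + 1 - m) with 1 in B1, B2 by ring. rewrite !pow1, !Rmult_1_r in B1, B2.
  apply Rabs_le_between in B0, B1, B2. unfold em_error. apply Rabs_le.
  assert (0 <= M) by lra. split; lra.
Qed.

(** The local error ignores constants and squares in [F]. This discards the parts that diverge as
    [x] tends to 0, namely multiples of [1 / x^2] and of [ln x]. *)
Lemma em_error_ext_quadratic (F F1 F2 G G1 G2 : R -> R) (c0 c2 m : R) :
  (forall t, m <= t -> F t = G t + c0 + c2 * t ^ 2) ->
  (forall t, m <= t -> F1 t = G1 t + 2 * c2 * t) ->
  (forall t, m <= t -> F2 t = G2 t + 2 * c2) ->
  em_error F F1 F2 m = em_error G G1 G2 m.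
Proof.
  intros H0 H1 H2. unfold em_error.
  rewrite !H0, !H1, !H2 by lra. field.
Qed.

Lemma em_error_dist (F F1 F2 G G1 G2 : R -> R) (m C : R) :
  (forall t, m <= t <= m + 1 -> Rabs (F t - G t) <= C) ->
  (forall t, m <= t <= m + 1 -> Rabs (F1 t - G1 t) <= C) ->
  (forall t, m <= t <= m + 1 -> Rabs (F2 t - G2 t) <= C) ->
  Rabs (em_error F F1 F2 m - em_error G G1 G2 m) <= 4 * C.
Proof.
  intros H0 H1 H2.
  pose proof (H0 m ltac:(lra)) as a0. pose proof (H0 (m + 1) ltac:(lra)) as b0.
  pose proof (H1 m ltac:(lra)) as a1. pose proof (H1 (m + 1) ltac:(lra)) as b1.
  pose proof (H2 m ltac:(lra)) as a2. pose proof (H2 (m + 1) ltac:(lra)) as b2.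
  unfold em_error. apply Rabs_le_between in a0, b0, a1, b1, a2, b2. apply Rabs_le. lra.
Qed.

Lemma em_error_sum (F F1 F2 : R -> R) (N : nat) :
  sum_f_R0 (fun n => em_error F F1 F2 (INR (S n))) N =
  - (F (INR (S (S N))) - F 1) + sum_f_R0 (fun n => F1 (INR (S n))) N
  - (F1 1 - F1 (INR (S (S N)))) / 2 - (F2 (INR (S (S N))) - F2 1) / 12.
Proof.
  induction N as [|N IH].
  - simpl. unfold em_error. field.
  - rewrite (tech5 _ N), IH, (tech5 _ N). unfold em_error. rewrite <- S_INR. field.
Qed.

(** The local errors telescope: [Finf - F 1] stands for the integral of [F1] over [[1, oo)], the
    boundary terms at infinity vanish, and those at 1 remain. *)
Lemma is_series_em_error (F F1 F2 : R -> R) (Finf l : R) :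
  is_lim_seq (fun n => F (INR n)) Finf -> is_lim_seq (fun n => F2 (INR n)) 0 ->
  is_series (fun n => F1 (INR (S n))) l ->
  is_series (fun n => em_error F F1 F2 (INR (S n))) (F 1 - Finf + l - F1 1 / 2 + F2 1 / 12).
Proof.
  intros HF HF2 Hl.
  assert (HF1 : is_lim_seq (fun n => F1 (INR (S (S n)))) 0).
  { apply (is_lim_seq_incr_1 (fun n => F1 (INR (S n))) 0).
    apply ex_series_lim_0. now exists l. }
  apply (is_lim_seq_incr_1 (fun n => F (INR n))), (is_lim_seq_incr_1 (fun n => F (INR (S n)))) in HF.
  apply (is_lim_seq_incr_1 (fun n => F2 (INR n))), (is_lim_seq_incr_1 (fun n => F2 (INR (S n)))) in HF2.
  change (is_lim_seq (sum_n (fun n => em_error F F1 F2 (INR (S n))))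
    (F 1 - Finf + l - F1 1 / 2 + F2 1 / 12)).
  refine (is_lim_seq_ext (fun N => - (F (INR (S (S N))) - F 1) + sum_n (fun n => F1 (INR (S n))) N
    - (F1 1 - F1 (INR (S (S N)))) / 2 - (F2 (INR (S (S N))) - F2 1) / 12) _ _ _ _).
  - intro N. rewrite !sum_n_Reals. symmetry. apply em_error_sum.
  - replace (F 1 - Finf + l - F1 1 / 2 + F2 1 / 12) with
      (- (Finf - F 1) + l - (F1 1 - 0) / 2 - (0 - F2 1) / 12) by field.
    unfold Rdiv.
    apply is_lim_seq_minus'; [apply is_lim_seq_minus'; [apply is_lim_seq_plus'|]|].
    + apply (is_lim_seq_opp _ (Finf - F 1)). apply is_lim_seq_minus'; [exact HF|apply is_lim_seq_const].
    + exact Hl.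
    + apply (is_lim_seq_scal_r _ (/ 2) (F1 1 - 0)). apply is_lim_seq_minus'; [apply is_lim_seq_const|exact HF1].
    + apply (is_lim_seq_scal_r _ (/ 12) (0 - F2 1)). apply is_lim_seq_minus'; [exact HF2|apply is_lim_seq_const].
Qed.

Lemma filterlim_le_R {T : Type} (F : (T -> Prop) -> Prop) {FF : ProperFilter F} (f g : T -> R) (a b : R) :
  F (fun x => f x <= g x) -> filterlim f F (locally a) -> filterlim g F (locally b) -> a <= b.
Proof. intros H Hf Hg. exact (filterlim_le f g a b H Hf Hg). Qed.

(** The tail of [b] bounds the tails of all [a x] at once, which leaves a finite sum of limits. *)
Lemma tannery {T : Type} (F : (T -> Prop) -> Prop) {FF : ProperFilter F}
  (a : T -> nat -> R) (a0 b : nat -> R) : ex_series b ->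
  F (fun x => forall n, Rabs (a x n) <= b n) ->
  (forall n, filterlim (fun x => a x n) F (locally (a0 n))) ->
  filterlim (fun x => Series (a x)) F (locally (Series a0)).
Proof.
  intros Hb Hab Hlim.
  assert (Ha0 : forall n, Rabs (a0 n) <= b n).
  { intro n. apply (filterlim_le_R F (fun x => Rabs (a x n)) (fun _ => b n)).
    - apply filter_imp with (2 := Hab). intros x H. apply H.
    - apply (filterlim_comp _ _ _ _ Rabs _ (locally (a0 n))); [apply Hlim|].
      apply (continuous_Rabs (a0 n)).
    - apply filterlim_const. }
  assert (Exs : forall c, (forall n, Rabs (c n) <= b n) -> ex_series c).
  { intros c Hc. apply (ex_series_le (V := R_CompleteNormedModule) c b); [exact Hc|exact Hb]. }
  assert (Htail : forall c N, (forall n, Rabs (c n) <= b n) ->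
    Rabs (Series c - sum_n c N) <= Series b - sum_n b N).
  { intros c N Hc. rewrite (Series_incr_n c (S N)), (Series_incr_n b (S N)) by (lia || auto).
    rewrite !sum_n_Reals. simpl pred. unfold Rminus.
    replace (sum_f_R0 c N + Series (fun k => c (S N + k)%nat) + - sum_f_R0 c N)
      with (Series (fun k => c (S N + k)%nat)) by ring.
    replace (sum_f_R0 b N + Series (fun k => b (S N + k)%nat) + - sum_f_R0 b N)
      with (Series (fun k => b (S N + k)%nat)) by ring.
    assert (Hb' : ex_series (fun k => b (S N + k)%nat)) by now apply (ex_series_incr_n b (S N)).
    apply Rle_trans with (Series (fun k => Rabs (c (S N + k)%nat))).
    - apply Series_Rabs.
      apply (ex_series_le (V := R_CompleteNormedModule) _ (fun k => b (S N + k)%nat)); [|exact Hb'].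
      intro k. unfold norm; simpl; unfold abs; simpl. rewrite Rabs_Rabsolu. apply Hc.
    - apply Series_le; [|exact Hb']. intro k. split; [apply Rabs_pos|apply Hc]. }
  apply filterlim_locally. intro eps.
  assert (Hbs := Series_correct b Hb).
  assert (He : 0 < eps / 3) by (pose proof (cond_pos eps); lra).
  destruct (proj1 (filterlim_locally (sum_n b) (Series b)) Hbs (mkposreal _ He)) as [N HN].
  specialize (HN N (Nat.le_refl N)).
  assert (HbN : Series b - sum_n b N < eps / 3).
  { unfold ball in HN; simpl in HN; unfold AbsRing_ball, abs, minus, plus, opp in HN; simpl in HN.
    apply Rabs_lt_between in HN. lra. }
  assert (Hsum : filterlim (fun x => sum_n (a x) N) F (locally (sum_n a0 N))).
  { clear -Hlim FF. induction N as [|N IH].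
    - apply filterlim_ext with (fun x => a x 0%nat); [intro; now rewrite sum_O|].
      rewrite sum_O. apply Hlim.
    - apply filterlim_ext with (fun x => plus (sum_n (a x) N) (a x (S N))); [intro; now rewrite sum_Sn|].
      rewrite sum_Sn.
      refine (filterlim_comp_2 (G := locally (sum_n a0 N)) (H := locally (a0 (S N)))
        _ _ plus IH (Hlim (S N)) _).
      apply (filterlim_plus (V := R_NormedModule)). }
  assert (Hs := proj1 (filterlim_locally _ _) Hsum (mkposreal _ He)).
  apply filter_imp with (2 := filter_and _ _ Hab Hs). intros x [H1 H2].
  unfold ball in *; simpl in *; unfold AbsRing_ball, abs, minus, plus, opp in *; simpl in *.
  assert (T1 := Htail (a x) N H1). assert (T2 := Htail a0 N Ha0).
  apply Rabs_le_between in T1, T2. apply Rabs_lt_between in H2.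
  apply Rabs_lt_between. lra.
Qed.

(** * Logarithm of the generating function near q = 1 *)

Lemma sum_inv_sq_le (N : nat) :
  sum_f_R0 (fun n => harmonic_coef n ^ 2) N <= 2 - 2 / INR (S N).
Proof.
  induction N as [|N IH]; [simpl; lra|].
  rewrite tech5. apply Rle_trans with (1 := Rplus_le_compat_r _ _ _ IH).
  unfold harmonic_coef. rewrite !S_INR. pose proof (pos_INR N).
  set (x := INR N) in *. clearbody x.
  apply Rminus_le_0.
  replace (2 - 2 / (x + 1 + 1) - (2 - 2 / (x + 1) + (/ (x + 1)) ^ 2))
    with (x * / ((x + 1) ^ 2 * (x + 2))) by (field; lra).
  apply Rmult_le_pos; [easy|]. left. apply Rinv_0_lt_compat.
  apply Rmult_lt_0_compat; [apply pow_lt|]; lra.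
Qed.

Lemma ex_series_inv_sq : ex_series (fun n => harmonic_coef n ^ 2).
Proof.
  destruct (is_series_bounded (fun n => harmonic_coef n ^ 2) 2) as [l [Hl _]].
  - intro n. apply pow_le, harmonic_coef_ge0.
  - intro N. apply Rle_trans with (1 := sum_inv_sq_le N).
    assert (0 < / INR (S N)) by (apply Rinv_0_lt_compat, lt_0_INR; lia). lra.
  - now exists l.
Qed.

Lemma harmonic_coef_le1 (n : nat) : harmonic_coef n <= 1.
Proof.
  destruct n; unfold harmonic_coef; [lra|].
  rewrite <- Rinv_1. apply Rinv_le_contravar; [lra|]. apply (le_INR 1). lia.
Qed.

Lemma ex_series_inv_cube : ex_series (fun n => harmonic_coef n ^ 3).
Proof.
  apply (ex_series_le (V := R_CompleteNormedModule)) with (2 := ex_series_inv_sq).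
  intro n. unfold norm; simpl; unfold abs; simpl.
  pose proof (harmonic_coef_ge0 n). pose proof (harmonic_coef_le1 n).
  rewrite Rabs_pos_eq; [nra|]. apply Rmult_le_pos; nra.
Qed.

(** These are zeta(2), which enters only in bounds, and zeta(3), as real series that do not refer to
    the function [zeta] of the theorem. *)
Definition inv_sq_sum : R := Series (fun n => harmonic_coef n ^ 2).
Definition inv_cube_sum : R := Series (fun n => harmonic_coef n ^ 3).

Lemma harmonic_coef_pow_radius (k : nat) (x : R) :
  Rabs x < 1 -> Rbar_lt (Rabs x) (CV_radius (fun n => harmonic_coef n ^ k)).
Proof.
  apply radius_gt. intros q Hq.
  apply (ex_series_le (V := R_CompleteNormedModule)) with (b := fun n => q ^ n).
  - intro n. unfold norm; simpl; unfold abs; simpl.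
    pose proof (harmonic_coef_ge0 n). pose proof (harmonic_coef_le1 n).
    assert (0 <= q ^ n) by (apply pow_le; lra).
    assert (0 <= harmonic_coef n ^ k) by now apply pow_le.
    assert (harmonic_coef n ^ k <= 1) by (rewrite <- (pow1 k); now apply pow_incr).
    rewrite Rabs_pos_eq; nra.
  - apply ex_series_geom. rewrite Rabs_pos_eq; lra.
Qed.

(** For [k >= 1] this is the polylogarithm of order [k]. *)
Definition li (k : nat) : R -> R := PSeries (fun n => harmonic_coef n ^ k).

Lemma li_1 (q : R) : 0 <= q < 1 -> li 1 q = - ln (1 - q).
Proof.
  intro Hq. apply is_series_unique. apply is_series_ext with (2 := is_series_ln q Hq).
  intro n. now rewrite pow_1.
Qed.

Lemma is_derive_li (k : nat) (q : R) : 0 < q < 1 -> is_derive (li (S (S k))) q (li (S k) q / q).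
Proof.
  intro Hq. unfold li.
  replace (PSeries (fun n => harmonic_coef n ^ S k) q / q)
    with (PSeries (PS_derive (fun n => harmonic_coef n ^ S (S k))) q).
  - apply is_derive_PSeries. apply harmonic_coef_pow_radius. rewrite Rabs_pos_eq; lra.
  - rewrite (PSeries_decr_1_aux (fun n => harmonic_coef n ^ S k)) by (simpl; ring).
    rewrite (PSeries_ext (PS_decr_1 _) (PS_derive (fun n => harmonic_coef n ^ S (S k)))).
    + field. lra.
    + intro n. unfold PS_decr_1, PS_derive, harmonic_coef.
      rewrite <- (tech_pow_Rmult _ (S k)). rewrite <- Rmult_assoc, Rinv_r, Rmult_1_l; [easy|].
      apply not_0_INR. lia.
Qed.

Lemma is_series_li (k : nat) (q : R) : 0 <= q < 1 ->
  is_series (fun n => harmonic_coef n ^ k * q ^ n) (li k q).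
Proof.
  intro Hq. unfold li, PSeries. apply Series_correct, ex_pseries_R, CV_radius_inside.
  apply harmonic_coef_pow_radius. rewrite Rabs_pos_eq; lra.
Qed.

Lemma li_bound (k : nat) (q : R) : 0 <= q < 1 -> 0 <= li (S (S k)) q <= inv_sq_sum * q.
Proof.
  intro Hq. assert (H := is_series_li (S (S k)) q Hq).
  assert (Hn : forall n, 0 <= harmonic_coef n ^ S (S k) * q ^ n <= harmonic_coef n ^ 2 * q).
  { intro n. pose proof (harmonic_coef_ge0 n). pose proof (harmonic_coef_le1 n).
    assert (Hk : 0 <= harmonic_coef n ^ k <= 1).
    { split; [now apply pow_le|]. rewrite <- (pow1 k). apply pow_incr. lra. }
    assert (Hqn : 0 <= q ^ n) by (apply pow_le; lra).
    replace (harmonic_coef n ^ S (S k)) with (harmonic_coef n ^ 2 * harmonic_coef n ^ k) by (simpl; ring).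
    assert (0 <= harmonic_coef n ^ 2) by (apply pow_le; lra).
    split; [apply Rmult_le_pos; [nra|easy]|].
    destruct n as [|n]; [simpl; lra|]. rewrite Rmult_assoc.
    apply Rmult_le_compat_l; [easy|]. rewrite <- tech_pow_Rmult.
    assert (0 <= q ^ n <= 1).
    { split; [apply pow_le; lra|]. rewrite <- (pow1 n). apply pow_incr; lra. }
    assert (q * q ^ n <= q) by nra. assert (0 <= q * q ^ n) by nra. nra. }
  split.
  - apply (is_series_le (fun _ => 0) _ 0 _ (fun n => proj1 (Hn n))); [|exact H].
    now apply (is_series_finite (fun _ => 0) 0).
  - apply (is_series_le _ _ _ _ (fun n => proj2 (Hn n)) H).
    apply (is_series_scal_r q _ inv_sq_sum). apply Series_correct, ex_series_inv_sq.
Qed.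

Lemma exp_neg_01 (w : R) : 0 < w -> 0 < exp (- w) < 1.
Proof.
  intro Hw. split; [apply exp_pos|]. rewrite <- exp_0. apply exp_increasing. lra.
Qed.

Lemma exp_pow (x : R) (n : nat) : exp x ^ n = exp (INR n * x).
Proof.
  induction n as [|n IH]; [simpl; now rewrite Rmult_0_l, exp_0|].
  rewrite <- tech_pow_Rmult, IH, S_INR, <- exp_plus. f_equal. ring.
Qed.

(** Termwise, [1 - exp (- n w) <= n w] turns a cube into a square at the cost of a factor [w]. *)
Lemma li3_bound (w : R) : 0 < w -> 0 <= inv_cube_sum - li 3 (exp (- w)) <= inv_sq_sum * w.
Proof.
  intro Hw. pose proof (exp_neg_01 w Hw) as Hq.
  assert (H := is_series_minus _ _ _ _ (Series_correct _ ex_series_inv_cube) (is_series_li 3 (exp (- w)) ltac:(lra))).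
  fold inv_cube_sum in H.
  change (is_series (fun n => harmonic_coef n ^ 3 - harmonic_coef n ^ 3 * exp (- w) ^ n)
    (inv_cube_sum - li 3 (exp (- w)))) in H.
  assert (Hn : forall n, 0 <= harmonic_coef n ^ 3 - harmonic_coef n ^ 3 * exp (- w) ^ n <= harmonic_coef n ^ 2 * w).
  { intro n. rewrite exp_pow. pose proof (exp_ineq1_le (INR n * - w)) as E.
    assert (exp (INR n * - w) <= 1).
    { rewrite <- exp_0. apply exp_le_compat. pose proof (pos_INR n). nra. }
    pose proof (harmonic_coef_ge0 n) as Hh.
    assert (H3 : 0 <= harmonic_coef n ^ 3) by now apply pow_le.
    split; [nra|].
    assert (E2 : harmonic_coef n ^ 3 * INR n = harmonic_coef n ^ 2).
    { destruct n; unfold harmonic_coef; [simpl; ring|]. field. apply not_0_INR; lia. }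
    rewrite <- E2. nra. }
  split.
  - apply (is_series_le (fun _ => 0) _ 0 _ (fun n => proj1 (Hn n))); [|exact H].
    now apply (is_series_finite (fun _ => 0) 0).
  - apply (is_series_le _ (fun n => harmonic_coef n ^ 2 * w) _ _ (fun n => proj2 (Hn n)) H).
    apply (is_series_scal_r w _ inv_sq_sum). apply Series_correct, ex_series_inv_sq.
Qed.

(** * The function -ln(1 - exp(-w)) and its integral against w *)

Definition ell (w : R) : R := - ln (1 - exp (- w)).
Definition ell1 (w : R) : R := - / (exp w - 1).
Definition ell2 (w : R) : R := exp w / (exp w - 1) ^ 2.
Definition ell3 (w : R) : R := - (exp w * (exp w + 1)) / (exp w - 1) ^ 3.

Lemma exp_gt_1 (w : R) : 0 < w -> 1 < exp w.
Proof. intro Hw. rewrite <- exp_0. now apply exp_increasing. Qed.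

Lemma is_derive_ell (w : R) : 0 < w -> is_derive ell w (ell1 w).
Proof.
  intro Hw. pose proof (exp_neg_01 w Hw). pose proof (exp_gt_1 w Hw). unfold ell, ell1.
  auto_derive; [lra|]. rewrite exp_Ropp. field. split; lra.
Qed.

Lemma is_derive_ell1 (w : R) : 0 < w -> is_derive ell1 w (ell2 w).
Proof.
  intro Hw. pose proof (exp_gt_1 w Hw). unfold ell1, ell2.
  auto_derive; [lra|]. field. lra.
Qed.

Lemma is_derive_ell2 (w : R) : 0 < w -> is_derive ell2 w (ell3 w).
Proof.
  intro Hw. pose proof (exp_gt_1 w Hw). unfold ell2, ell3.
  auto_derive; [apply Rgt_not_eq; nra|]. field. lra.
Qed.

(* The integral of [t * ell t] over [[w, oo)]. *)
Definition ell_tail (w : R) : R := w * li 2 (exp (- w)) + li 3 (exp (- w)).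

Lemma is_derive_ell_tail (w : R) : 0 < w -> is_derive ell_tail w (- (w * ell w)).
Proof.
  intro Hw. pose proof (exp_neg_01 w Hw) as Hq.
  assert (D : forall k, is_derive (fun t => li (S (S k)) (exp (- t))) w (- li (S k) (exp (- w)))).
  { intro k. replace (- li (S k) (exp (- w)))
      with (- exp (- w) * (li (S k) (exp (- w)) / exp (- w))) by (field; lra).
    apply (is_derive_comp (li (S (S k))) (fun t => exp (- t))).
    - now apply is_derive_li.
    - auto_derive; [easy|ring]. }
  assert (D2 := D 0%nat). assert (D3 := D 1%nat). rewrite li_1 in D2 by lra.
  unfold ell_tail, ell.
  replace (- (w * - ln (1 - exp (- w)))) with
    ((1 * li 2 (exp (- w)) + w * - - ln (1 - exp (- w))) + - li 2 (exp (- w))) by ring.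
  apply (is_derive_plus (V := R_NormedModule)); [|exact D3].
  apply (is_derive_mult (fun t => t) (fun t => li 2 (exp (- t)))); [auto_derive; [easy|ring]|exact D2|].
  intros a b. apply Rmult_comm.
Qed.

Lemma exp_minus_1_bounds (w : R) : 0 < w ->
  w <= exp w - 1 /\ w ^ 2 / 2 <= exp w - 1 /\ w ^ 3 / 6 <= exp w - 1.
Proof.
  intro Hw. pose proof (exp_ge_taylor w 3 ltac:(lra)) as H. simpl in H.
  assert (0 < w ^ 2 /\ 0 < w ^ 3) by (split; apply pow_lt; lra).
  assert (w * (w * 1) / (1 + 1) = w ^ 2 / 2) by (simpl; field).
  assert (w * (w * (w * 1)) / (1 + 1 + 1 + (1 + 1 + 1)) = w ^ 3 / 6) by (simpl; field).
  simpl in *. repeat split; lra.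
Qed.

(** The combination depends on [w] alone: [em_prim4 x u] is its value at [w = u x] divided by [u^2].
    A bound for all [w] therefore dominates the Euler-Maclaurin errors uniformly in [x]. The value
    23 comes from [3 * 3 + 14]. *)
Lemma ell_fourth_bound (w : R) : 0 < w ->
  Rabs (3 * w ^ 2 * ell2 w + w ^ 3 * ell3 w) <= 23.
Proof.
  intro Hw. destruct (exp_minus_1_bounds w Hw) as [E1 [E2 E3]].
  unfold ell2, ell3. set (E := exp w - 1) in *.
  replace (exp w) with (E + 1) by (unfold E; ring). clearbody E.
  assert (HE : 0 < E) by lra.
  assert (A1 : 0 <= w ^ 2 * ((E + 1) / E ^ 2) <= 3).
  { assert (P : 0 < E ^ 2) by (apply pow_lt; lra).
    replace (w ^ 2 * ((E + 1) / E ^ 2)) with (w ^ 2 * (E + 1) / E ^ 2) by (field; lra).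
    split.
    - apply Rmult_le_pos; [apply Rmult_le_pos; [apply pow_le|]; lra|]. left. now apply Rinv_0_lt_compat.
    - apply Rle_div_l; [lra|]. simpl in *. nra. }
  assert (A2 : 0 <= w ^ 3 * ((E + 1) * (E + 1 + 1) / E ^ 3) <= 14).
  { assert (P : 0 < E ^ 3) by (apply pow_lt; lra).
    replace (w ^ 3 * ((E + 1) * (E + 1 + 1) / E ^ 3)) with (w ^ 3 * ((E + 1) * (E + 1 + 1)) / E ^ 3) by (field; lra).
    assert (W3 : 0 < w ^ 3) by (apply pow_lt; lra).
    split.
    - apply Rmult_le_pos; [apply Rmult_le_pos; [|apply Rmult_le_pos]; lra|]. left. now apply Rinv_0_lt_compat.
    - apply Rle_div_l; [lra|].
      replace (w ^ 3 * ((E + 1) * (E + 1 + 1))) with (w ^ 3 * E ^ 2 + 3 * (w ^ 3 * E) + 2 * w ^ 3) by ring.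
      assert (B1 : w ^ 3 * E ^ 2 <= 6 * E ^ 3) by (simpl in *; nra).
      assert (B2 : w ^ 3 <= 2 * E ^ 2).
      { replace (w ^ 3) with (w ^ 2 * w) by ring. assert (0 < w ^ 2) by (apply pow_lt; lra).
        replace (2 * E ^ 2) with (2 * E * E) by ring. apply Rmult_le_compat; lra. }
      assert (B3 : w ^ 3 <= E ^ 3) by (apply pow_incr; lra).
      assert (B4 : w ^ 3 * E <= 2 * E ^ 3) by (replace (2 * E ^ 3) with (2 * E ^ 2 * E) by ring; apply Rmult_le_compat_r; lra).
      lra. }
  replace (3 * w ^ 2 * ((E + 1) / E ^ 2) + w ^ 3 * (- ((E + 1) * (E + 1 + 1)) / E ^ 3))
    with (3 * (w ^ 2 * ((E + 1) / E ^ 2)) - w ^ 3 * ((E + 1) * (E + 1 + 1) / E ^ 3)) by (field; lra).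
  apply Rabs_le. lra.
Qed.

Lemma ell_plus_ln (w : R) : 0 < w -> 0 <= ell w + ln w <= w.
Proof.
  intro Hw. pose proof (exp_neg_01 w Hw) as Hq. unfold ell.
  pose proof (exp_ineq1_le (- w)) as E1. pose proof (exp_ineq1_le w) as E2. split.
  - assert (ln (1 - exp (- w)) <= ln w) by (apply ln_le; lra). lra.
  - assert (ln (w * exp (- w)) <= ln (1 - exp (- w))).
    { apply ln_le; [apply Rmult_lt_0_compat; lra|].
      assert (P : exp w * exp (- w) = 1) by (rewrite <- exp_plus, Rplus_opp_r; apply exp_0). nra. }
    rewrite ln_mult, ln_exp in H by lra. lra.
Qed.

Lemma ell1_bound (w : R) : 0 < w -> 0 <= w * ell1 w + 1 <= w.
Proof.
  intro Hw. unfold ell1. pose proof (exp_gt_1 w Hw). pose proof (exp_ineq1_le w).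
  pose proof (exp_ineq1_le (- w)) as E1.
  assert (P : exp w * exp (- w) = 1) by (rewrite <- exp_plus, Rplus_opp_r; apply exp_0).
  pose proof (exp_pos w).
  replace (w * - / (exp w - 1) + 1) with ((exp w - 1 - w) / (exp w - 1)) by (field; lra).
  split.
  - apply Rmult_le_pos; [lra|]. left; apply Rinv_0_lt_compat; lra.
  - apply Rle_div_l; [lra|]. nra.
Qed.

(** Up to sign, the remainder in the expansion [ell_tail w = zeta(3) + w^2/2 ln w - w^2/4 + ...] at
    0. *)
Definition ell_rem (w : R) : R := inv_cube_sum - ell_tail w + w ^ 2 / 2 * ln w - w ^ 2 / 4.

Lemma ln_inv_le (w : R) : 0 < w <= 1 -> 0 <= - ln w <= / w.
Proof.
  intro Hw. rewrite <- ln_Rinv by lra. assert (1 <= / w) by (rewrite <- Rinv_1; apply Rinv_le_contravar; lra).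
  split; [rewrite <- ln_1; apply ln_le; lra|].
  apply Rle_trans with (ln (exp (/ w))); [|rewrite ln_exp; lra].
  apply ln_le; [lra|]. pose proof (exp_ineq1_le (/ w)). lra.
Qed.

Lemma ell_rem_small (w : R) : 0 < w <= 1 -> Rabs (ell_rem w) <= (2 * inv_sq_sum + 1) * w.
Proof.
  intro Hw. unfold ell_rem, ell_tail. pose proof (exp_neg_01 w ltac:(lra)) as Hq.
  pose proof (li3_bound w ltac:(lra)). pose proof (li_bound 0 (exp (- w)) ltac:(lra)).
  assert (HC : 0 <= inv_sq_sum).
  { destruct (Rle_lt_dec 0 inv_sq_sum); [easy|]. exfalso. nra. }
  pose proof (ln_inv_le w Hw) as Hln.
  assert (0 <= w ^ 2 / 2 * - ln w <= w / 2).
  { split; [apply Rmult_le_pos; simpl; nra|].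
    replace (w / 2) with (w ^ 2 / 2 * / w) by (field; lra).
    apply Rmult_le_compat_l; [simpl; nra|lra]. }
  assert (0 <= w * li 2 (exp (- w)) <= w * inv_sq_sum) by (split; nra).
  assert (0 <= w ^ 2 <= w) by (simpl; nra).
  apply Rabs_le. split; nra.
Qed.

(** The derivative of [ell_rem] is [t (ell t + ln t)], which lies between 0 and [t^2], and [ell_rem]
    tends to 0 at the origin. *)
Lemma ell_rem_bound (w : R) : 0 < w -> Rabs (ell_rem w) <= w ^ 3.
Proof.
  intro Hw.
  assert (D : forall t, 0 < t -> is_derive ell_rem t (t * (ell t + ln t))).
  { intros t Ht. unfold ell_rem.
    replace (t * (ell t + ln t)) with ((0 - - (t * ell t)) + (t * ln t + t / 2) - t / 2) by field.
    apply (is_derive_minus (V := R_NormedModule)); [apply (is_derive_plus (V := R_NormedModule));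
      [apply (is_derive_minus (V := R_NormedModule))|]|].
    - apply (is_derive_const (V := R_NormedModule)).
    - now apply is_derive_ell_tail.
    - auto_derive; [lra|]. field. lra.
    - auto_derive; [easy|]. field. }
  set (K := 2 * inv_sq_sum + 1).
  apply le_epsilon. intros eps Heps.
  assert (HK : 0 < Rabs K + 1) by (pose proof (Rabs_pos K); lra).
  (* The formula is singular at 0, so integration starts at a small [e > 0], where [ell_rem] is at
     most [eps]. *)
  set (e := Rmin (Rmin w 1) (eps / (Rabs K + 1))).
  assert (He : 0 < e) by (apply Rmin_pos; [apply Rmin_pos; lra|now apply Rdiv_lt_0_compat]).
  assert (Hew : e <= w) by (eapply Rle_trans; [apply Rmin_l|apply Rmin_l]).
  assert (He1 : e <= 1) by (eapply Rle_trans; [apply Rmin_l|apply Rmin_r]).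
  assert (Hee : e * (Rabs K + 1) <= eps).
  { apply Rle_trans with (eps / (Rabs K + 1) * (Rabs K + 1)); [|right; field; lra].
    apply Rmult_le_compat_r; [lra|apply Rmin_r]. }
  assert (H1 : Rabs (ell_rem w - ell_rem e) <= w ^ 3 - e ^ 3).
  { apply (derive_abs_le ell_rem (fun t => t * (ell t + ln t)) (fun t => t ^ 3) (fun t => 3 * t ^ 2)); [lra| | |];
      intros t Ht.
    - apply D; lra.
    - auto_derive; [easy|ring].
    - pose proof (ell_plus_ln t ltac:(lra)). rewrite Rabs_pos_eq by nra. simpl. nra. }
  assert (H2 := ell_rem_small e ltac:(lra)). fold K in H2.
  assert (K * e <= eps).
  { apply Rle_trans with (2 := Hee). pose proof (Rle_abs K). nra. }
  assert (0 < e ^ 3) by now apply pow_lt.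
  replace (ell_rem w) with ((ell_rem w - ell_rem e) + ell_rem e) by ring.
  apply Rle_trans with (1 := Rabs_triang _ _). lra.
Qed.

Lemma filterlim_at_right_0 (f : R -> R) (l : R) :
  filterlim f (at_right 0) (locally l) <->
  forall eps, 0 < eps -> exists del, 0 < del /\ forall x, 0 < x < del -> Rabs (f x - l) < eps.
Proof.
  split.
  - intros H eps Heps.
    destruct (proj1 (filterlim_locally f l) H (mkposreal eps Heps)) as [d Hd].
    exists d. split; [apply cond_pos|]. intros x Hx. apply (Hd x); [|lra].
    unfold ball; simpl; unfold AbsRing_ball, abs, minus, plus, opp; simpl.
    apply Rabs_lt_between. lra.
  - intros H. apply filterlim_locally. intros [eps Heps].
    destruct (H eps Heps) as [d [Hd Hf]]. exists (mkposreal d Hd). intros x Hx Hx0.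
    unfold ball in *; simpl in *; unfold AbsRing_ball, abs, minus, plus, opp in *; simpl in *.
    apply Hf. apply Rabs_lt_between in Hx. lra.
Qed.

Lemma filterlim_at_right_linear (f : R -> R) (l C : R) :
  (forall x, 0 < x < 1 -> Rabs (f x - l) <= C * x) -> filterlim f (at_right 0) (locally l).
Proof.
  intro H. apply filterlim_at_right_0. intros eps Heps.
  assert (HC : 0 < Rabs C + 1) by (pose proof (Rabs_pos C); lra).
  exists (Rmin 1 (eps / (Rabs C + 1))). split.
  - apply Rmin_pos; [lra|now apply Rdiv_lt_0_compat].
  - intros x Hx. pose proof (Rmin_l 1 (eps / (Rabs C + 1))). pose proof (Rmin_r 1 (eps / (Rabs C + 1))).
    apply Rle_lt_trans with (1 := H x ltac:(lra)).
    assert (x * (Rabs C + 1) < eps).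
    { apply Rlt_le_trans with (eps / (Rabs C + 1) * (Rabs C + 1)); [|right; field; lra].
      apply Rmult_lt_compat_r; lra. }
    pose proof (Rle_abs C). nra.
Qed.

(** * Euler-Maclaurin summation of the logarithm *)

(** The antiderivative in [u] of [u * ell (u x)] that vanishes at infinity; at integers [u] the
    integrand [em_prim1] runs through the terms of the logarithm at [q = exp (- x)]. *)
Definition em_prim (x u : R) : R := - (ell_tail (u * x) / x ^ 2).
Definition em_prim1 (x u : R) : R := u * ell (u * x).
Definition em_prim2 (x u : R) : R := ell (u * x) + u * x * ell1 (u * x).
Definition em_prim3 (x u : R) : R := 2 * x * ell1 (u * x) + u * x ^ 2 * ell2 (u * x).
Definition em_prim4 (x u : R) : R := 3 * x ^ 2 * ell2 (u * x) + u * x ^ 3 * ell3 (u * x).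

(** The profile for [x] tending to 0: [u * ell (u x)] is close to [- u ln u - u ln x], and the
    second summand is invisible to [em_error]. *)
Definition xlnx_prim (u : R) : R := - (u ^ 2 / 2 * ln u) + u ^ 2 / 4.
Definition xlnx_prim1 (u : R) : R := - (u * ln u).
Definition xlnx_prim2 (u : R) : R := - ln u - 1.

(** Equal to zeta'(-1) + 1/6, as shown in [zeta'_m1_eq]. *)
Definition xlnx_em_sum : R :=
  Series (fun n => em_error xlnx_prim xlnx_prim1 xlnx_prim2 (INR (S n))).

Lemma is_derive_scaled (f f' : R -> R) (x u : R) :
  is_derive f (u * x) (f' (u * x)) -> is_derive (fun u => f (u * x)) u (x * f' (u * x)).
Proof.
  intro H. apply (is_derive_comp f (fun u => u * x)); [exact H|]. auto_derive; [easy|ring].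
Qed.

Lemma em_prim_derive (x u : R) : 0 < x -> 0 < u ->
  is_derive (em_prim x) u (em_prim1 x u) /\ is_derive (em_prim1 x) u (em_prim2 x u) /\
  is_derive (em_prim2 x) u (em_prim3 x u) /\ is_derive (em_prim3 x) u (em_prim4 x u).
Proof.
  intros Hx Hu. assert (Hux : 0 < u * x) by now apply Rmult_lt_0_compat.
  assert (DT := is_derive_scaled ell_tail (fun w => - (w * ell w)) x u (is_derive_ell_tail _ Hux)).
  assert (D0 := is_derive_scaled ell ell1 x u (is_derive_ell _ Hux)).
  assert (D1 := is_derive_scaled ell1 ell2 x u (is_derive_ell1 _ Hux)).
  assert (D2 := is_derive_scaled ell2 ell3 x u (is_derive_ell2 _ Hux)).
  assert (Hid : forall c, is_derive (fun v : R => c * v) u c) by (intro c; auto_derive; [easy|ring]).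
  unfold em_prim, em_prim1, em_prim2, em_prim3, em_prim4. refine (conj _ (conj _ (conj _ _))).
  - refine (is_derive_ext (fun v : R => (- / x ^ 2) * ell_tail (v * x)) _ u _ _ _).
    + intro v. unfold Rdiv. simpl. ring.
    + replace (u * ell (u * x)) with (- / x ^ 2 * (x * - (u * x * ell (u * x)))) by (field; lra).
      apply (is_derive_scal (fun v => ell_tail (v * x)) u (- / x ^ 2)). exact DT.
  - replace (ell (u * x) + u * x * ell1 (u * x))
      with (1 * ell (u * x) + u * (x * ell1 (u * x))) by ring.
    apply (is_derive_mult (fun v => v) (fun v => ell (v * x))); [|exact D0|apply Rmult_comm].
    auto_derive; [easy|ring].
  - replace (2 * x * ell1 (u * x) + u * x ^ 2 * ell2 (u * x))
      with (x * ell1 (u * x) + (x * ell1 (u * x) + (u * x) * (x * ell2 (u * x)))) by ring.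
    apply (is_derive_plus (V := R_NormedModule)); [exact D0|].
    apply (is_derive_mult (fun v => v * x) (fun v => ell1 (v * x))); [|exact D1|apply Rmult_comm].
    auto_derive; [easy|ring].
  - replace (3 * x ^ 2 * ell2 (u * x) + u * x ^ 3 * ell3 (u * x))
      with (2 * x * (x * ell2 (u * x)) + (x ^ 2 * ell2 (u * x) + (u * x ^ 2) * (x * ell3 (u * x)))) by ring.
    apply (is_derive_plus (V := R_NormedModule)).
    + apply (is_derive_scal (fun v => ell1 (v * x)) u (2 * x)). exact D1.
    + apply (is_derive_mult (fun v => v * x ^ 2) (fun v => ell2 (v * x))); [|exact D2|apply Rmult_comm].
      auto_derive; [easy|ring].
Qed.

Lemma em_prim4_bound (x u m : R) : 0 < x -> 0 < m <= u -> Rabs (em_prim4 x u) <= 23 * (/ m) ^ 2.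
Proof.
  intros Hx Hu. assert (Hux : 0 < u * x) by (apply Rmult_lt_0_compat; lra).
  assert (H := ell_fourth_bound _ Hux).
  assert (Hu2 : 0 < u ^ 2) by (apply pow_lt; lra).
  replace (em_prim4 x u) with
    ((3 * (u * x) ^ 2 * ell2 (u * x) + (u * x) ^ 3 * ell3 (u * x)) / u ^ 2)
    by (unfold em_prim4; field; lra).
  unfold Rdiv. rewrite Rabs_mult, (Rabs_pos_eq (/ u ^ 2)) by (left; now apply Rinv_0_lt_compat).
  apply Rmult_le_compat; [apply Rabs_pos|left; now apply Rinv_0_lt_compat|exact H|].
  rewrite pow_inv. apply Rinv_le_contravar; [apply pow_lt; lra|]. apply pow_incr; lra.
Qed.

Lemma em_prim_error_bound (x : R) (n : nat) : 0 < x ->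
  Rabs (em_error (em_prim x) (em_prim1 x) (em_prim2 x) (INR (S n))) <= 23 * harmonic_coef (S n) ^ 2.
Proof.
  intro Hx. assert (Hn : 0 < INR (S n)) by (apply lt_0_INR; lia).
  apply (em_error_bound _ _ _ (em_prim3 x) (em_prim4 x));
    intros t Ht; try (apply em_prim_derive; lra).
  apply em_prim4_bound; lra.
Qed.

(** After a suitable quadratic is added to the profile, [em_prim] and its first two derivatives
    differ from it by [O(x)] on [[m, m + 1]]. *)
Lemma em_prim_error_lim (n : nat) :
  filterlim (fun x => em_error (em_prim x) (em_prim1 x) (em_prim2 x) (INR (S n))) (at_right 0)
    (locally (em_error xlnx_prim xlnx_prim1 xlnx_prim2 (INR (S n)))).
Proof.
  set (m := INR (S n)). assert (Hm : 1 <= m) by (unfold m; apply (le_INR 1); lia).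
  apply (filterlim_at_right_linear _ _ (4 * (m + 1) ^ 3)). intros x Hx.
  (* These are the divergent parts of [em_prim x]: its limit value at [u = 0], and the [ln x]
     produced by [ln (u x) = ln u + ln x]. *)
  set (c0 := - inv_cube_sum / x ^ 2). set (c2 := - ln x / 2).
  rewrite <- (em_error_ext_quadratic (fun u => xlnx_prim u + c0 + c2 * u ^ 2)
    (fun u => xlnx_prim1 u + 2 * c2 * u) (fun u => xlnx_prim2 u + 2 * c2)
    xlnx_prim xlnx_prim1 xlnx_prim2 c0 c2 m) by easy.
  rewrite Rmult_assoc.
  assert (Hle : forall t, m <= t <= m + 1 -> 0 < t * x /\ t <= m + 1 /\ t ^ 2 <= (m + 1) ^ 3 /\ t ^ 3 <= (m + 1) ^ 3 /\ t <= (m + 1) ^ 3 /\ ln (t * x) = ln t + ln x).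
  { intros t Ht. assert (t ^ 3 <= (m + 1) ^ 3) by (apply pow_incr; lra).
    assert (1 <= t ^ 2) by (simpl; nra). assert (t <= t ^ 2) by (simpl; nra).
    assert (t ^ 2 <= t ^ 3) by (simpl in *; nra).
    repeat split; try lra; [apply Rmult_lt_0_compat; lra|apply ln_mult; lra]. }
  apply em_error_dist; intros t Ht; destruct (Hle t Ht) as [P [T1 [T2 [T3 [T4 L]]]]].
  - replace (em_prim x t - (xlnx_prim t + c0 + c2 * t ^ 2)) with (ell_rem (t * x) / x ^ 2).
    + unfold Rdiv. rewrite Rabs_mult, (Rabs_pos_eq (/ x ^ 2)) by (left; apply Rinv_0_lt_compat, pow_lt; lra).
      apply Rle_trans with ((t * x) ^ 3 * / x ^ 2).
      * apply Rmult_le_compat_r; [left; apply Rinv_0_lt_compat, pow_lt; lra|now apply ell_rem_bound].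
      * replace ((t * x) ^ 3 * / x ^ 2) with (t ^ 3 * x) by (field; lra). apply Rmult_le_compat_r; lra.
    + unfold ell_rem, em_prim, xlnx_prim, c0, c2. rewrite L. field. lra.
  - replace (em_prim1 x t - (xlnx_prim1 t + 2 * c2 * t)) with (t * (ell (t * x) + ln (t * x)))
      by (unfold em_prim1, xlnx_prim1, c2; rewrite L; field).
    pose proof (ell_plus_ln _ P). rewrite Rabs_pos_eq by nra.
    apply Rle_trans with (t ^ 2 * x); [simpl; nra|]. apply Rmult_le_compat_r; lra.
  - replace (em_prim2 x t - (xlnx_prim2 t + 2 * c2)) with
      ((ell (t * x) + ln (t * x)) + (t * x * ell1 (t * x) + 1))
      by (unfold em_prim2, xlnx_prim2, c2; rewrite L; field).
    pose proof (ell_plus_ln _ P). pose proof (ell1_bound _ P). rewrite Rabs_pos_eq by lra.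
    apply Rle_trans with (2 * t * x); [lra|]. apply Rmult_le_compat_r; [lra|].
    assert (2 * t <= t ^ 3 + 1) by (simpl; nra).
    assert (t ^ 3 + 1 <= (t + 1) ^ 3) by (simpl; nra).
    assert (2 * t <= 2 * (m + 1)) by lra.
    assert (2 * (m + 1) <= (m + 1) ^ 3) by (simpl; nra). lra.
Qed.

Lemma is_lim_seq_inv_bound (f : nat -> R) (C : R) :
  (forall n, (1 <= n)%nat -> Rabs (f n) <= C * / INR n) -> is_lim_seq f 0.
Proof.
  intro H. apply is_lim_seq_abs_0.
  assert (Hlim : is_lim_seq (fun n => C * / INR n) 0).
  { replace (Finite 0) with (Rbar_mult C 0) by (simpl; f_equal; ring).
    apply is_lim_seq_scal_l. apply (is_lim_seq_inv _ p_infty); [apply is_lim_seq_INR|easy]. }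
  apply (is_lim_seq_le_le_loc (fun _ => 0) _ (fun n => C * / INR n) 0);
    [|apply is_lim_seq_const|exact Hlim].
  exists 1%nat. intros n Hn. split; [apply Rabs_pos|now apply H].
Qed.

Lemma inv_exp_bounds (w : R) : 0 < w -> exp (- w) <= / w /\ w * exp (- w) <= 2 * / w.
Proof.
  intro Hw. destruct (exp_minus_1_bounds w Hw) as [E1 [E2 _]]. rewrite exp_Ropp.
  pose proof (exp_pos w). split.
  - apply Rinv_le_contravar; lra.
  - apply Rmult_le_reg_r with (exp w); [easy|]. rewrite Rmult_assoc, Rinv_l by lra.
    apply Rmult_le_reg_l with w; [easy|].
    replace (w * (2 * / w * exp w)) with (2 * exp w) by (field; lra). nra.
Qed.

Lemma is_lim_seq_em_prim (x : R) : 0 < x -> is_lim_seq (fun n => em_prim x (INR n)) 0.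
Proof.
  intro Hx. apply is_lim_seq_inv_bound with (3 * inv_sq_sum * / x ^ 3). intros n Hn.
  assert (Hn' : 0 < INR n) by (apply lt_0_INR; lia).
  assert (Hw : 0 < INR n * x) by now apply Rmult_lt_0_compat.
  pose proof (exp_neg_01 _ Hw) as Hq. destruct (inv_exp_bounds _ Hw) as [I1 I2].
  pose proof (li_bound 0 (exp (- (INR n * x))) ltac:(lra)) as L2.
  pose proof (li_bound 1 (exp (- (INR n * x))) ltac:(lra)) as L3.
  assert (HC : 0 <= inv_sq_sum) by nra.
  unfold em_prim, ell_tail. set (w := INR n * x) in *. set (q := exp (- w)) in *.
  rewrite Rabs_Ropp. assert (Px : 0 < x ^ 2) by now apply pow_lt.
  assert (HT : 0 <= w * li 2 q + li 3 q <= 3 * inv_sq_sum * / w).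
  { assert (0 <= w * li 2 q) by nra. assert (w * li 2 q <= inv_sq_sum * (w * q)) by nra. nra. }
  replace (3 * inv_sq_sum * / x ^ 3 * / INR n) with (3 * inv_sq_sum * / w / x ^ 2)
    by (unfold w; field; split; lra).
  assert (Hix : 0 <= / x ^ 2) by (left; now apply Rinv_0_lt_compat).
  unfold Rdiv. rewrite Rabs_mult, (Rabs_pos_eq (/ x ^ 2)), (Rabs_pos_eq (_ + _)) by lra.
  apply Rmult_le_compat_r; lra.
Qed.

Lemma is_lim_seq_em_prim2 (x : R) : 0 < x -> is_lim_seq (fun n => em_prim2 x (INR n)) 0.
Proof.
  intro Hx. apply is_lim_seq_inv_bound with (3 * / x). intros n Hn.
  assert (Hn' : 0 < INR n) by (apply lt_0_INR; lia).
  assert (Hw : 0 < INR n * x) by now apply Rmult_lt_0_compat.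
  unfold em_prim2, ell, ell1. set (w := INR n * x) in *.
  pose proof (exp_neg_01 w Hw) as Hq. destruct (exp_minus_1_bounds w Hw) as [E1 [E2 _]].
  pose proof (neg_ln_ge0 (exp (- w)) ltac:(lra)). pose proof (neg_ln_le (exp (- w)) ltac:(lra)).
  assert (P : exp (- w) / (1 - exp (- w)) = / (exp w - 1)).
  { rewrite exp_Ropp. pose proof (exp_pos w). field. split; lra. }
  assert (I1 : 0 < / (exp w - 1) <= / w).
  { split; [apply Rinv_0_lt_compat; lra|apply Rinv_le_contravar; lra]. }
  assert (I2 : w * / (exp w - 1) <= 2 * / w).
  { apply Rle_trans with (w * / (w ^ 2 / 2)).
    - apply Rmult_le_compat_l; [lra|]. apply Rinv_le_contravar; [|lra]. assert (0 < w ^ 2) by now apply pow_lt. lra.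
    - right. field. lra. }
  replace (3 * / x * / INR n) with (3 * / w) by (unfold w; field; lra).
  apply Rabs_le. split; nra.
Qed.

Lemma pp_log_term_ell (x : R) (m : nat) :
  pp_log_term (exp (- x)) m = em_prim1 x (INR (S m)).
Proof.
  unfold pp_log_term, em_prim1, ell. rewrite exp_pow. do 5 f_equal. ring.
Qed.

Lemma pp_log_em (x : R) : 0 < x ->
  Series (pp_log_term (exp (- x))) =
  Series (fun n => em_error (em_prim x) (em_prim1 x) (em_prim2 x) (INR (S n)))
  - em_prim x 1 + em_prim1 x 1 / 2 - em_prim2 x 1 / 12.
Proof.
  intro Hx. pose proof (exp_neg_01 x Hx) as Hq.
  assert (HL := Series_correct _ (ex_series_pp_log (exp (- x)) ltac:(lra))).
  set (L := Series (pp_log_term (exp (- x)))) in *.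
  assert (HL' : is_series (fun n => em_prim1 x (INR (S n))) L).
  { apply is_series_ext with (2 := HL). intro n. apply pp_log_term_ell. }
  rewrite (is_series_unique _ _ (is_series_em_error _ _ _ 0 L
    (is_lim_seq_em_prim x Hx) (is_lim_seq_em_prim2 x Hx) HL')). ring.
Qed.

(** The boundary terms at [u = 1] supply the rest. The term [- em_prim] gives
    [zeta(3)/x^2 + ln x / 2 - 1/4], half of [em_prim1] gives [- ln x / 2], and [- em_prim2 / 12]
    gives [ln x / 12 + 1/12]. The constants add up to [- 1/6]. *)
Lemma pp_log_asymp :
  filterlim (fun x => Series (pp_log_term (exp (- x))) - inv_cube_sum / x ^ 2 - ln x / 12)
    (at_right 0) (locally (xlnx_em_sum - 1 / 6)).
Proof.
  set (S1 := fun x => Series (fun n => em_error (em_prim x) (em_prim1 x) (em_prim2 x) (INR (S n)))).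
  assert (H1 : filterlim S1 (at_right 0) (locally xlnx_em_sum)).
  { apply (tannery (at_right 0) (fun x n => em_error (em_prim x) (em_prim1 x) (em_prim2 x) (INR (S n)))
      _ (fun n => 23 * harmonic_coef (S n) ^ 2)).
    - apply (ex_series_scal_l (V := R_NormedModule) 23 (fun n => harmonic_coef (S n) ^ 2)).
      apply (ex_series_incr_1 (fun n => harmonic_coef n ^ 2)), ex_series_inv_sq.
    - exists (mkposreal 1 Rlt_0_1). intros x _ Hx n. now apply em_prim_error_bound.
    - exact em_prim_error_lim. }
  apply filterlim_at_right_0. intros eps Heps.
  destruct (proj1 (filterlim_at_right_0 _ _) H1 (eps / 2) ltac:(lra)) as [d [Hd Hd']].
  exists (Rmin d (eps / 4)). split; [apply Rmin_pos; lra|]. intros x Hx.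
  pose proof (Rmin_l d (eps / 4)). pose proof (Rmin_r d (eps / 4)).
  specialize (Hd' x ltac:(lra)). rewrite pp_log_em by lra. fold (S1 x).
  unfold em_prim, em_prim1, em_prim2. rewrite !Rmult_1_l.
  pose proof (ell_plus_ln x ltac:(lra)). pose proof (ell1_bound x ltac:(lra)).
  pose proof (ell_rem_bound x ltac:(lra)) as HR.
  assert (HR' : Rabs (ell_rem x / x ^ 2) <= x).
  { unfold Rdiv. assert (0 < / x ^ 2) by (apply Rinv_0_lt_compat, pow_lt; lra).
    rewrite Rabs_mult, (Rabs_pos_eq (/ x ^ 2)) by lra.
    replace x with (x ^ 3 * / x ^ 2) at 3 by (field; lra). apply Rmult_le_compat_r; lra. }
  assert (ET : ell_tail x / x ^ 2 = inv_cube_sum / x ^ 2 + ln x / 2 - 1 / 4 - ell_rem x / x ^ 2)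
    by (unfold ell_rem; field; lra).
  rewrite ET. apply Rabs_le_between in HR'. apply Rabs_lt_between in Hd'.
  apply Rabs_lt_between. lra.
Qed.

(** * Complex series and Fourier coefficients *)

Notation Cseries := (is_series (K := C_AbsRing) (V := C_NormedModule)) (only parsing).
Notation Cpseries := (is_pseries (K := C_AbsRing) (V := C_NormedModule)) (only parsing).

Ltac eq_in_C := match goal with |- @eq _ ?a ?b => change (@eq C a b) end.

Ltac eq_in_R := match goal with |- @eq _ ?a ?b => change (@eq R a b) end.

Lemma Re_sum_n (a : nat -> C) (N : nat) :
  Re (sum_n (G := C_AbelianMonoid) a N) = sum_n (fun n => Re (a n)) N.
Proof. induction N as [|N IH]; [now rewrite !sum_O|]. rewrite !sum_Sn, <- IH. easy. Qed.

Lemma Im_sum_n (a : nat -> C) (N : nat) :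
  Im (sum_n (G := C_AbelianMonoid) a N) = sum_n (fun n => Im (a n)) N.
Proof. induction N as [|N IH]; [now rewrite !sum_O|]. rewrite !sum_Sn, <- IH. easy. Qed.

Lemma Cseries_Re_Im (a : nat -> C) (l : C) :
  Cseries a l <-> is_series (fun n => Re (a n)) (Re l) /\ is_series (fun n => Im (a n)) (Im l).
Proof.
  split.
  - intro H. split.
    + refine (filterlim_ext (fun N => Re (sum_n (G := C_AbelianMonoid) a N)) _ _ _);
        [apply Re_sum_n|].
      apply (filterlim_comp _ _ _ (sum_n (G := C_AbelianMonoid) a) Re _ (locally (T := C_UniformSpace) l) _ H).
      intros P [e He]. exists e. intros y Hy. apply He. apply Hy.
    + refine (filterlim_ext (fun N => Im (sum_n (G := C_AbelianMonoid) a N)) _ _ _);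
        [apply Im_sum_n|].
      apply (filterlim_comp _ _ _ (sum_n (G := C_AbelianMonoid) a) Im _ (locally (T := C_UniformSpace) l) _ H).
      intros P [e He]. exists e. intros y Hy. apply He. apply Hy.
  - intros [H1 H2]. apply (filterlim_locally (U := C_UniformSpace)). intro eps.
    assert (K1 := proj1 (filterlim_locally _ _) H1 eps).
    assert (K2 := proj1 (filterlim_locally _ _) H2 eps).
    apply filter_imp with (2 := filter_and _ _ K1 K2). intros N [L1 L2].
    rewrite <- Re_sum_n in L1. rewrite <- Im_sum_n in L2. split; [exact L1|exact L2].
Qed.

Definition cis (y : R) : C := (cos y, sin y).

Lemma cis_plus (x y : R) : cis (x + y) = (cis x * cis y)%C.
Proof. unfold cis, Cmult; simpl. rewrite cos_plus, sin_plus. f_equal; ring. Qed.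

Lemma cis_0 : cis 0 = RtoC 1.
Proof. unfold cis. now rewrite cos_0, sin_0. Qed.

Lemma Cmod_cis (y : R) : Cmod (cis y) = 1.
Proof.
  unfold Cmod, cis; simpl. transitivity (sqrt 1); [|apply sqrt_1].
  f_equal. pose proof (sin2_cos2 y) as H. unfold Rsqr in H. lra.
Qed.

Lemma pow_n_cis (r y : R) (n : nat) :
  pow_n (K := C_AbsRing) (RtoC r * cis y)%C n = (RtoC (r ^ n) * cis (INR n * y))%C.
Proof.
  induction n as [|n IH].
  - simpl. rewrite Rmult_0_l, cis_0. now rewrite Cmult_1_r.
  - change (pow_n (K := C_AbsRing) (RtoC r * cis y)%C (S n)) with
      ((RtoC r * cis y) * pow_n (K := C_AbsRing) (RtoC r * cis y)%C n)%C.
    rewrite IH, S_INR. replace ((INR n + 1) * y) with (y + INR n * y) by ring.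
    rewrite cis_plus. simpl pow. rewrite RtoC_mult. eq_in_C. ring.
Qed.

Lemma Cmod_pow_n (z : C) (n : nat) : Cmod (pow_n (K := C_AbsRing) z n) = Cmod z ^ n.
Proof.
  induction n as [|n IH]; [apply Cmod_1|].
  change (pow_n (K := C_AbsRing) z (S n)) with (z * pow_n (K := C_AbsRing) z n)%C.
  now rewrite Cmod_mult, IH.
Qed.

Lemma im_le_Cmod (z : C) : Rabs (Im z) <= Cmod z.
Proof. apply Rle_trans with (2 := Rmax_Cmod z). apply Rmax_r. Qed.

Lemma Cmod_le_Re_Im (z : C) : Cmod z <= Rabs (Re z) + Rabs (Im z).
Proof.
  destruct z as [x y]. unfold Cmod; simpl fst; simpl snd; unfold Re, Im; simpl.
  pose proof (Rabs_pos x). pose proof (Rabs_pos y).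
  rewrite <- (sqrt_pow2 (Rabs x + Rabs y)) by lra. apply sqrt_le_1_alt.
  assert (E1 : Rabs x * Rabs x = x * x) by (rewrite <- Rabs_mult; apply Rabs_pos_eq; nra).
  assert (E2 : Rabs y * Rabs y = y * y) by (rewrite <- Rabs_mult; apply Rabs_pos_eq; nra).
  simpl. nra.
Qed.

Lemma Cseries_of_abs (a : nat -> C) : ex_series (fun n => Cmod (a n)) -> exists l, Cseries a l.
Proof.
  intro H. exists (Series (fun n => Re (a n)), Series (fun n => Im (a n))).
  apply Cseries_Re_Im. split; apply Series_correct;
    apply (ex_series_le (V := R_CompleteNormedModule) _ (fun n => Cmod (a n))); try exact H;
    intro n; [apply re_le_Cmod|apply im_le_Cmod].
Qed.

Lemma Cseries_unique (a : nat -> C) (l l' : C) : Cseries a l -> Cseries a l' -> l = l'.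
Proof.
  intros H H'. apply Cseries_Re_Im in H, H'. destruct H as [H1 H2], H' as [H1' H2'].
  destruct l as [x y], l' as [x' y']. simpl in *.
  f_equal; [rewrite <- (is_series_unique _ _ H1); now apply is_series_unique|
            rewrite <- (is_series_unique _ _ H2); now apply is_series_unique].
Qed.

Lemma Cmod_Cseries_le (a : nat -> C) (b : nat -> R) (l : C) (B : R) :
  (forall n, Cmod (a n) <= b n) -> Cseries a l -> is_series b B -> Cmod l <= B.
Proof.
  intros Hab Ha Hb.
  apply (is_lim_seq_le (fun N => norm (V := C_NormedModule) (sum_n (G := C_AbelianMonoid) a N)) (sum_n b) (Cmod l) B).
  - intro N. apply Rle_trans with (sum_n (fun n => Cmod (a n)) N).
    + induction N as [|N IH]; [rewrite !sum_O; apply Rle_refl|]. rewrite !sum_Sn.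
      apply Rle_trans with (1 := Cmod_triangle _ _). apply Rplus_le_compat_r. exact IH.
    + rewrite !sum_n_Reals. apply sum_Rle. intros; apply Hab.
  - apply (filterlim_comp _ _ _ (sum_n (G := C_AbelianMonoid) a) (norm (V := C_NormedModule)) _ (locally (T := C_UniformSpace) l) _ Ha).
    apply (filterlim_norm (V := C_NormedModule)).
  - exact Hb.
Qed.

(** * Fourier coefficients and Cauchy's estimate *)

Lemma is_RInt_cos_sin (k : Z) (al be : R) :
  is_RInt (fun y => al * cos (IZR k * y) + be * sin (IZR k * y)) (- PI) PI
    (if Z.eq_dec k 0 then 2 * PI * al else 0).
Proof.
  destruct (Z.eq_dec k 0) as [->|Hk].
  - apply (is_RInt_ext (fun _ => al)).
    + intros y _. rewrite Rmult_0_l, cos_0, sin_0. eq_in_R. ring.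
    + replace (2 * PI * al) with (scal (PI - - PI) al) by (unfold scal; simpl; unfold mult; simpl; eq_in_R; ring).
      apply (is_RInt_const (V := R_NormedModule)).
  - assert (HkR : IZR k <> 0) by (now apply not_0_IZR).
    set (G := fun y => al * sin (IZR k * y) / IZR k - be * cos (IZR k * y) / IZR k).
    replace 0 with (minus (G PI) (G (- PI))).
    + apply (is_RInt_derive G).
      * intros y _. unfold G. auto_derive; [easy|]. field. exact HkR.
      * intros y _. apply (ex_derive_continuous (V := R_NormedModule)). auto_derive. easy.
    + unfold G, minus, plus, opp; simpl.
      assert (S1 : sin (IZR k * PI) = 0) by (apply sin_eq_0_1; now exists k).
      replace (IZR k * - PI) with (- (IZR k * PI)) by ring.
      rewrite sin_neg, cos_neg, S1. field. exact HkR.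
Qed.

(** Absolute summability makes the partial sums converge uniformly, so integration is termwise, and
    only the term [m = n] survives. *)
Lemma is_RInt_fourier (al be : nat -> R) (n : nat) :
  ex_series (fun m => Rabs (al m)) -> ex_series (fun m => Rabs (be m)) ->
  is_RInt (fun y => Series (fun m => al m * cos ((INR m - INR n) * y) + be m * sin ((INR m - INR n) * y)))
    (- PI) PI (2 * PI * al n).
Proof.
  intros Ha Hb.
  set (f := fun (N : nat) (y : R) =>
    sum_n (fun m => al m * cos ((INR m - INR n) * y) + be m * sin ((INR m - INR n) * y)) N).
  set (g := fun y => Series (fun m => al m * cos ((INR m - INR n) * y) + be m * sin ((INR m - INR n) * y))).
  set (t := fun m => if Z.eq_dec (Z.of_nat m - Z.of_nat n) 0 then 2 * PI * al m else 0).
  assert (Hf : forall N, is_RInt (f N) (- PI) PI (sum_n t N)).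
  { intro N. unfold f. induction N as [|N IH].
    - rewrite sum_O. apply (is_RInt_ext (fun y => al 0%nat * cos (IZR (Z.of_nat 0 - Z.of_nat n) * y)
        + be 0%nat * sin (IZR (Z.of_nat 0 - Z.of_nat n) * y))).
      + intros y _. now rewrite sum_O, minus_IZR, <- !INR_IZR_INZ.
      + apply is_RInt_cos_sin.
    - rewrite sum_Sn.
      apply (is_RInt_ext (fun y => plus (sum_n (fun m => al m * cos ((INR m - INR n) * y) + be m * sin ((INR m - INR n) * y)) N)
        (al (S N) * cos (IZR (Z.of_nat (S N) - Z.of_nat n) * y)
        + be (S N) * sin (IZR (Z.of_nat (S N) - Z.of_nat n) * y)))).
      + intros y _. now rewrite sum_Sn, minus_IZR, <- !INR_IZR_INZ.
      + apply (is_RInt_plus (V := R_NormedModule)); [exact IH|apply is_RInt_cos_sin]. }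
  assert (Hbd : forall m y, Rabs (al m * cos ((INR m - INR n) * y) + be m * sin ((INR m - INR n) * y)) <= Rabs (al m) + Rabs (be m)).
  { intros m y. apply Rle_trans with (1 := Rabs_triang _ _). rewrite !Rabs_mult.
    assert (Rabs (cos ((INR m - INR n) * y)) <= 1) by (apply Rabs_le, COS_bound).
    assert (Rabs (sin ((INR m - INR n) * y)) <= 1) by (apply Rabs_le, SIN_bound).
    pose proof (Rabs_pos (al m)). pose proof (Rabs_pos (be m)). nra. }
  assert (Hab : ex_series (fun m => Rabs (al m) + Rabs (be m))) by (apply (ex_series_plus (V := R_NormedModule)); easy).
  assert (Hunif : filterlim f eventually (locally (T := fct_UniformSpace R R_UniformSpace) g)).
  { apply (filterlim_locally (U := fct_UniformSpace R R_UniformSpace)). intro eps.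
    assert (Hs := Series_correct _ Hab).
    destruct (proj1 (filterlim_locally _ _) Hs eps) as [N0 HN0].
    exists N0. intros N HN y. specialize (HN0 N HN).
    unfold ball in HN0; simpl in HN0; unfold AbsRing_ball, abs, minus, plus, opp in HN0; simpl in HN0.
    unfold ball; simpl; unfold AbsRing_ball, abs, minus, plus, opp; simpl.
    set (c := fun m => al m * cos ((INR m - INR n) * y) + be m * sin ((INR m - INR n) * y)).
    set (d := fun m => Rabs (al m) + Rabs (be m)) in *.
    assert (Ec : ex_series c) by (apply (ex_series_le (V := R_CompleteNormedModule) c d); [intro m; apply Hbd|exact Hab]).
    unfold f, g. fold c. rewrite sum_n_Reals in HN0 |- *.
    rewrite (Series_incr_n d (S N)) in HN0 by (lia || exact Hab).
    rewrite (Series_incr_n c (S N)) by (lia || exact Ec). simpl pred in *.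
    assert (Hd' : ex_series (fun k => d (S N + k)%nat)) by now apply (ex_series_incr_n d (S N)).
    assert (T : Rabs (Series (fun k => c (S N + k)%nat)) <= Series (fun k => d (S N + k)%nat)).
    { apply Rle_trans with (Series (fun k => Rabs (c (S N + k)%nat))).
      - apply Series_Rabs. apply (ex_series_le (V := R_CompleteNormedModule) _ (fun k => d (S N + k)%nat)); [|exact Hd'].
        intro k. unfold norm; simpl; unfold abs; simpl. rewrite Rabs_Rabsolu. apply Hbd.
      - apply Series_le; [|exact Hd']. intro k. split; [apply Rabs_pos|apply Hbd]. }
    apply Rabs_lt_between in HN0. apply Rabs_le_between in T. apply Rabs_lt_between. lra. }
  destruct (filterlim_RInt f (- PI) PI eventually _ g (sum_n t) Hf Hunif) as [I [HI1 HI2]].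
  replace (2 * PI * al n) with I; [exact HI2|].
  assert (Ht : is_series t (2 * PI * al n)).
  { replace (2 * PI * al n) with (sum_f_R0 t n).
    - apply is_series_finite. intros m Hm. unfold t. destruct (Z.eq_dec _ 0); [lia|easy].
    - assert (T0 : t n = 2 * PI * al n) by (unfold t; destruct (Z.eq_dec _ 0); [easy|lia]).
      destruct n as [|n]; [exact T0|]. rewrite tech5, T0.
      rewrite (sum_eq _ (fun _ => 0)); [rewrite sum_cte; ring|].
      intros i Hi. unfold t. destruct (Z.eq_dec _ 0); [lia|easy]. }
  apply (filterlim_locally_unique (V := R_NormedModule) (F := eventually) (sum_n t)); [exact HI1|exact Ht].
Qed.

Lemma Cpseries_bounded (a : nat -> C) (z l : C) : Cpseries a z l ->
  exists B, forall n, Cmod (a n) * Cmod z ^ n <= B.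
Proof.
  intro H. apply Cseries_Re_Im in H. destruct H as [H1 H2].
  assert (Hb : forall u : nat -> R, forall l, is_series u l -> exists B, forall n, Rabs (u n) <= B).
  { intros u l' Hu. assert (Hl : is_lim_seq u 0) by (apply ex_series_lim_0; now exists l').
    destruct (filterlim_bounded (V := R_NormedModule) u (ex_intro _ 0 Hl)) as [B HB]. now exists B. }
  destruct (Hb _ _ H1) as [B1 HB1]. destruct (Hb _ _ H2) as [B2 HB2].
  exists (B1 + B2). intro n.
  rewrite <- Cmod_pow_n, Rmult_comm, <- Cmod_mult.
  apply Rle_trans with (1 := Cmod_le_Re_Im _).
  specialize (HB1 n). specialize (HB2 n). unfold scal in HB1, HB2; simpl in HB1, HB2.
  apply Rplus_le_compat; [exact HB1|exact HB2].
Qed.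

Lemma Cpseries_abs (a : nat -> C) (l : C) (r rho : R) : 0 <= rho < r ->
  Cpseries a (RtoC r) l -> ex_series (fun n => Cmod (a n) * rho ^ n).
Proof.
  intros Hr H. destruct (Cpseries_bounded _ _ _ H) as [B HB].
  rewrite Cmod_R, Rabs_pos_eq in HB by lra.
  apply (ex_series_le (V := R_CompleteNormedModule) _ (fun n => scal B ((rho / r) ^ n))).
  - intro n. unfold norm; simpl; unfold abs; simpl. unfold scal; simpl; unfold mult; simpl.
    pose proof (Cmod_ge_0 (a n)). assert (0 <= rho ^ n) by (apply pow_le; lra).
    rewrite Rabs_pos_eq by nra.
    replace (Cmod (a n) * rho ^ n) with (Cmod (a n) * r ^ n * (rho / r) ^ n).
    + apply Rmult_le_compat_r; [|apply HB]. apply pow_le. apply Rmult_le_pos; [lra|].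
      left; apply Rinv_0_lt_compat; lra.
    + unfold Rdiv. rewrite Rpow_mult_distr, pow_inv. field. apply pow_nonzero. lra.
  - apply (ex_series_scal_l (V := R_NormedModule)). apply ex_series_geom.
    rewrite Rabs_pos_eq.
    + apply Rlt_div_l; lra.
    + apply Rmult_le_pos; [lra|]. left; apply Rinv_0_lt_compat; lra.
Qed.

(** The coefficient is a Fourier coefficient of [f] on the circle of radius [rho], so no contour
    integral is involved. *)
Lemma cauchy_estimate (a : nat -> C) (f : C -> C) (rho M : R) (n : nat) : 0 < rho ->
  ex_series (fun n => Cmod (a n) * rho ^ n) ->
  (forall z, Cmod z = rho -> Cpseries a z (f z)) ->
  (forall z, Cmod z = rho -> Cmod (f z) <= M) -> Cmod (a n) * rho ^ n <= M.
Proof.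
  intros Hr Hex Hf HM.
  (* A unimodular factor rotates [a n] onto the nonnegative axis, which makes the real part of the
     integral equal to the modulus. *)
  assert (Hu : exists u : C, Cmod u = 1 /\ (u * a n)%C = RtoC (Cmod (a n))).
  { destruct (Req_dec (Cmod (a n)) 0) as [E|E].
    - exists (RtoC 1). split; [apply Cmod_1|]. apply Cmod_eq_0 in E. rewrite E, Cmod_0. eq_in_C. ring.
    - assert (P : 0 < Cmod (a n)) by (pose proof (Cmod_ge_0 (a n)); lra).
      exists (Cconj (a n) * RtoC (/ Cmod (a n)))%C. split.
      + rewrite Cmod_mult, Cmod_conj, Cmod_R, Rabs_pos_eq; [field; lra|].
        left. now apply Rinv_0_lt_compat.
      + transitivity (RtoC (/ Cmod (a n)) * (a n * Cconj (a n)))%C; [ring|].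
        rewrite <- Cmod2_conj, <- RtoC_mult. f_equal. field. lra. }
  destruct Hu as [u [Hu1 Hu2]].
  set (al := fun m => Re (u * a m)%C * rho ^ m).
  set (be := fun m => - Im (u * a m)%C * rho ^ m).
  assert (Hterm : forall m, Cmod (u * a m)%C = Cmod (a m)) by (intro; rewrite Cmod_mult, Hu1; ring).
  assert (Hpow : forall m, 0 <= rho ^ m) by (intro; apply pow_le; lra).
  assert (Hal : ex_series (fun m => Rabs (al m))).
  { apply (ex_series_le (V := R_CompleteNormedModule) _ (fun n => Cmod (a n) * rho ^ n)); [|exact Hex].
    intro m. unfold norm; simpl; unfold abs; simpl. rewrite Rabs_Rabsolu. unfold al.
    rewrite Rabs_mult, (Rabs_pos_eq (rho ^ m)) by easy. apply Rmult_le_compat_r; [easy|].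
    rewrite <- Hterm. apply re_le_Cmod. }
  assert (Hbe : ex_series (fun m => Rabs (be m))).
  { apply (ex_series_le (V := R_CompleteNormedModule) _ (fun n => Cmod (a n) * rho ^ n)); [|exact Hex].
    intro m. unfold norm; simpl; unfold abs; simpl. rewrite Rabs_Rabsolu. unfold be.
    rewrite Rabs_mult, (Rabs_pos_eq (rho ^ m)), Rabs_Ropp by easy. apply Rmult_le_compat_r; [easy|].
    rewrite <- Hterm. apply im_le_Cmod. }
  assert (HI := is_RInt_fourier al be n Hal Hbe).
  assert (Hal_n : al n = Cmod (a n) * rho ^ n).
  { unfold al. rewrite Hu2. now rewrite re_RtoC. }
  rewrite Hal_n in HI.
  assert (HJ := is_RInt_const (V := R_NormedModule) (- PI) PI M).
  assert (Hle : 2 * PI * (Cmod (a n) * rho ^ n) <= scal (PI - - PI) M).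
  { apply (is_RInt_le _ _ (- PI) PI _ _ ltac:(pose proof PI_RGT_0; lra) HI HJ).
    intros y _. set (z := (RtoC rho * cis y)%C).
    assert (Hz : Cmod z = rho) by (unfold z; rewrite Cmod_mult, Cmod_cis, Cmod_R, Rabs_pos_eq; lra).
    assert (HS := is_series_scal_l (K := C_AbsRing) (V := C_NormedModule) (u * cis (- INR n * y))%C _ _ (Hf z Hz)).
    apply Cseries_Re_Im in HS. destruct HS as [HS _].
    rewrite (is_series_unique (fun m => al m * cos ((INR m - INR n) * y) + be m * sin ((INR m - INR n) * y))
      (Re (u * cis (- INR n * y) * f z)%C)).
    - apply Rle_trans with (1 := Rle_abs _). apply Rle_trans with (1 := re_le_Cmod _).
      rewrite !Cmod_mult, Hu1, Cmod_cis, !Rmult_1_l. now apply HM.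
    - apply is_series_ext with (2 := HS). intro m.
      change (Re (u * cis (- INR n * y) * (pow_n (K := C_AbsRing) z m * a m))%C =
        al m * cos ((INR m - INR n) * y) + be m * sin ((INR m - INR n) * y)).
      unfold z. rewrite pow_n_cis.
      transitivity (Re (u * a m * (RtoC (rho ^ m) * cis ((INR m - INR n) * y)))%C).
      + apply (f_equal Re). replace ((INR m - INR n) * y) with (- INR n * y + INR m * y) by ring.
        rewrite cis_plus. eq_in_C. ring.
      + unfold al, be. destruct (u * a m)%C as [p q]. unfold cis. simpl. ring. }
  unfold scal in Hle; simpl in Hle; unfold mult in Hle; simpl in Hle.
  pose proof PI_RGT_0. nra.
Qed.

(** Adding [M m * kap ^ j] makes every term nonnegative. Tonelli then applies, and the added
    geometric part is subtracted again. *)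
Lemma fubini_geom (t : nat -> nat -> R) (M r s : nat -> R) (kap : R) : 0 <= kap < 1 ->
  (forall m j, Rabs (t m j) <= M m * kap ^ j) -> ex_series M ->
  (forall m, is_series (t m) (r m)) -> (forall j, is_series (fun m => t m j) (s j)) ->
  is_series s (Series r).
Proof.
  intros Hk Ht HM Hr Hs.
  assert (HM0 : forall m, 0 <= M m).
  { intro m. specialize (Ht m 0%nat). simpl in Ht. pose proof (Rabs_pos (t m 0%nat)). lra. }
  assert (Hg := is_series_geom kap ltac:(rewrite Rabs_pos_eq; lra)).
  assert (Hrow : forall m, is_series (fun j => M m * kap ^ j) (M m * / (1 - kap)))
    by (intro m; apply (is_series_scal_l (K := R_AbsRing) (V := R_NormedModule) (M m) _ _ Hg)).
  assert (Hrb : forall m, Rabs (r m) <= M m * / (1 - kap)).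
  { intro m. rewrite <- (is_series_unique _ _ (Hr m)), <- (is_series_unique _ _ (Hrow m)).
    assert (E : ex_series (fun j => M m * kap ^ j)) by (eexists; apply Hrow).
    apply Rle_trans with (Series (fun j => Rabs (t m j))).
    - apply Series_Rabs. apply (ex_series_le (V := R_CompleteNormedModule) _ (fun j => M m * kap ^ j)); [|exact E].
      intro j. unfold norm; simpl; unfold abs; simpl. rewrite Rabs_Rabsolu. apply Ht.
    - apply Series_le; [|exact E]. intro j. split; [apply Rabs_pos|apply Ht]. }
  assert (HMs := Series_correct _ HM). set (SM := Series M) in *.
  assert (Hrs : is_series r (Series r)).
  { apply Series_correct. apply (ex_series_le (V := R_CompleteNormedModule) r (fun m => M m * / (1 - kap))).
    - intro m. apply Hrb.
    - apply (ex_series_scal_r (/ (1 - kap)) M HM). }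
  assert (Htot : is_series (fun j => s j + SM * kap ^ j) (Series r + SM * / (1 - kap))).
  { apply (tonelli (fun m j => t m j + M m * kap ^ j) (fun m => r m + M m * / (1 - kap))).
    - intros m j. specialize (Ht m j). apply Rabs_le_between in Ht. lra.
    - intro m. apply (is_series_plus (V := R_NormedModule) _ _ _ _ (Hr m) (Hrow m)).
    - apply (is_series_plus (V := R_NormedModule) _ _ _ _ Hrs (is_series_scal_r _ _ _ HMs)).
    - intro j. apply (is_series_plus (V := R_NormedModule) _ _ _ _ (Hs j) (is_series_scal_r _ _ _ HMs)). }
  assert (Hg' : is_series (fun j => SM * kap ^ j) (SM * / (1 - kap)))
    by (apply (is_series_scal_l (K := R_AbsRing) (V := R_NormedModule) SM _ _ Hg)).
  assert (Hd := is_series_minus (V := R_NormedModule) _ _ _ _ Htot Hg').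
  replace (Series r) with (plus (Series r + SM * / (1 - kap)) (opp (SM * / (1 - kap))))
    by (unfold plus, opp; simpl; ring).
  apply is_series_ext with (2 := Hd). intro j. unfold plus, opp; simpl. eq_in_R. ring.
Qed.

(** Cauchy's estimate bounds coefficient [j] of the summand [m] by [M m / rho^j]. For [|z| < rho]
    the double series is thus dominated geometrically in [j] and may be summed by columns. *)
Lemma weierstrass_pseries (w : nat -> C -> C) (a : nat -> nat -> C) (M : nat -> R) (rho : R) : 0 < rho ->
  (forall m z, Cpseries (a m) z (w m z)) ->
  (forall m z, Cmod z <= rho -> Cmod (w m z) <= M m) -> ex_series M ->
  exists b, forall z, Cmod z < rho ->
    exists l, Cseries (fun m => w m z) l /\ Cpseries b z l.
Proof.
  intros Hr Hw HM HMs.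
  assert (Hcoef : forall m j, Cmod (a m j) * rho ^ j <= M m).
  { intros m j. apply (cauchy_estimate (a m) (w m) rho (M m) j Hr).
    - apply (Cpseries_abs (a m) (w m (RtoC (rho + 1))) (rho + 1) rho); [lra|apply Hw].
    - intros z _. apply Hw.
    - intros z Hz. apply HM. lra. }
  assert (Hpr : forall j, 0 < rho ^ j) by (intro; now apply pow_lt).
  assert (Hcol : forall j, exists l, Cseries (fun m => a m j) l).
  { intro j. apply Cseries_of_abs.
    apply (ex_series_le (V := R_CompleteNormedModule) _ (fun m => M m * / rho ^ j)).
    - intro m. unfold norm; simpl; unfold abs; simpl. rewrite Rabs_pos_eq by apply Cmod_ge_0.
      apply (proj1 (Rle_div_r _ _ _ (Hpr j))). apply Hcoef.
    - apply (ex_series_scal_r (/ rho ^ j) M HMs). }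
  set (b := fun j => (Series (fun m => Re (a m j)), Series (fun m => Im (a m j))) : C).
  assert (Hb : forall j, Cseries (fun m => a m j) (b j)).
  { intro j. destruct (Hcol j) as [l Hl]. apply Cseries_Re_Im in Hl. destruct Hl as [L1 L2].
    apply Cseries_Re_Im. split; apply Series_correct; eexists; eassumption. }
  exists b. intros z Hz.
  set (kap := Cmod z / rho).
  assert (Hk : 0 <= kap < 1).
  { unfold kap. split; [|apply Rlt_div_l; lra]. apply Rmult_le_pos; [apply Cmod_ge_0|].
    left; now apply Rinv_0_lt_compat. }
  assert (Hws : exists l, Cseries (fun m => w m z) l).
  { apply Cseries_of_abs. apply (ex_series_le (V := R_CompleteNormedModule) _ M); [|exact HMs].
    intro m. unfold norm; simpl; unfold abs; simpl. rewrite Rabs_pos_eq by apply Cmod_ge_0.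
    apply HM. lra. }
  destruct Hws as [l Hl]. exists l. split; [exact Hl|].
  set (t := fun m j => (pow_n (K := C_AbsRing) z j * a m j)%C).
  assert (Ht : forall m j, Cmod (t m j) <= M m * kap ^ j).
  { intros m j. unfold t, kap, Rdiv. rewrite Cmod_mult, Cmod_pow_n, Rpow_mult_distr, pow_inv.
    assert (0 <= Cmod z ^ j) by (apply pow_le, Cmod_ge_0).
    replace (Cmod z ^ j * Cmod (a m j)) with ((Cmod (a m j) * rho ^ j) * (Cmod z ^ j * / rho ^ j))
      by (field; apply Rgt_not_eq, Hpr).
    apply Rmult_le_compat_r; [|apply Hcoef]. apply Rmult_le_pos; [easy|]. left; apply Rinv_0_lt_compat, Hpr. }
  assert (Hrow : forall m, Cseries (t m) (w m z)) by (intro m; apply (Hw m z)).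
  assert (Hcols : forall j, Cseries (fun m => t m j) (pow_n (K := C_AbsRing) z j * b j)%C).
  { intro j. apply (is_series_scal_l (K := C_AbsRing) (V := C_NormedModule) (pow_n (K := C_AbsRing) z j) _ _ (Hb j)). }
  apply Cseries_Re_Im in Hl. destruct Hl as [Hl1 Hl2].
  apply Cseries_Re_Im. split.
  - rewrite <- (is_series_unique _ _ Hl1).
    apply (fubini_geom (fun m j => Re (t m j)) M _ _ kap Hk); [|exact HMs| |].
    + intros m j. apply Rle_trans with (1 := re_le_Cmod _). apply Ht.
    + intro m. apply (proj1 (proj1 (Cseries_Re_Im _ _) (Hrow m))).
    + intro j. apply (proj1 (proj1 (Cseries_Re_Im _ _) (Hcols j))).
  - rewrite <- (is_series_unique _ _ Hl2).
    apply (fubini_geom (fun m j => Im (t m j)) M _ _ kap Hk); [|exact HMs| |].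
    + intros m j. apply Rle_trans with (1 := im_le_Cmod _). apply Ht.
    + intro m. apply (proj2 (proj1 (Cseries_Re_Im _ _) (Hrow m))).
    + intro j. apply (proj2 (proj1 (Cseries_Re_Im _ _) (Hcols j))).
Qed.

(** Coefficients bounded at radius [r / 2] give geometric domination at radius [r / 4]. The value of
    [f] at 0 is left free, so the constant coefficient stands in for it. *)
Lemma Cpseries_near_0 (a : nat -> C) (f : C -> C) (r : R) : 0 < r ->
  (forall z, 0 < Cmod z < r -> Cpseries a z (f z)) ->
  exists B, forall z, 0 < Cmod z <= r / 4 -> Cmod (f z - a 0%nat)%C <= B * Cmod z.
Proof.
  intros Hr Hf.
  assert (Hr2 : Cmod (RtoC (r / 2)) = r / 2) by (rewrite Cmod_R, Rabs_pos_eq; lra).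
  destruct (Cpseries_bounded a _ _ (Hf (RtoC (r / 2)) ltac:(lra))) as [B HB].
  rewrite Hr2 in HB. exists (4 * B / r). intros z Hz.
  assert (HB0 : 0 <= B).
  { specialize (HB 0%nat). simpl in HB. pose proof (Cmod_ge_0 (a 0%nat)). lra. }
  assert (HS : Cseries (fun k => scal (pow_n (K := C_AbsRing) z (S k)) (a (S k))) (f z - a 0%nat)%C).
  { apply (is_series_incr_1 (K := C_AbsRing) (V := C_NormedModule) (fun k => scal (pow_n (K := C_AbsRing) z k) (a k))).
    refine (eq_ind (f z) (fun l : C => Cseries _ l) (Hf z ltac:(lra)) _ _).
    change (f z = f z - a 0%nat + RtoC 1 * a 0%nat)%C. ring. }
  assert (Hg := is_series_geom (1 / 2) ltac:(rewrite Rabs_pos_eq; lra)).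
  replace (4 * B / r * Cmod z) with (B * (2 * Cmod z / r) * / (1 - 1 / 2)) by (field; lra).
  apply (Cmod_Cseries_le _ (fun k => B * (2 * Cmod z / r) * (1 / 2) ^ k) _ _) with (2 := HS);
    [|apply (is_series_scal_l (K := R_AbsRing) (V := R_NormedModule) _ _ _ Hg)].
  intro k. change (scal (pow_n (K := C_AbsRing) z (S k)) (a (S k))) with (pow_n (K := C_AbsRing) z (S k) * a (S k))%C.
  rewrite Cmod_mult, Cmod_pow_n.
  assert (Hq : 0 <= 2 * Cmod z / r <= 1 / 2).
  { split; [apply Rmult_le_pos; [lra|left; now apply Rinv_0_lt_compat]|]. apply Rle_div_l; lra. }
  replace (Cmod z ^ S k * Cmod (a (S k))) with
    (Cmod (a (S k)) * (r / 2) ^ S k * (2 * Cmod z / r) ^ S k).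
  - assert (HX : 0 <= Cmod (a (S k)) * (r / 2) ^ S k <= B).
    { split; [|apply HB]. apply Rmult_le_pos; [apply Cmod_ge_0|apply pow_le; lra]. }
    assert (Hk : 0 <= (2 * Cmod z / r) ^ k <= (1 / 2) ^ k) by (split; [now apply pow_le|now apply pow_incr]).
    rewrite <- (tech_pow_Rmult (2 * Cmod z / r)), <- Rmult_assoc.
    revert HX Hk Hq. generalize (Cmod (a (S k)) * (r / 2) ^ S k) (2 * Cmod z / r).
    intros X kap HX Hk Hq. apply Rmult_le_compat; [nra|easy|nra|easy].
  - rewrite Rmult_assoc, <- Rpow_mult_distr. replace (r / 2 * (2 * Cmod z / r)) with (Cmod z) by (field; lra).
    ring.
Qed.

(** Zeros accumulating at 0 force the constant coefficient to vanish. Then [f z / z] has the same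
    zeros and the shifted coefficients; working on the punctured disc makes this division
    harmless. *)
Lemma Cpseries_isolated_zero (a : nat -> C) (f : C -> C) (r : R) : 0 < r ->
  (forall z, 0 < Cmod z < r -> Cpseries a z (f z)) ->
  (forall eps, 0 < eps -> exists z, 0 < Cmod z < eps /\ f z = RtoC 0) ->
  forall n, a n = RtoC 0.
Proof.
  intros Hr Hf Hz n. revert a f Hf Hz.
  assert (H0 : forall a f, (forall z, 0 < Cmod z < r -> Cpseries a z (f z)) ->
    (forall eps, 0 < eps -> exists z, 0 < Cmod z < eps /\ f z = RtoC 0) -> a 0%nat = RtoC 0).
  { intros a f Hf Hz. apply Cmod_eq_0.
    destruct (Cpseries_near_0 a f r Hr Hf) as [B HB].
    pose proof (Cmod_ge_0 (a 0%nat)) as P0.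
    destruct (Req_dec (Cmod (a 0%nat)) 0) as [E|E]; [exact E|exfalso].
    assert (HB1 : 0 < Rabs B + 1) by (pose proof (Rabs_pos B); lra).
    destruct (Hz (Rmin (r / 4) (Cmod (a 0%nat) / (Rabs B + 1)))) as [z [Hz1 Hz2]].
    { apply Rmin_pos; [lra|]. apply Rdiv_lt_0_compat; lra. }
    pose proof (Rmin_l (r / 4) (Cmod (a 0%nat) / (Rabs B + 1))) as m1.
    pose proof (Rmin_r (r / 4) (Cmod (a 0%nat) / (Rabs B + 1))) as m2.
    specialize (HB z ltac:(lra)). rewrite Hz2 in HB.
    replace (RtoC 0 - a 0%nat)%C with (- a 0%nat)%C in HB by ring.
    rewrite Cmod_opp in HB.
    assert (Cmod z * (Rabs B + 1) < Cmod (a 0%nat)).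
    { apply Rlt_le_trans with (Cmod (a 0%nat) / (Rabs B + 1) * (Rabs B + 1)); [|right; field; lra].
      apply Rmult_lt_compat_r; lra. }
    pose proof (Rle_abs B). nra. }
  induction n as [|n IH]; intros a f Hf Hz; [now apply (H0 a f)|].
  apply (IH (PS_decr_1 a) (fun z => (/ z * f z)%C)).
  - intros z Hz'. assert (Hz0 : z <> RtoC 0) by (apply Cmod_gt_0; lra).
    assert (E := is_pseries_decr_1 (K := C_AbsRing) (V := C_NormedModule) a z (/ z)%C (f z)
      (Cinv_l z Hz0) (Hf z Hz')).
    rewrite (H0 a f Hf Hz) in E.
    refine (eq_ind _ (fun l : C => Cpseries (PS_decr_1 a) z l) E _ _).
    change (/ z * (f z + - RtoC 0) = / z * f z)%C. ring.
  - intros eps Heps. destruct (Hz eps Heps) as [z [Hz1 Hz2]]. exists z. split; [exact Hz1|].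
    rewrite Hz2. ring.
Qed.

Lemma ex_series_pow_fact (x : R) : ex_series (fun n => / INR (fact n) * x ^ n).
Proof. exists (exp x). apply is_pseries_R, is_exp_Reals. Qed.

(** Along the ray from 0 to [z] the real and imaginary parts of the exponential series satisfy the
    differential equation of [complex_exp_ode], with exponent [t z]; the claim is its solution at
    [t = 1]. *)
Lemma is_pseries_Cexp (z : C) : Cpseries (fun n => RtoC (/ INR (fact n))) z (Cexp z).
Proof.
  set (u := fun n => / INR (fact n) * Re (pow_n (K := C_AbsRing) z n)).
  set (v := fun n => / INR (fact n) * Im (pow_n (K := C_AbsRing) z n)).
  assert (Hfact : forall n, 0 < / INR (fact n)) by (intro; apply Rinv_0_lt_compat, INR_fact_lt_0).
  assert (Hu : forall q, 0 <= q < 2 -> ex_series (fun n => u n * q ^ n)).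
  { intros q Hq. apply (ex_series_le (V := R_CompleteNormedModule)) with (2 := ex_series_pow_fact (Cmod z * q)).
    intro n. unfold norm; simpl; unfold abs; simpl. unfold u.
    assert (0 <= q ^ n) by (apply pow_le; lra).
    rewrite !Rabs_mult, (Rabs_pos_eq (q ^ n)), (Rabs_pos_eq (/ _)) by (easy || (left; apply Hfact)).
    rewrite Rpow_mult_distr, <- Rmult_assoc. apply Rmult_le_compat_r; [easy|].
    apply Rmult_le_compat_l; [left; apply Hfact|]. rewrite <- Cmod_pow_n. apply re_le_Cmod. }
  assert (Hv : forall q, 0 <= q < 2 -> ex_series (fun n => v n * q ^ n)).
  { intros q Hq. apply (ex_series_le (V := R_CompleteNormedModule)) with (2 := ex_series_pow_fact (Cmod z * q)).
    intro n. unfold norm; simpl; unfold abs; simpl. unfold v.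
    assert (0 <= q ^ n) by (apply pow_le; lra).
    rewrite !Rabs_mult, (Rabs_pos_eq (q ^ n)), (Rabs_pos_eq (/ _)) by (easy || (left; apply Hfact)).
    rewrite Rpow_mult_distr, <- Rmult_assoc. apply Rmult_le_compat_r; [easy|].
    apply Rmult_le_compat_l; [left; apply Hfact|]. rewrite <- Cmod_pow_n. apply im_le_Cmod. }
  assert (Hd : forall n, PS_derive u n = PS_minus (PS_scal (Re z) u) (PS_scal (Im z) v) n /\
                         PS_derive v n = PS_plus (PS_scal (Im z) u) (PS_scal (Re z) v) n).
  { intro n. unfold PS_derive, PS_minus, PS_plus, PS_opp, PS_scal, plus, opp, scal; simpl.
    unfold mult; simpl. change (match n with 0%nat => 1 | S _ => INR n + 1 end) with (INR (S n)).
    unfold u, v.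
    assert (E : INR (S n) * / INR (fact (S n)) = / INR (fact n)).
    { rewrite fact_simpl, mult_INR. field. split; [apply INR_fact_neq_0|apply not_0_INR; lia]. }
    change (pow_n (K := C_AbsRing) z (S n)) with (z * pow_n (K := C_AbsRing) z n)%C.
    rewrite <- !(Rmult_assoc (INR (S n))), E, re_mult, im_mult. split; eq_in_R; ring. }
  assert (Hrad_u : forall t, 0 <= t <= 1 -> Rbar_lt (Rabs t) (CV_radius u))
    by (intros t Ht; apply (radius_gt_r u 2 t Hu); rewrite Rabs_pos_eq; lra).
  assert (Hrad_v : forall t, 0 <= t <= 1 -> Rbar_lt (Rabs t) (CV_radius v))
    by (intros t Ht; apply (radius_gt_r v 2 t Hv); rewrite Rabs_pos_eq; lra).
  assert (Hode : PSeries u 1 = exp (Re z * 1) * cos (Im z * 1) /\ PSeries v 1 = exp (Re z * 1) * sin (Im z * 1)).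
  { apply (complex_exp_ode (fun t => Re z * t) (fun t => Im z * t) (PSeries u) (PSeries v)
      (fun _ => Re z) (fun _ => Im z)); try lra.
    - intros t _. auto_derive; [easy|ring].
    - intros t _. auto_derive; [easy|ring].
    - intros t Ht. rewrite <- !PSeries_scal, <- PSeries_minus.
      + refine (eq_ind _ (is_derive (PSeries u) t) (is_derive_PSeries _ t (Hrad_u t Ht)) _ _).
        apply PSeries_ext. intro n. apply Hd.
      + apply (ex_pseries_scal (K := R_AbsRing) (V := R_NormedModule)); [apply Rmult_comm|].
        apply CV_radius_inside; auto.
      + apply (ex_pseries_scal (K := R_AbsRing) (V := R_NormedModule)); [apply Rmult_comm|].
        apply CV_radius_inside; auto.
    - intros t Ht. rewrite <- !PSeries_scal, <- PSeries_plus.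
      + refine (eq_ind _ (is_derive (PSeries v) t) (is_derive_PSeries _ t (Hrad_v t Ht)) _ _).
        apply PSeries_ext. intro n. apply Hd.
      + apply (ex_pseries_scal (K := R_AbsRing) (V := R_NormedModule)); [apply Rmult_comm|].
        apply CV_radius_inside; auto.
      + apply (ex_pseries_scal (K := R_AbsRing) (V := R_NormedModule)); [apply Rmult_comm|].
        apply CV_radius_inside; auto.
    - rewrite PSeries_0. unfold u. simpl. field.
    - rewrite PSeries_0. unfold v. simpl. field. }
  rewrite !Rmult_1_r in Hode. destruct Hode as [E1 E2].
  assert (Hsu : is_series u (PSeries u 1)).
  { assert (H := PSeries_correct u 1 (CV_radius_inside _ _ (Hrad_u 1 ltac:(lra)))).
    apply is_pseries_R in H. apply is_series_ext with (2 := H). intro n. rewrite pow1. apply Rmult_1_r. }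
  assert (Hsv : is_series v (PSeries v 1)).
  { assert (H := PSeries_correct v 1 (CV_radius_inside _ _ (Hrad_v 1 ltac:(lra)))).
    apply is_pseries_R in H. apply is_series_ext with (2 := H). intro n. rewrite pow1. apply Rmult_1_r. }
  apply Cseries_Re_Im. unfold Cexp. cbn [Re Im fst snd]. rewrite <- E1, <- E2. split.
  - apply is_series_ext with (2 := Hsu). intro n.
    change (u n = Re (pow_n (K := C_AbsRing) z n * RtoC (/ INR (fact n)))%C).
    rewrite re_scal_r. unfold u. ring.
  - apply is_series_ext with (2 := Hsv). intro n.
    change (v n = Im (pow_n (K := C_AbsRing) z n * RtoC (/ INR (fact n)))%C).
    unfold v. generalize (pow_n (K := C_AbsRing) z n). intros [p q]. simpl. ring.
Qed.

(** * Analytic continuation of zeta to Re s > -3/2 *)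

(* [npow u a] is [u ^ (- a)] for [0 < u]. *)
Definition npow (u : R) (a : C) : C := Cexp (- a * RtoC (ln u))%C.

Lemma Cmod_Cexp (z : C) : Cmod (Cexp z) = exp (Re z).
Proof.
  replace (Cexp z) with (RtoC (exp (Re z)) * cis (Im z))%C.
  - rewrite Cmod_mult, Cmod_cis, Cmod_R, Rabs_pos_eq; [ring|left; apply exp_pos].
  - unfold Cexp, cis, RtoC, Cmult; simpl. f_equal; ring.
Qed.

Lemma Cexp_plus (z w : C) : Cexp (z + w)%C = (Cexp z * Cexp w)%C.
Proof.
  unfold Cexp, Cmult; simpl. unfold Re, Im; simpl.
  rewrite exp_plus, cos_plus, sin_plus. f_equal; ring.
Qed.

Lemma Cmod_npow (u : R) (a : C) : Cmod (npow u a) = exp (- Re a * ln u).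
Proof. unfold npow. rewrite Cmod_Cexp. f_equal. destruct a as [x y]. simpl. ring. Qed.

Lemma npow_succ (u : R) (a : C) : 0 < u -> npow u (a + RtoC 1)%C = (npow u a * RtoC (/ u))%C.
Proof.
  intro Hu. unfold npow.
  replace (- (a + RtoC 1) * RtoC (ln u))%C with (- a * RtoC (ln u) + RtoC (- ln u))%C
    by (rewrite RtoC_opp; ring).
  rewrite Cexp_plus. f_equal. unfold Cexp, RtoC; simpl.
  rewrite cos_0, sin_0, exp_Ropp, exp_ln by easy. f_equal; ring.
Qed.

Lemma npow_polar (u x y : R) :
  npow u (x, y) = (exp (- (x * ln u)) * cos (y * ln u), - (exp (- (x * ln u)) * sin (y * ln u))).
Proof.
  unfold npow, Cexp. cbn [Re Im fst snd Cmult Copp RtoC].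
  replace (- x * ln u - - y * 0) with (- (x * ln u)) by ring.
  replace (- x * 0 + - y * ln u) with (- (y * ln u)) by ring.
  rewrite cos_neg, sin_neg. f_equal. ring.
Qed.

Lemma is_derive_Re_npow (K a : C) (u : R) : 0 < u ->
  is_derive (fun u => Re (K * npow u a)%C) u (Re (- K * a * npow u (a + RtoC 1))%C).
Proof.
  intro Hu. rewrite npow_succ by easy. destruct K as [k1 k2], a as [x y].
  refine (is_derive_ext (fun v : R => exp (- (x * ln v)) * (k1 * cos (y * ln v) + k2 * sin (y * ln v))) _ u _ _ _).
  - intro v. rewrite npow_polar. simpl. eq_in_R. ring.
  - rewrite npow_polar. simpl. auto_derive; [easy|]. field. lra.
Qed.

Lemma is_derive_Im_npow (K a : C) (u : R) : 0 < u ->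
  is_derive (fun u => Im (K * npow u a)%C) u (Im (- K * a * npow u (a + RtoC 1))%C).
Proof.
  intro Hu. rewrite npow_succ by easy. destruct K as [k1 k2], a as [x y].
  refine (is_derive_ext (fun v : R => exp (- (x * ln v)) * (k2 * cos (y * ln v) - k1 * sin (y * ln v))) _ u _ _ _).
  - intro v. rewrite npow_polar. simpl. eq_in_R. ring.
  - rewrite npow_polar. simpl. auto_derive; [easy|]. field. lra.
Qed.

(** Summing [(s - 1) u^(-s)] instead of [u^(-s)] gives the antiderivative [- u^(1 - s)], free of
    denominators, so that what is continued is [(s - 1) zeta s], regular at 1. *)
Definition zeta_prim (s : C) (u : R) : C := (- RtoC 1 * npow u (s - RtoC 1))%C.
Definition zeta_prim1 (s : C) (u : R) : C := ((s - RtoC 1) * npow u s)%C.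
Definition zeta_prim2 (s : C) (u : R) : C := (- (s - RtoC 1) * s * npow u (s + RtoC 1))%C.
Definition zeta_prim3 (s : C) (u : R) : C :=
  ((s - RtoC 1) * s * (s + RtoC 1) * npow u (s + RtoC 1 + RtoC 1))%C.
Definition zeta_prim4 (s : C) (u : R) : C :=
  (- ((s - RtoC 1) * s * (s + RtoC 1)) * (s + RtoC 1 + RtoC 1) *
   npow u (s + RtoC 1 + RtoC 1 + RtoC 1))%C.

Definition zeta_em (s : C) (m : R) : C :=
  (em_error (fun u => Re (zeta_prim s u)) (fun u => Re (zeta_prim1 s u))
     (fun u => Re (zeta_prim2 s u)) m,
   em_error (fun u => Im (zeta_prim s u)) (fun u => Im (zeta_prim1 s u))
     (fun u => Im (zeta_prim2 s u)) m).

Lemma zeta_prim_derive_eqs (s : C) (u : R) :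
  (- - RtoC 1 * (s - RtoC 1) * npow u (s - RtoC 1 + RtoC 1))%C = zeta_prim1 s u /\
  (- (s - RtoC 1) * s * npow u (s + RtoC 1))%C = zeta_prim2 s u /\
  (- (- (s - RtoC 1) * s) * (s + RtoC 1) * npow u (s + RtoC 1 + RtoC 1))%C = zeta_prim3 s u /\
  (- ((s - RtoC 1) * s * (s + RtoC 1)) * (s + RtoC 1 + RtoC 1) *
   npow u (s + RtoC 1 + RtoC 1 + RtoC 1))%C = zeta_prim4 s u.
Proof.
  unfold zeta_prim1, zeta_prim2, zeta_prim3, zeta_prim4.
  replace (s - RtoC 1 + RtoC 1)%C with s by ring.
  repeat split; ring.
Qed.

Lemma zeta_prim4_bound (s : C) (u m : R) : 1 <= m <= u -> 0 <= Re s + 3 ->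
  Cmod (zeta_prim4 s u) <=
  Cmod (s - RtoC 1)%C * Cmod s * Cmod (s + RtoC 1)%C * Cmod (s + RtoC 2)%C * exp (- (Re s + 3) * ln m).
Proof.
  intros Hu Hs. unfold zeta_prim4. rewrite !Cmod_mult, Cmod_opp, !Cmod_mult, Cmod_npow.
  replace (s + RtoC 1 + RtoC 1)%C with (s + RtoC 2)%C by (rewrite (RtoC_plus 1 1 : RtoC 2 = _); ring).
  apply Rmult_le_compat_l.
  - repeat apply Rmult_le_pos; apply Cmod_ge_0.
  - apply exp_le_compat. rewrite !re_plus, !re_RtoC.
    assert (ln m <= ln u) by (apply ln_le; lra).
    assert (0 <= ln m) by (rewrite <- ln_1; apply ln_le; lra). nra.
Qed.

Lemma zeta_em_bound_components (s : C) (m : R) : 1 <= m -> 0 <= Re s + 3 ->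
  let B := Cmod (s - RtoC 1)%C * Cmod s * Cmod (s + RtoC 1)%C * Cmod (s + RtoC 2)%C * exp (- (Re s + 3) * ln m) in
  Rabs (Re (zeta_em s m)) <= B /\ Rabs (Im (zeta_em s m)) <= B.
Proof.
  intros Hm Hs B. split.
  - apply (em_error_bound _ _ _ (fun u => Re (zeta_prim3 s u)) (fun u => Re (zeta_prim4 s u))); intros t Ht;
      destruct (zeta_prim_derive_eqs s t) as [E1 [E2 [E3 E4]]].
    + rewrite <- E1. apply is_derive_Re_npow. lra.
    + rewrite <- E2. apply is_derive_Re_npow. lra.
    + rewrite <- E3. apply is_derive_Re_npow. lra.
    + rewrite <- E4. apply is_derive_Re_npow. lra.
    + apply Rle_trans with (1 := re_le_Cmod _). apply zeta_prim4_bound; lra.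
  - apply (em_error_bound _ _ _ (fun u => Im (zeta_prim3 s u)) (fun u => Im (zeta_prim4 s u))); intros t Ht;
      destruct (zeta_prim_derive_eqs s t) as [E1 [E2 [E3 E4]]].
    + rewrite <- E1. apply is_derive_Im_npow. lra.
    + rewrite <- E2. apply is_derive_Im_npow. lra.
    + rewrite <- E3. apply is_derive_Im_npow. lra.
    + rewrite <- E4. apply is_derive_Im_npow. lra.
    + apply Rle_trans with (1 := im_le_Cmod _). apply zeta_prim4_bound; lra.
Qed.

(** The fourth derivative decays like [u^(- Re s - 3)], and [Re s >= - 3/2] makes the exponent at
    most [- 3/2], which is summable. The four polynomial factors are each at most [R0 + 2]. *)
Lemma zeta_em_bound (s : C) (m R0 : R) : 1 <= m -> - 3 / 2 <= Re s -> Cmod s <= R0 ->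
  Cmod (zeta_em s m) <= 2 * (R0 + 2) ^ 4 * exp (- (3 / 2) * ln m).
Proof.
  intros Hm Hs HR. destruct (zeta_em_bound_components s m Hm ltac:(lra)) as [B1 B2].
  apply Rle_trans with (1 := Cmod_le_Re_Im _).
  set (B := Cmod (s - RtoC 1)%C * Cmod s * Cmod (s + RtoC 1)%C * Cmod (s + RtoC 2)%C * exp (- (Re s + 3) * ln m)) in *.
  assert (HB : B <= (R0 + 2) ^ 4 * exp (- (3 / 2) * ln m)); [|lra].
  unfold B.
  assert (G : forall c : R, 0 <= c <= 2 -> Cmod (s + RtoC c)%C <= R0 + 2).
  { intros c Hc. apply Rle_trans with (1 := Cmod_triangle _ _). rewrite Cmod_R, Rabs_pos_eq by lra. lra. }
  assert (C1 : Cmod (s - RtoC 1)%C <= R0 + 2).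
  { unfold Cminus. apply Rle_trans with (1 := Cmod_triangle _ _). rewrite Cmod_opp, Cmod_1. lra. }
  pose proof (G 1 ltac:(lra)) as C2. pose proof (G 2 ltac:(lra)) as C3.
  pose proof (Cmod_ge_0 s). pose proof (Cmod_ge_0 (s - RtoC 1)%C).
  pose proof (Cmod_ge_0 (s + RtoC 1)%C). pose proof (Cmod_ge_0 (s + RtoC 2)%C).
  apply Rmult_le_compat; [repeat apply Rmult_le_pos; easy|left; apply exp_pos| |].
  - replace ((R0 + 2) ^ 4) with ((R0 + 2) * (R0 + 2) * (R0 + 2) * (R0 + 2)) by ring.
    repeat (apply Rmult_le_compat; try (repeat apply Rmult_le_pos; lra); try lra).
  - apply exp_le_compat. assert (0 <= ln m) by (rewrite <- ln_1; apply ln_le; lra). nra.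
Qed.

(** Each term satisfies [m^(-3/2) <= 6 (1 / sqrt m - 1 / sqrt (m + 1))], which telescopes. *)
Lemma ex_series_three_halves : ex_series (fun n => exp (- (3 / 2) * ln (INR (S n)))).
Proof.
  set (g := fun n => / sqrt (INR (S n))).
  assert (Hs : forall n, 0 < sqrt (INR (S n))) by (intro; apply sqrt_lt_R0, lt_0_INR; lia).
  destruct (is_series_bounded (fun n => exp (- (3 / 2) * ln (INR (S n)))) 6) as [l [Hl _]]; [| |now exists l].
  - intro n. left. apply exp_pos.
  - intro N. assert (H : sum_f_R0 (fun n => exp (- (3 / 2) * ln (INR (S n)))) N <= 6 - 6 * g (S N)).
    2:{ assert (0 < g (S N)) by (apply Rinv_0_lt_compat, Hs). lra. }
    assert (Hterm : forall n, exp (- (3 / 2) * ln (INR (S n))) <= 6 * (g n - g (S n))).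
    { intro n. unfold g.
      pose proof (Hs n) as h1. pose proof (Hs (S n)) as h2.
      assert (q1 : sqrt (INR (S n)) * sqrt (INR (S n)) = INR (S n)) by (apply sqrt_sqrt, pos_INR).
      assert (q2 : sqrt (INR (S (S n))) * sqrt (INR (S (S n))) = INR (S n) + 1)
        by (rewrite <- (S_INR (S n)); apply sqrt_sqrt, pos_INR).
      assert (q3 : 1 <= INR (S n)) by (apply (le_INR 1); lia).
      assert (E : exp (- (3 / 2) * ln (INR (S n))) = / (sqrt (INR (S n)) ^ 3)).
      { rewrite <- (exp_ln (sqrt (INR (S n)) ^ 3)) by (apply pow_lt; easy).
        rewrite <- exp_Ropp. f_equal. rewrite ln_pow by easy. simpl INR at 2.
        rewrite <- q1 at 1. rewrite ln_mult by easy. simpl. field. }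
      rewrite E. set (a := sqrt (INR (S n))) in *. set (b := sqrt (INR (S (S n)))) in *.
      assert (ab : a <= b) by nra. assert (b2 : b * b <= 2 * (a * a)) by lra.
      assert (bb : b <= 3 / 2 * a) by nra.
      replace (6 * (/ a - / b)) with (6 * ((b * b - a * a) / (a * b * (a + b)))) by (field; lra).
      replace (b * b - a * a) with 1 by lra.
      replace (6 * (1 / (a * b * (a + b)))) with (/ (a * b * (a + b) / 6)) by (field; lra).
      assert (0 < a * b) by nra.
      apply Rinv_le_contravar.
      + apply Rdiv_lt_0_compat; [apply Rmult_lt_0_compat; lra|lra].
      + assert (a * b * (a + b) <= a * (3 / 2 * a) * (a + 3 / 2 * a)) 
          by (apply Rmult_le_compat; [lra|lra|apply Rmult_le_compat_l; lra|lra]).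
        replace (a * (3 / 2 * a) * (a + 3 / 2 * a)) with (15 / 4 * a ^ 3) in H0 by field.
        assert (0 < a ^ 3) by now apply pow_lt. lra. }
    assert (H0 : g 0%nat = 1) by (unfold g; simpl; rewrite sqrt_1; field).
    induction N as [|N IH].
    + specialize (Hterm 0%nat). rewrite H0 in Hterm.
      change (exp (- (3 / 2) * ln (INR 1)) <= 6 - 6 * g 1%nat). lra.
    + rewrite tech5. specialize (Hterm (S N)). lra.
Qed.

Lemma is_lim_seq_exp_ln (c : R) : 0 < c -> is_lim_seq (fun n => exp (- c * ln (INR n))) 0.
Proof.
  intro Hc.
  apply (is_lim_comp_seq exp (fun n => - c * ln (INR n)) m_infty 0); [exact is_lim_exp_m|exists 0%nat; intros; discriminate|].
  replace m_infty with (Rbar_mult (- c) p_infty).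
  - apply is_lim_seq_scal_l. apply (is_lim_comp_seq ln INR p_infty p_infty);
      [exact is_lim_ln_p|exists 0%nat; intros; discriminate|exact is_lim_seq_INR].
  - apply is_Rbar_mult_unique. apply is_Rbar_mult_sym. apply is_Rbar_mult_p_infty_neg. simpl. lra.
Qed.

(** For [Re s > 1] the boundary terms at infinity vanish; the polynomial subtracted from
    [(s - 1) zeta s] collects those at [u = 1]. *)
Lemma zeta_em_sum (zeta : C -> C) (s : C) : is_riemann_zeta zeta -> 1 < Re s ->
  Cseries (fun n => zeta_em s (INR (S n)))
    ((s - RtoC 1) * zeta s - (RtoC 1 + (s - RtoC 1) / RtoC 2 + s * (s - RtoC 1) / RtoC 12))%C.
Proof.
  intros [Hz _] Hs. specialize (Hz s Hs).
  assert (H1 := is_series_scal_l (K := C_AbsRing) (V := C_NormedModule) (s - RtoC 1)%C _ _ Hz).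
  apply Cseries_Re_Im in H1. destruct H1 as [HRe HIm].
  change (is_series (fun n => Re (zeta_prim1 s (INR (S n)))) (Re ((s - RtoC 1) * zeta s)%C)) in HRe.
  change (is_series (fun n => Im (zeta_prim1 s (INR (S n)))) (Im ((s - RtoC 1) * zeta s)%C)) in HIm.
  assert (L0 : is_lim_seq (fun n => Cmod (zeta_prim s (INR n))) 0).
  { apply is_lim_seq_ext with (2 := is_lim_seq_exp_ln (Re s - 1) ltac:(lra)). intro n.
    unfold zeta_prim. rewrite Cmod_mult, Cmod_opp, Cmod_1, Cmod_npow, Rmult_1_l. now do 3 f_equal. }
  assert (L2 : is_lim_seq (fun n => Cmod (zeta_prim2 s (INR n))) 0).
  { set (c := Cmod (- (s - RtoC 1) * s)%C).
    replace (Finite 0) with (Rbar_mult c 0) by (simpl; f_equal; ring).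
    apply is_lim_seq_ext with (fun n => c * exp (- (Re s + 1) * ln (INR n))).
    - intro n. unfold zeta_prim2. rewrite Cmod_mult, Cmod_npow, re_plus, re_RtoC. easy.
    - apply is_lim_seq_scal_l. apply is_lim_seq_exp_ln. lra. }
  assert (Lc : forall f : nat -> R, forall g : nat -> C, (forall n, Rabs (f n) <= Cmod (g n)) ->
    is_lim_seq (fun n => Cmod (g n)) 0 -> is_lim_seq f 0).
  { intros f g Hfg Hg. apply is_lim_seq_abs_0.
    apply (is_lim_seq_le_le (fun _ => 0) _ (fun n => Cmod (g n)) 0); [|apply is_lim_seq_const|exact Hg].
    intro n. split; [apply Rabs_pos|apply Hfg]. }
  assert (N1 : forall a, npow 1 a = RtoC 1).
  { intro a. unfold npow, Cexp. rewrite ln_1. replace (- a * RtoC 0)%C with (RtoC 0) by ring.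
    unfold RtoC. simpl. now rewrite exp_0, cos_0, sin_0, !Rmult_1_l. }
  assert (E0 : zeta_prim s 1 = (- RtoC 1)%C) by (unfold zeta_prim; rewrite N1; ring).
  assert (E1 : zeta_prim1 s 1 = (s - RtoC 1)%C) by (unfold zeta_prim1; rewrite N1; ring).
  assert (E2 : zeta_prim2 s 1 = (- (s - RtoC 1) * s)%C) by (unfold zeta_prim2; rewrite N1; ring).
  apply Cseries_Re_Im. split.
  - assert (K := is_series_em_error (fun u => Re (zeta_prim s u)) (fun u => Re (zeta_prim1 s u))
      (fun u => Re (zeta_prim2 s u)) 0 _
      (Lc _ _ (fun n => re_le_Cmod (zeta_prim s (INR n))) L0)
      (Lc _ _ (fun n => re_le_Cmod (zeta_prim2 s (INR n))) L2) HRe).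
    cbv beta in K. rewrite E0, E1, E2 in K.
    refine (eq_ind _ (fun l : R => is_series _ l) K _ _).
    destruct s as [x y]. destruct (zeta (x, y)) as [p q]. simpl. field.
  - assert (K := is_series_em_error (fun u => Im (zeta_prim s u)) (fun u => Im (zeta_prim1 s u))
      (fun u => Im (zeta_prim2 s u)) 0 _
      (Lc _ _ (fun n => im_le_Cmod (zeta_prim s (INR n))) L0)
      (Lc _ _ (fun n => im_le_Cmod (zeta_prim2 s (INR n))) L2) HIm).
    cbv beta in K. rewrite E0, E1, E2 in K.
    refine (eq_ind _ (fun l : R => is_series _ l) K _ _).
    destruct s as [x y]. destruct (zeta (x, y)) as [p q]. simpl. field.
Qed.

(** * Analyticity of the continued function *)

(** The expansion is asked to hold on the whole plane, the form in which [weierstrass_pseries] takes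
    its summands. *)
Definition entire_at (c : C) (f : C -> C) : Prop :=
  exists a : nat -> C, forall z, Cpseries a z (f (c + z)%C).

Lemma entire_ext (c : C) (f g : C -> C) :
  (forall s, f s = g s) -> entire_at c f -> entire_at c g.
Proof. intros E [a Ha]. exists a. intro z. rewrite <- E. apply Ha. Qed.

Lemma entire_plus (c : C) (f g : C -> C) :
  entire_at c f -> entire_at c g -> entire_at c (fun s => f s + g s)%C.
Proof.
  intros [a Ha] [b Hb]. exists (PS_plus (K := C_AbsRing) (V := C_NormedModule) a b). intro z.
  apply (is_pseries_plus (K := C_AbsRing) (V := C_NormedModule)); auto.
Qed.

Lemma entire_scal (c k : C) (f : C -> C) : entire_at c f -> entire_at c (fun s => k * f s)%C.
Proof.
  intros [a Ha]. exists (PS_scal (K := C_AbsRing) (V := C_NormedModule) k a). intro z.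
  apply (is_pseries_scal (K := C_AbsRing) (V := C_NormedModule)); [apply Cmult_comm|apply Ha].
Qed.

Lemma Cpseries_mul_id (c z l : C) (a : nat -> C) : Cpseries a z l ->
  Cpseries (PS_plus (K := C_AbsRing) (V := C_NormedModule) (PS_scal (K := C_AbsRing) (V := C_NormedModule) c a)
     (PS_incr_1 (K := C_AbsRing) (V := C_NormedModule) a)) z ((c + z) * l)%C.
Proof.
  intro Ha.
  refine (eq_ind _ (fun l => Cpseries _ z l) _ _ _).
  - apply (is_pseries_plus (K := C_AbsRing) (V := C_NormedModule)).
    + apply (is_pseries_scal (K := C_AbsRing) (V := C_NormedModule)); [apply Cmult_comm|apply Ha].
    + apply (is_pseries_incr_1 (K := C_AbsRing) (V := C_NormedModule)). apply Ha.
  - change (c * l + z * l = (c + z) * l)%C. ring.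
Qed.

Lemma entire_mul_id (c : C) (f : C -> C) : entire_at c f -> entire_at c (fun s => s * f s)%C.
Proof. intros [a Ha]. eexists. intro z. apply Cpseries_mul_id. apply Ha. Qed.

Lemma Cpseries_comp_scal (k z l : C) (a : nat -> C) : Cpseries a (k * z)%C l ->
  Cpseries (fun n => pow_n (K := C_AbsRing) k n * a n)%C z l.
Proof.
  intro H. refine (is_series_ext (K := C_AbsRing) (V := C_NormedModule) _ _ _ _ H). intro n.
  change (pow_n (K := C_AbsRing) (k * z)%C n * a n = pow_n (K := C_AbsRing) z n * (pow_n (K := C_AbsRing) k n * a n))%C.
  assert (E : pow_n (K := C_AbsRing) (k * z)%C n = (pow_n (K := C_AbsRing) k n * pow_n (K := C_AbsRing) z n)%C).
  { induction n as [|n IH].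
    - change (RtoC 1 = RtoC 1 * RtoC 1)%C. ring.
    - change (k * z * pow_n (K := C_AbsRing) (k * z)%C n = k * pow_n (K := C_AbsRing) k n * (z * pow_n (K := C_AbsRing) z n))%C.
      rewrite IH. ring. }
  rewrite E. ring.
Qed.

Lemma entire_npow (c : C) (u : R) : entire_at c (npow u).
Proof.
  assert (H : entire_at c (fun s => npow u c * Cexp ((- RtoC (ln u)) * (s - c)))%C).
  { apply entire_scal. eexists. intro z.
    replace ((- RtoC (ln u)) * (c + z - c))%C with ((- RtoC (ln u)) * z)%C by ring.
    apply Cpseries_comp_scal. apply is_pseries_Cexp. }
  refine (entire_ext _ _ _ _ H). intro s. unfold npow. rewrite <- Cexp_plus. f_equal. ring.
Qed.

Lemma entire_const (c k : C) : entire_at c (fun _ => k).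
Proof.
  apply (entire_ext c (fun s => k * npow 1 s)%C).
  - intro s. unfold npow. rewrite ln_1. replace (- s * RtoC 0)%C with (RtoC 0) by ring.
    replace (Cexp (RtoC 0)) with (RtoC 1); [ring|].
    unfold Cexp, RtoC. simpl. now rewrite exp_0, cos_0, sin_0, !Rmult_1_l.
  - apply entire_scal, entire_npow.
Qed.

Lemma npow_pred (u : R) (a : C) : 0 < u -> npow u (a - RtoC 1)%C = (npow u a * RtoC u)%C.
Proof.
  intro Hu. assert (H := npow_succ u (a - RtoC 1)%C Hu).
  replace (a - RtoC 1 + RtoC 1)%C with a in H by ring. rewrite H.
  rewrite <- Cmult_assoc, <- RtoC_mult, Rinv_l by lra. ring.
Qed.

Lemma zeta_em_eq (s : C) (m : R) : 0 < m ->
  zeta_em s m =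
  ((- zeta_prim s (m + 1) + zeta_prim s m) +
   (RtoC (1 / 2) * zeta_prim1 s m + RtoC (1 / 2) * zeta_prim1 s (m + 1)) +
   (RtoC (1 / 12) * zeta_prim2 s m + RtoC (- (1 / 12)) * zeta_prim2 s (m + 1)))%C.
Proof.
  intro Hm. unfold zeta_em, em_error.
  destruct (zeta_prim s (m + 1)) as [a1 a2]. destruct (zeta_prim s m) as [b1 b2].
  destruct (zeta_prim1 s (m + 1)) as [c1 c2]. destruct (zeta_prim1 s m) as [d1 d2].
  destruct (zeta_prim2 s (m + 1)) as [e1 e2]. destruct (zeta_prim2 s m) as [f1 f2].
  unfold Cplus, Cmult, Copp, RtoC. simpl. f_equal; field.
Qed.

Lemma entire_zeta_prims (c : C) (u : R) : 0 < u ->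
  entire_at c (fun s => zeta_prim s u) /\ entire_at c (fun s => zeta_prim1 s u) /\
  entire_at c (fun s => zeta_prim2 s u).
Proof.
  intro Hu. assert (H := entire_npow c u). repeat split.
  - apply (entire_ext c (fun s => - RtoC u * npow u s)%C); [|now apply entire_scal].
    intro s. unfold zeta_prim. rewrite npow_pred by easy. ring.
  - apply (entire_ext c (fun s => s * npow u s + (- RtoC 1) * npow u s)%C).
    + intro s. unfold zeta_prim1. ring.
    + apply entire_plus; [now apply entire_mul_id|now apply entire_scal].
  - apply (entire_ext c (fun s => (- RtoC (/ u)) * (s * (s * npow u s)) + RtoC (/ u) * (s * npow u s))%C).
    + intro s. unfold zeta_prim2. rewrite npow_succ by easy. ring.
    + apply entire_plus; apply entire_scal; [now apply entire_mul_id, entire_mul_id|now apply entire_mul_id].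
Qed.

Lemma entire_zeta_em (c : C) (m : R) : 0 < m -> entire_at c (fun s => zeta_em s m).
Proof.
  intro Hm. destruct (entire_zeta_prims c m Hm) as [A0 [A1 A2]].
  destruct (entire_zeta_prims c (m + 1) ltac:(lra)) as [B0 [B1 B2]].
  apply (entire_ext c (fun s =>
    ((((- RtoC 1) * zeta_prim s (m + 1) + zeta_prim s m) +
   (RtoC (1 / 2) * zeta_prim1 s m + RtoC (1 / 2) * zeta_prim1 s (m + 1))) +
   (RtoC (1 / 12) * zeta_prim2 s m + RtoC (- (1 / 12)) * zeta_prim2 s (m + 1)))%C)).
  - intro s. rewrite zeta_em_eq by easy. ring.
  - exact (entire_plus c _ _ (entire_plus c _ _
      (entire_plus c _ _ (entire_scal c _ _ B0) A0)
      (entire_plus c _ _ (entire_scal c _ _ A1) (entire_scal c _ _ B1)))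
      (entire_plus c _ _ (entire_scal c _ _ A2) (entire_scal c _ _ B2))).
Qed.

Definition zeta_em_sum_fun (s : C) : C :=
  (Series (fun n => Re (zeta_em s (INR (S n)))), Series (fun n => Im (zeta_em s (INR (S n))))).

Definition zeta_poly (s : C) : C :=
  (RtoC 1 + (s - RtoC 1) / RtoC 2 + s * (s - RtoC 1) / RtoC 12)%C.

(* [(s - 1) * zeta s], continued to [- 3 / 2 < Re s]. *)
Definition zeta_cont (s : C) : C := (zeta_poly s + zeta_em_sum_fun s)%C.

Lemma Cseries_zeta_em (s l : C) :
  Cseries (fun n => zeta_em s (INR (S n))) l -> zeta_em_sum_fun s = l.
Proof.
  intro H. apply Cseries_Re_Im in H. destruct H as [H1 H2].
  unfold zeta_em_sum_fun. rewrite (is_series_unique _ _ H1), (is_series_unique _ _ H2).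
  now destruct l.
Qed.

Lemma zeta_cont_eq (zeta : C -> C) (s : C) : is_riemann_zeta zeta -> 1 < Re s ->
  ((s - RtoC 1) * zeta s)%C = zeta_cont s.
Proof.
  intros Hz Hs. unfold zeta_cont, zeta_poly. rewrite (Cseries_zeta_em _ _ (zeta_em_sum zeta s Hz Hs)). ring.
Qed.

Lemma entire_zeta_poly (c : C) : entire_at c zeta_poly.
Proof.
  assert (H1 := entire_const c (RtoC 1)).
  assert (Hs : entire_at c (fun s => s * RtoC 1)%C) by now apply entire_mul_id.
  assert (Hss : entire_at c (fun s => s * (s * RtoC 1))%C) by now apply entire_mul_id.
  apply (entire_ext c (fun s => (RtoC (1 / 2) * RtoC 1 + RtoC (5 / 12) * (s * RtoC 1)) +
    RtoC (1 / 12) * (s * (s * RtoC 1)))%C).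
  - intros [x y]. unfold zeta_poly, Cdiv, Cinv, Cminus, Cplus, Copp, Cmult, RtoC. simpl. f_equal; field.
  - exact (entire_plus c _ _ (entire_plus c _ _ (entire_scal c _ _ H1) (entire_scal c _ _ Hs))
      (entire_scal c _ _ Hss)).
Qed.

(** The disc of radius 1/2 around [c] stays in [Re s >= - 3/2], where the Euler-Maclaurin errors are
    summable uniformly. *)
Lemma zeta_cont_analytic (c : C) : - 1 <= Re c ->
  exists b, forall z, Cmod z < 1 / 2 -> Cpseries b z (zeta_cont (c + z)%C).
Proof.
  intro Hc.
  assert (Ha : exists a : nat -> nat -> C, forall m z, Cpseries (a m) z (zeta_em (c + z)%C (INR (S m)))).
  { assert (Hm : forall m, exists a : nat -> C, forall z, Cpseries a z (zeta_em (c + z)%C (INR (S m)))).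
    { intro m. apply (entire_zeta_em c (INR (S m))). apply lt_0_INR. lia. }
    destruct (boolp.choice Hm) as [a Ha]. now exists a. }
  destruct Ha as [a Ha].
  destruct (weierstrass_pseries (fun m z => zeta_em (c + z)%C (INR (S m))) a
    (fun m => 2 * (Cmod c + 1 / 2 + 2) ^ 4 * exp (- (3 / 2) * ln (INR (S m)))) (1 / 2) ltac:(lra) Ha) as [b Hb].
  - intros m z Hz. apply zeta_em_bound.
    + apply (le_INR 1). lia.
    + rewrite re_plus. pose proof (re_le_Cmod z) as H. apply Rabs_le_between in H. lra.
    + apply Rle_trans with (1 := Cmod_triangle _ _). lra.
  - apply (ex_series_scal_l (K := R_AbsRing) (V := R_NormedModule) _ _ ex_series_three_halves).
  - destruct (entire_zeta_poly c) as [p Hp].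
    exists (PS_plus (K := C_AbsRing) (V := C_NormedModule) p b). intros z Hz.
    destruct (Hb z Hz) as [l [Hl1 Hl2]]. unfold zeta_cont. rewrite (Cseries_zeta_em _ _ Hl1).
    apply (is_pseries_plus (K := C_AbsRing) (V := C_NormedModule)); [apply Hp|exact Hl2].
Qed.

(** * The identity theorem along a segment *)

Definition analytic_near (f : C -> C) (c : C) : Prop :=
  exists r a, 0 < r /\ forall z, Cmod z < r -> Cpseries a z (f (c + z)%C).

Definition zero_near (f : C -> C) (c : C) : Prop :=
  exists r, 0 < r /\ forall z, Cmod z < r -> f (c + z)%C = RtoC 0.

Lemma analytic_zero_limit_point (f : C -> C) (c : C) : analytic_near f c ->
  (forall eps, 0 < eps -> exists z, 0 < Cmod z < eps /\ f (c + z)%C = RtoC 0) -> zero_near f c.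
Proof.
  intros [r [a [Hr Ha]]] Hz. exists r. split; [easy|]. intros z Hzr.
  assert (E := Cpseries_isolated_zero a (fun z => f (c + z)%C) r Hr (fun z Hz => Ha z (proj2 Hz)) Hz).
  apply (Cseries_unique _ _ _ (Ha z Hzr)).
  apply (is_series_ext (K := C_AbsRing) (V := C_NormedModule) (fun _ => RtoC 0)).
  - intro n. rewrite E. change (RtoC 0 = pow_n (K := C_AbsRing) z n * RtoC 0)%C. ring.
  - apply Cseries_Re_Im. split; apply (is_series_finite (fun _ => 0) 0); easy.
Qed.

Lemma zero_near_open (f : C -> C) (c : C) : zero_near f c ->
  exists r, 0 < r /\ forall z, Cmod z < r -> zero_near f (c + z)%C.
Proof.
  intros [r [Hr H]]. exists (r / 2). split; [lra|]. intros z Hz.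
  exists (r / 2). split; [lra|]. intros w Hw.
  replace (c + z + w)%C with (c + (z + w))%C by ring. apply H.
  apply Rle_lt_trans with (1 := Cmod_triangle _ _). lra.
Qed.

(** Let [s] be the supremum of the parameters up to which [f] vanishes locally. Zeros accumulate at
    [s] from the left, so [f] vanishes near [s] too, and openness excludes [s < 1]. *)
Lemma identity_segment (f : C -> C) (p d : C) : d <> RtoC 0 ->
  (forall t, 0 <= t <= 1 -> analytic_near f (p + RtoC t * d)%C) ->
  zero_near f p -> zero_near f (p + d)%C.
Proof.
  intros Hd Han H0.
  assert (Hd0 : 0 < Cmod d) by now apply Cmod_gt_0.
  set (P := fun t => zero_near f (p + RtoC t * d)%C).
  set (E := fun t => 0 <= t <= 1 /\ forall t', 0 <= t' <= t -> P t').
  assert (P0 : P 0) by (unfold P; now replace (p + RtoC 0 * d)%C with p by ring).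
  assert (Hopen : forall t, P t -> exists e, 0 < e /\ forall t', Rabs (t' - t) < e -> P t').
  { intros t Ht. destruct (zero_near_open _ _ Ht) as [r [Hr H]]. exists (r / Cmod d).
    split; [now apply Rdiv_lt_0_compat|]. intros t' Ht'. unfold P.
    replace (p + RtoC t' * d)%C with (p + RtoC t * d + RtoC (t' - t) * d)%C by (rewrite RtoC_minus; ring).
    apply H. rewrite Cmod_mult, Cmod_R. now apply Rlt_div_r. }
  destruct (completeness E) as [s [Hs1 Hs2]].
  - exists 1. intros t [Ht _]. lra.
  - exists 0. split; [lra|]. intros t' Ht'. now replace t' with 0 by lra.
  - assert (E0 : E 0) by (split; [lra|]; intros t' Ht'; now replace t' with 0 by lra).
    assert (Hs : 0 <= s <= 1).
    { split; [now apply Hs1|]. apply Hs2. intros t [Ht _]. lra. }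
    assert (Hbelow : forall t, 0 <= t < s -> P t).
    { intros t Ht. apply boolp.contrapT. intro Hn. assert (s <= t); [|lra]. apply Hs2. intros t' [Ht' HP].
      destruct (Rle_lt_dec t' t) as [h|h]; [easy|]. exfalso. apply Hn. apply HP. lra. }
    assert (HPs : P s).
    { destruct (Rle_lt_or_eq_dec 0 s (proj1 Hs)) as [Hpos|<-]; [|exact P0].
      apply analytic_zero_limit_point; [now apply Han|]. intros eps Heps.
      set (h := Rmin s (eps / (2 * Cmod d))).
      assert (Hh : 0 < h) by (apply Rmin_pos; [easy|apply Rdiv_lt_0_compat; lra]).
      assert (Hh1 : h <= s) by apply Rmin_l.
      assert (Hh2 : h * Cmod d < eps).
      { apply Rle_lt_trans with (eps / (2 * Cmod d) * Cmod d); [apply Rmult_le_compat_r; [lra|apply Rmin_r]|].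
        replace (eps / (2 * Cmod d) * Cmod d) with (eps / 2) by (field; lra). lra. }
      exists (RtoC (- h) * d)%C. split.
      - rewrite Cmod_mult, Cmod_R, Rabs_Ropp, Rabs_pos_eq by lra. split; [now apply Rmult_lt_0_compat|easy].
      - destruct (Hbelow (s - h) ltac:(lra)) as [r [Hr H]].
        specialize (H (RtoC 0) ltac:(rewrite Cmod_0; lra)).
        rewrite <- H. f_equal. rewrite RtoC_minus, RtoC_opp. ring. }
    destruct (Rle_lt_or_eq_dec s 1 (proj2 Hs)) as [Hlt|Heq].
    + exfalso. destruct (Hopen s HPs) as [e [He Hne]].
      set (t := Rmin 1 (s + e / 2)).
      assert (Ht : s < t <= 1) by (split; [apply Rmin_glb_lt; lra|apply Rmin_l]).
      assert (Ht2 : t <= s + e / 2) by apply Rmin_r.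
      assert (t <= s); [|lra]. apply Hs1. split; [lra|]. intros t' Ht'.
      destruct (Rlt_le_dec t' s) as [h|h]; [apply Hbelow; lra|].
      apply Hne. rewrite Rabs_pos_eq; lra.
    + unfold P in HPs. rewrite Heq in HPs. now replace (p + d)%C with (p + RtoC 1 * d)%C by ring.
Qed.

(** * The constants zeta(3) and zeta'(-1) *)

Lemma zeta3_eq (zeta : C -> C) : is_riemann_zeta zeta -> zeta3 zeta = inv_cube_sum.
Proof.
  intros [Hz _]. specialize (Hz (RtoC 3) ltac:(rewrite re_RtoC; lra)).
  apply Cseries_Re_Im in Hz. destruct Hz as [Hz _].
  unfold zeta3, inv_cube_sum. rewrite <- (is_series_unique _ _ Hz).
  rewrite (Series_incr_1 (fun n => harmonic_coef n ^ 3)) by exact ex_series_inv_cube.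
  simpl (harmonic_coef 0 ^ 3). rewrite Rmult_0_l, Rplus_0_l. apply Series_ext. intro n.
  assert (Hn : 0 < INR (S n)) by (apply lt_0_INR; lia).
  assert (E : Cexp (- RtoC 3 * RtoC (ln (INR (S n))))%C = npow (INR (S n)) (3, 0)) by easy.
  rewrite E, npow_polar, Rmult_0_l, cos_0. cbn [Re fst]. rewrite Rmult_1_r.
  unfold harmonic_coef. rewrite pow_inv, exp_Ropp. f_equal.
  rewrite <- (exp_ln (INR (S n) ^ 3)) by now apply pow_lt.
  f_equal. rewrite ln_pow by easy. simpl. ring.
Qed.

Definition zeta_defect (zeta : C -> C) (s : C) : C := ((s - RtoC 1) * zeta s - zeta_cont s)%C.

Lemma zeta_defect_analytic (zeta : C -> C) (c : C) : is_riemann_zeta zeta ->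
  c <> RtoC 1 -> - 1 <= Re c -> analytic_near (zeta_defect zeta) c.
Proof.
  intros [_ Hz] Hc Hre. destruct (Hz c Hc) as [a [eps Ha]].
  destruct (zeta_cont_analytic c Hre) as [b Hb].
  exists (Rmin eps (1 / 2)). eexists. split; [apply Rmin_pos; [apply cond_pos|lra]|].
  intros z Hzr. pose proof (Rmin_l eps (1 / 2)). pose proof (Rmin_r eps (1 / 2)).
  assert (Hball : ball (M := C_UniformSpace) c eps (c + z)%C).
  { apply C_NormedModule_mixin_compat1. change (Cmod (c + z - c)%C < eps).
    replace (c + z - c)%C with z by ring. lra. }
  specialize (Ha _ Hball). simpl in Ha.
  replace (c + z - c)%C with z in Ha by ring.
  unfold zeta_defect. replace (c + z - RtoC 1)%C with (c - RtoC 1 + z)%C by ring.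
  refine (is_pseries_minus (K := C_AbsRing) (V := C_NormedModule) _ _ z _ _ _ (Hb z ltac:(lra))).
  apply Cpseries_mul_id. exact Ha.
Qed.

(** The path runs from [2 + i] horizontally to [- 1 + i] and then vertically down to [- 1], within
    [Re s >= - 1] and away from 1. *)
Lemma zeta_defect_zero (zeta : C -> C) : is_riemann_zeta zeta ->
  zero_near (zeta_defect zeta) (RtoC (-1)).
Proof.
  intro Hz.
  assert (H0 : zero_near (zeta_defect zeta) (2, 1)).
  { exists (1 / 2). split; [lra|]. intros z Hzr. unfold zeta_defect.
    rewrite zeta_cont_eq; [ring|easy|]. rewrite re_plus. simpl.
    pose proof (re_le_Cmod z) as H. apply Rabs_le_between in H. lra. }
  assert (H1 : zero_near (zeta_defect zeta) ((2, 1) + (- 3, 0))%C).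
  { apply identity_segment; [|intros t Ht; apply zeta_defect_analytic; [easy| |]|exact H0].
    - intro E. injection E. lra.
    - intro E. injection E. simpl. lra.
    - simpl. lra. }
  assert (H2 : zero_near (zeta_defect zeta) ((2, 1) + (- 3, 0) + (0, - 1))%C).
  { apply identity_segment; [|intros t Ht; apply zeta_defect_analytic; [easy| |]|exact H1].
    - intro E. injection E. lra.
    - intro E. injection E. simpl. lra.
    - simpl. lra. }
  replace (RtoC (-1)) with ((2, 1) + (- 3, 0) + (0, - 1))%C; [exact H2|].
  unfold Cplus, RtoC. simpl. f_equal; ring.
Qed.

Definition zeta_em_real (x m : R) : R :=
  em_error (fun u => - exp (- ((x - 1) * ln u))) (fun u => (x - 1) * exp (- (x * ln u)))
    (fun u => - (x - 1) * x * exp (- ((x + 1) * ln u))) m.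

Lemma Re_zeta_em_real (x m : R) : Re (zeta_em (RtoC x) m) = zeta_em_real x m.
Proof.
  assert (E0 : forall u, Re (zeta_prim (RtoC x) u) = - exp (- ((x - 1) * ln u))).
  { intro u. unfold zeta_prim. rewrite <- RtoC_minus. unfold RtoC at 2.
    rewrite npow_polar, Rmult_0_l, cos_0, sin_0. simpl. ring. }
  assert (E1 : forall u, Re (zeta_prim1 (RtoC x) u) = (x - 1) * exp (- (x * ln u))).
  { intro u. unfold zeta_prim1. rewrite <- RtoC_minus. unfold RtoC at 2.
    rewrite npow_polar, Rmult_0_l, cos_0, sin_0. simpl. ring. }
  assert (E2 : forall u, Re (zeta_prim2 (RtoC x) u) = - (x - 1) * x * exp (- ((x + 1) * ln u))).
  { intro u. unfold zeta_prim2. rewrite <- RtoC_minus, <- RtoC_plus. unfold RtoC at 3.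
    rewrite npow_polar, Rmult_0_l, cos_0, sin_0. simpl. ring. }
  unfold zeta_em, zeta_em_real, em_error. cbn [Re fst]. now rewrite !E0, !E1, !E2.
Qed.

(** The fourth derivative contains the factor [s + 1], so the error is of order [|x + 1|] near
    [- 1]; this dominates the difference quotients there. The other factors are at most
    [5/2 * 3/2 * 3/2 < 6]. *)
Lemma zeta_em_real_bound (x : R) (n : nat) : Rabs (x + 1) < 1 / 2 ->
  Rabs (zeta_em_real x (INR (S n))) <= 6 * Rabs (x + 1) * exp (- (3 / 2) * ln (INR (S n))).
Proof.
  intro Hx. apply Rabs_lt_between in Hx.
  assert (Hm : 1 <= INR (S n)) by (apply (le_INR 1); lia).
  destruct (zeta_em_bound_components (RtoC x) (INR (S n)) Hm ltac:(rewrite re_RtoC; lra)) as [B _].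
  rewrite Re_zeta_em_real in B. apply Rle_trans with (1 := B).
  rewrite <- RtoC_minus, <- !RtoC_plus, !Cmod_R, re_RtoC.
  rewrite (Rabs_left (x - 1)), (Rabs_left x), (Rabs_pos_eq (x + 2)) by lra.
  pose proof (Rabs_pos (x + 1)) as Hp.
  apply Rmult_le_compat; [|left; apply exp_pos| |].
  - repeat apply Rmult_le_pos; lra.
  - replace (- (x - 1) * - x * Rabs (x + 1) * (x + 2)) with (- (x - 1) * - x * (x + 2) * Rabs (x + 1)) by ring.
    apply Rmult_le_compat_r; [easy|].
    assert (- (x - 1) * - x <= 5 / 2 * (3 / 2)) by (apply Rmult_le_compat; lra).
    assert (0 <= - (x - 1) * - x) by (apply Rmult_le_pos; lra). nra.
  - apply exp_le_compat. assert (0 <= ln (INR (S n))) by (rewrite <- ln_1; apply ln_le; lra). nra.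
Qed.

(** At [s = - 1] the antiderivative is [- u^2], which Euler-Maclaurin handles exactly. *)
Lemma zeta_em_real_m1 (m : R) : 0 < m -> zeta_em_real (-1) m = 0.
Proof.
  intro Hm. unfold zeta_em_real.
  assert (E : forall u, 0 < u -> exp (ln u) = u /\ exp (- ((-1 - 1) * ln u)) = u ^ 2).
  { intros u Hu. split; [now apply exp_ln|].
    replace (- ((-1 - 1) * ln u)) with (ln u + ln u) by ring.
    rewrite exp_plus, exp_ln by easy. ring. }
  unfold em_error. destruct (E m Hm) as [e1 e2]. destruct (E (m + 1) ltac:(lra)) as [e3 e4].
  rewrite e2, e4. replace (- (-1 * ln m)) with (ln m) by ring.
  replace (- (-1 * ln (m + 1))) with (ln (m + 1)) by ring. rewrite e1, e3.
  replace (- ((-1 + 1) * ln m)) with 0 by ring. replace (- ((-1 + 1) * ln (m + 1))) with 0 by ring.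
  rewrite exp_0. field.
Qed.

(** The derivative of [- u^(1 - s)] in [s] at [- 1] is [u^2 ln u], which equals
    [- 2 xlnx_prim u + u^2 / 2], and [em_error] ignores the square. This is where the constant of
    the logarithm meets zeta'(-1). *)
Lemma zeta_em_real_derive (m : R) : 0 < m ->
  is_derive (fun x => zeta_em_real x m) (-1) (-2 * em_error xlnx_prim xlnx_prim1 xlnx_prim2 m).
Proof.
  intro Hm. unfold zeta_em_real, em_error.
  auto_derive; [easy|].
  unfold xlnx_prim, xlnx_prim1, xlnx_prim2.
  replace (- ((-1 + - (1)) * ln (m + 1))) with (ln (m + 1) + ln (m + 1)) by ring.
  replace (- ((-1 + - (1)) * ln m)) with (ln m + ln m) by ring.
  replace (- (-1 * ln m)) with (ln m) by ring.
  replace (- (-1 * ln (m + 1))) with (ln (m + 1)) by ring.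
  replace (- ((-1 + 1) * ln m)) with 0 by ring. replace (- ((-1 + 1) * ln (m + 1))) with 0 by ring.
  rewrite !exp_plus, exp_0, !exp_ln by lra. field.
Qed.

Lemma is_derive_quotient (f : R -> R) (x l : R) : is_derive f x l -> f x = 0 ->
  filterlim (fun y => f y / (y - x)) (locally' x) (locally l).
Proof.
  intros Hf H0. apply is_derive_Reals in Hf. apply filterlim_locally. intros [eps Heps].
  destruct (Hf eps Heps) as [del Hdel]. exists del. intros y Hy Hne. change R in y.
  assert (Hy' : Rabs (y - x) < del) by exact Hy.
  assert (Hd : y - x <> 0) by (intro; apply Hne; lra).
  specialize (Hdel (y - x) Hd Hy'). rewrite H0 in Hdel.
  replace (x + (y - x)) with y in Hdel by ring. rewrite Rminus_0_r in Hdel. exact Hdel.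
Qed.

(** Termwise differentiation of the series at [- 1], where all terms vanish, by dominated
    convergence of the quotients. *)
Lemma zeta_em_real_sum_quotient :
  filterlim (fun x => Series (fun n => zeta_em_real x (INR (S n))) / (x - -1)) (locally' (-1))
    (locally (-2 * xlnx_em_sum)).
Proof.
  apply filterlim_ext with (fun x => Series (fun n => zeta_em_real x (INR (S n)) / (x - -1))).
  { intro x. unfold Rdiv. apply Series_scal_r. }
  unfold xlnx_em_sum. rewrite <- Series_scal_l.
  apply (tannery (FF := Rbar_locally'_filter (Finite (-1))) (locally' (-1)) (fun x n => zeta_em_real x (INR (S n)) / (x - -1)) _
    (fun n => 6 * exp (- (3 / 2) * ln (INR (S n))))).
  - apply (ex_series_scal_l (K := R_AbsRing) (V := R_NormedModule) 6 _ ex_series_three_halves).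
  - assert (Hh : 0 < 1 / 2) by lra. exists (mkposreal _ Hh). intros x Hx Hne n. change R in x.
    assert (Hx' : Rabs (x + 1) < 1 / 2).
    { assert (E : Rabs (x - -1) < 1 / 2) by exact Hx. now replace (x - -1) with (x + 1) in E by ring. }
    replace (x - -1) with (x + 1) by ring.
    assert (P : 0 < Rabs (x + 1)) by (apply Rabs_pos_lt; intro; apply Hne; lra).
    unfold Rdiv at 1. rewrite Rabs_mult, Rabs_inv.
    apply Rmult_le_reg_r with (Rabs (x + 1)); [easy|].
    apply Rle_trans with (Rabs (zeta_em_real x (INR (S n)))); [right; field; lra|].
    apply Rle_trans with (1 := zeta_em_real_bound x n Hx'). right.
    ring.
  - intro n. assert (Hn : 0 < INR (S n)) by (apply lt_0_INR; lia).
    apply (is_derive_quotient (fun x => zeta_em_real x (INR (S n)))).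
    + now apply zeta_em_real_derive.
    + now apply zeta_em_real_m1.
Qed.

Lemma zeta'_m1_eq (zeta : C -> C) : is_riemann_zeta zeta ->
  zeta'_m1 zeta = xlnx_em_sum - 1 / 6.
Proof.
  intro Hz. destruct (zeta_defect_zero zeta Hz) as [r [Hr H]].
  set (w := fun x => Series (fun n => zeta_em_real x (INR (S n)))).
  assert (Hre : forall x, Rabs (x + 1) < r -> x <> 1 ->
    Re (zeta (RtoC x)) = (1 + (x - 1) / 2 + x * (x - 1) / 12 + w x) / (x - 1)).
  { intros x Hx Hx1. specialize (H (RtoC (x + 1)) ltac:(rewrite Cmod_R; easy)).
    rewrite <- RtoC_plus in H. replace (-1 + (x + 1)) with x in H by ring.
    assert (E : Re ((RtoC x - RtoC 1) * zeta (RtoC x))%C = Re (zeta_cont (RtoC x))).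
    { f_equal. unfold zeta_defect in H.
      transitivity ((RtoC x - RtoC 1) * zeta (RtoC x) - zeta_cont (RtoC x) + zeta_cont (RtoC x))%C; [ring|].
      rewrite H. ring. }
    rewrite <- RtoC_minus, re_scal_l in E.
    assert (E2 : Re (zeta_cont (RtoC x)) = 1 + (x - 1) / 2 + x * (x - 1) / 12 + w x).
    { unfold zeta_cont. rewrite re_plus. f_equal.
      - unfold zeta_poly. rewrite <- RtoC_minus, <- RtoC_mult, <- !RtoC_div, <- !RtoC_plus by lra.
        apply re_RtoC.
      - unfold zeta_em_sum_fun, w. cbn [Re fst]. apply Series_ext. intro n. apply Re_zeta_em_real. }
    rewrite <- E2, <- E. field. lra. }
  assert (Hw : w (-1) = 0).
  { unfold w. rewrite (Series_ext _ (fun _ => 0)).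
    - apply is_series_unique. now apply (is_series_finite (fun _ => 0) 0).
    - intro n. apply zeta_em_real_m1. apply lt_0_INR. lia. }
  assert (Hm1 := Hre (-1) ltac:(replace (-1 + 1) with 0 by ring; rewrite Rabs_R0; easy) ltac:(lra)). rewrite Hw in Hm1.
  (* By definition [C_derive] takes limits along the horizontal line through the point, so its real
     part is a limit over real [x]. *)
  unfold zeta'_m1, C_derive, C_lim. cbn [Re fst].
  rewrite (is_lim_unique _ _ (xlnx_em_sum - 1 / 6)); [easy|].
  change (fst (RtoC (-1))) with (-1).
  (* The difference quotient at [- 1] with the polynomial part simplified: [1 / (x - 1) + 1 / 2]
     equals [(x + 1) / (2 (x - 1))], so the factor [x + 1] cancels. At [- 1] the first two summands
     give [- 1/4 + 1/12 = - 1/6]. *)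
  set (g := fun x => / (2 * (x - 1)) + 1 / 12 + w x / (x - -1) * / (x - 1)).
  apply is_lim_ext_loc with g.
  - assert (Hr1 : 0 < Rmin r 1) by (apply Rmin_pos; lra).
    exists (mkposreal _ Hr1). intros x Hx Hne. change R in x.
    assert (Hx' : Rabs (x + 1) < Rmin r 1).
    { assert (E : Rabs (x - -1) < Rmin r 1) by exact Hx. now replace (x - -1) with (x + 1) in E by ring. }
    pose proof (Rmin_l r 1). pose proof (Rmin_r r 1).
    assert (Hx1 : x <> 1) by (intro; subst x; rewrite Rabs_pos_eq in Hx'; lra).
    assert (Hxr := Hre x ltac:(lra) Hx1).
    change (g x = Re ((zeta (RtoC x) - zeta (RtoC (-1))) / (RtoC x - RtoC (-1)))%C).
    unfold Cdiv. rewrite <- RtoC_minus, <- RtoC_inv by lra. rewrite re_scal_r.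
    unfold Cminus. rewrite re_plus, re_opp, Hxr, Hm1. unfold g. field. lra.
  - assert (Hc : forall f, continuity_pt f (-1) -> is_lim f (-1) (f (-1))) by (intros; now apply is_lim_continuity).
    replace (xlnx_em_sum - 1 / 6) with
      (/ (2 * (-1 - 1)) + 1 / 12 + (-2 * xlnx_em_sum) * / (-1 - 1)) by field.
    apply (is_lim_plus' (fun x => / (2 * (x - 1)) + 1 / 12)).
    + apply (Hc (fun x => / (2 * (x - 1)) + 1 / 12)). apply derivable_continuous_pt.
      apply ex_derive_Reals_0. auto_derive. lra.
    + apply (is_lim_mult (fun x => w x / (x - -1)) (fun x => / (x - 1)) (-1) (-2 * xlnx_em_sum) (/ (-1 - 1))).
      * exact zeta_em_real_sum_quotient.
      * apply (Hc (fun x => / (x - 1))). apply derivable_continuous_pt.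
        apply ex_derive_Reals_0. auto_derive. lra.
      * easy.
Qed.

(** * Derivatives of the logarithm and decay off the real axis *)

(** For [L x], the logarithm of the generating function at [exp (- x)], this is the [k]-th
    derivative of [L] times [(- 1)^k]. As a sum of nonnegative terms it is convex in [x]. *)
Definition log_moment (k : nat) (x : R) : R :=
  Series (fun n => sig_coef n * INR n ^ k * exp (- x) ^ n).

Lemma ex_series_log_moment (k : nat) (x : R) : 0 < x ->
  ex_series (fun n => sig_coef n * INR n ^ k * exp (- x) ^ n).
Proof.
  intro Hx. set (d := x / (2 * (INR k + 1))).
  assert (Hk : 0 <= INR k) by apply pos_INR.
  assert (Hd : 0 < d) by (unfold d; apply Rdiv_lt_0_compat; lra).
  assert (Hdk : INR k * d <= x / 2).
  { unfold d. apply Rmult_le_reg_r with (2 * (INR k + 1)); [lra|].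
    replace (INR k * (x / (2 * (INR k + 1))) * (2 * (INR k + 1))) with (INR k * x) by (field; lra).
    nra. }
  pose proof (exp_neg_01 (x / 2) ltac:(lra)) as Hq.
  apply (ex_series_le (V := R_CompleteNormedModule) _
    (fun n => scal ((/ d) ^ k) (sig_coef n * exp (- (x / 2)) ^ n))).
  - intro n. unfold norm; simpl; unfold abs; simpl. unfold scal; simpl; unfold mult; simpl.
    pose proof (sig_coef_ge0 n) as Hc. pose proof (pos_INR n) as Hn.
    rewrite !exp_pow.
    pose proof (exp_pos (INR n * - x)). assert (0 <= INR n ^ k) by now apply pow_le.
    rewrite Rabs_pos_eq by (repeat apply Rmult_le_pos; lra).
    assert (HN : INR n <= / d * exp (INR n * d)).
    { apply Rmult_le_reg_l with d; [easy|]. rewrite <- Rmult_assoc, Rinv_r, Rmult_1_l by lra.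
      pose proof (exp_ineq1_le (INR n * d)). lra. }
    assert (HNk : INR n ^ k <= (/ d) ^ k * exp (INR k * (INR n * d))).
    { rewrite <- exp_pow, <- Rpow_mult_distr. apply pow_incr. lra. }
    assert (Hexp : exp (INR k * (INR n * d)) * exp (INR n * - x) <= exp (INR n * - (x / 2))).
    { rewrite <- exp_plus. apply exp_le_compat. nra. }
    assert (Hdk0 : 0 <= (/ d) ^ k) by (apply pow_le; left; now apply Rinv_0_lt_compat).
    replace ((/ d) ^ k * (sig_coef n * exp (INR n * - (x / 2))))
      with (sig_coef n * ((/ d) ^ k * exp (INR n * - (x / 2)))) by ring.
    rewrite Rmult_assoc. apply Rmult_le_compat_l; [easy|].
    apply Rle_trans with ((/ d) ^ k * exp (INR k * (INR n * d)) * exp (INR n * - x)).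
    + apply Rmult_le_compat_r; lra.
    + rewrite Rmult_assoc. now apply Rmult_le_compat_l.
  - apply (ex_series_scal_l (K := R_AbsRing) (V := R_NormedModule)).
    apply ex_series_sig_coef. lra.
Qed.

Lemma log_moment_0 (x : R) : 0 < x -> log_moment 0 x = Series (pp_log_term (exp (- x))).
Proof.
  intro Hx. pose proof (exp_neg_01 x Hx). unfold log_moment.
  rewrite <- (is_series_unique _ _ (is_series_sig_coef (exp (- x)) ltac:(lra))).
  apply Series_ext. intro n. simpl. ring.
Qed.

Lemma log_moment_ge0 (k : nat) (x : R) : 0 < x -> 0 <= log_moment k x.
Proof.
  intro Hx. apply (is_series_le (fun _ => 0) _ 0 _) with (3 := Series_correct _ (ex_series_log_moment k x Hx)).
  - intro n. repeat apply Rmult_le_pos; [apply sig_coef_ge0|apply pow_le, pos_INR|apply pow_le; left; apply exp_pos].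
  - now apply (is_series_finite (fun _ => 0) 0).
Qed.

(* Convexity: [exp (- n t) >= 1 - n t] in each term. *)
Lemma log_moment_convex (k : nat) (x t : R) : 0 < x -> 0 < x + t ->
  log_moment k x - t * log_moment (S k) x <= log_moment k (x + t).
Proof.
  intros Hx Hxt.
  assert (H0 := Series_correct _ (ex_series_log_moment k x Hx)).
  assert (H1 := Series_correct _ (ex_series_log_moment (S k) x Hx)).
  assert (H2 := Series_correct _ (ex_series_log_moment k (x + t) Hxt)).
  fold (log_moment k x) in H0. fold (log_moment (S k) x) in H1. fold (log_moment k (x + t)) in H2.
  assert (H3 := is_series_minus (V := R_NormedModule) _ _ _ _ H0
    (is_series_scal_l (K := R_AbsRing) (V := R_NormedModule) t _ _ H1)).
  refine (is_series_le _ _ _ _ _ H3 H2). intro n.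
  change (sig_coef n * INR n ^ k * exp (- x) ^ n - t * (sig_coef n * INR n ^ S k * exp (- x) ^ n) <=
          sig_coef n * INR n ^ k * exp (- (x + t)) ^ n).
  rewrite !exp_pow. rewrite <- tech_pow_Rmult.
  replace (INR n * - (x + t)) with (INR n * - x + - (INR n * t)) by ring. rewrite exp_plus.
  pose proof (exp_ineq1_le (- (INR n * t))). pose proof (exp_pos (INR n * - x)).
  pose proof (sig_coef_ge0 n). assert (0 <= INR n ^ k) by (apply pow_le, pos_INR).
  assert (0 <= sig_coef n * INR n ^ k * exp (INR n * - x)) by (repeat apply Rmult_le_pos; lra).
  nra.
Qed.

Definition log_rem (x : R) : R := log_moment 0 x - inv_cube_sum / x ^ 2 - ln x / 12 - (xlnx_em_sum - 1 / 6).

Lemma log_rem_lim (eps : R) : 0 < eps ->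
  exists del, 0 < del /\ forall x, 0 < x < del -> Rabs (log_rem x) < eps.
Proof.
  intro Heps. destruct (proj1 (filterlim_at_right_0 _ _) pp_log_asymp eps Heps) as [d [Hd H]].
  exists d. split; [easy|]. intros x Hx. unfold log_rem. rewrite log_moment_0 by lra. now apply H.
Qed.

Lemma inv_cube_sum_pos : 0 < inv_cube_sum.
Proof.
  apply Rlt_le_trans with (sum_f_R0 (fun n => harmonic_coef n ^ 3) 1).
  - simpl. lra.
  - apply sum_le_is_series; [intro; apply pow_le, harmonic_coef_ge0|].
    apply Series_correct, ex_series_inv_cube.
Qed.

(** The error is [o(x^(-2))], finer than the leading order [x^(-3)], because the phase multiplies
    the first moment by an angle of order [x^2]. Convexity traps [t * log_moment 1 x] between
    [L x - L (x + t)] and [L (x - t) - L x]. *)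
Lemma log_moment_1_lim (eps : R) : 0 < eps ->
  exists del, 0 < del <= 1 /\ forall x, 0 < x < del ->
    Rabs (x ^ 2 * (log_moment 1 x - 2 * inv_cube_sum / x ^ 3)) <= eps.
Proof.
  intro Heps. pose proof inv_cube_sum_pos as Hz. set (z := inv_cube_sum) in *.
  set (e := Rmin (1 / 2) (eps / (48 * z))).
  assert (He : 0 < e) by (apply Rmin_pos; [lra|apply Rdiv_lt_0_compat; lra]).
  assert (He1 : e <= 1 / 2) by apply Rmin_l.
  assert (He2 : 12 * z * e <= eps / 4).
  { apply Rle_trans with (12 * z * (eps / (48 * z))); [apply Rmult_le_compat_l; [lra|apply Rmin_r]|].
    right. field. lra. }
  destruct (log_rem_lim (e * eps / 8)) as [d [Hd H]].
  { apply Rdiv_lt_0_compat; [now apply Rmult_lt_0_compat|lra]. }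
  set (D := Rmin (d / 2) (Rmin 1 eps)).
  exists D. split.
  { split; [apply Rmin_pos; [lra|apply Rmin_pos; lra]|]. eapply Rle_trans; [apply Rmin_r|apply Rmin_l]. }
  intros x Hx.
  assert (Hx1 : x < d / 2) by (eapply Rlt_le_trans; [apply Hx|apply Rmin_l]).
  assert (Hx2 : x < 1) by (eapply Rlt_le_trans; [apply Hx|eapply Rle_trans; [apply Rmin_r|apply Rmin_l]]).
  assert (Hx3 : x < eps) by (eapply Rlt_le_trans; [apply Hx|eapply Rle_trans; [apply Rmin_r|apply Rmin_r]]).
  set (t := e * x ^ 2).
  assert (Hx0 : 0 < x ^ 2) by (apply pow_lt; lra).
  assert (Ht : 0 < t <= x / 2).
  { unfold t. split; [now apply Rmult_lt_0_compat|]. replace (x / 2) with (1 / 2 * x) by field.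
    apply Rmult_le_compat; simpl; nra. }
  pose proof (H x ltac:(lra)) as R0. pose proof (H (x - t) ltac:(lra)) as Rm. pose proof (H (x + t) ltac:(lra)) as Rp.
  pose proof (log_moment_convex 0 x t ltac:(lra) ltac:(lra)) as Cp.
  pose proof (log_moment_convex 0 x (- t) ltac:(lra) ltac:(lra)) as Cm.
  replace (x + - t) with (x - t) in Cm by ring.
  assert (EL : forall y, log_moment 0 y = z / y ^ 2 + ln y / 12 + (xlnx_em_sum - 1 / 6) + log_rem y)
    by (intro y; unfold log_rem, z; ring).
  rewrite (EL x), (EL (x + t)) in Cp. rewrite (EL x), (EL (x - t)) in Cm.
  apply Rabs_lt_between in R0, Rm, Rp.
  assert (Lm : ln (x - t) <= ln x) by (apply ln_le; lra).
  assert (Lp : ln (x + t) <= ln x + t / x).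
  { replace (x + t) with (x * (1 + t / x)) by (field; lra).
    assert (0 < t / x) by (apply Rdiv_lt_0_compat; lra).
    rewrite ln_mult by lra. apply Rplus_le_compat_l.
    rewrite <- (ln_exp (t / x)) at 2. apply ln_le; [lra|apply exp_ineq1_le]. }
  set (D1 := log_moment 1 x) in *.
  assert (Hx3' : 0 < x ^ 3) by (apply pow_lt; lra).
  assert (Um : z / (x - t) ^ 2 - z / x ^ 2 <= t * (2 * z / x ^ 3) + 12 * z * e * e).
  { replace (z / (x - t) ^ 2 - z / x ^ 2) with
      (t * (2 * z / x ^ 3) + z * (t * t * (3 * x - 2 * t) / (x ^ 3 * (x - t) ^ 2))) by (field; lra).
    apply Rplus_le_compat_l.
    replace (12 * z * e * e) with (z * (12 * e * e)) by ring. apply Rmult_le_compat_l; [lra|].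
    assert (P : 0 < x ^ 3 * (x - t) ^ 2) by (apply Rmult_lt_0_compat; [easy|apply pow_lt; lra]).
    apply Rle_div_l; [easy|].
    assert (Q : x ^ 2 / 4 <= (x - t) ^ 2) by (simpl; nra).
    apply Rle_trans with (12 * e * e * (x ^ 3 * (x ^ 2 / 4))).
    - replace (12 * e * e * (x ^ 3 * (x ^ 2 / 4))) with (t * t * (3 * x)) by (unfold t; field).
      apply Rmult_le_compat_l; [nra|lra].
    - apply Rmult_le_compat_l; [nra|]. apply Rmult_le_compat_l; lra. }
  assert (Up : t * (2 * z / x ^ 3) - 5 * z * e * e <= z / x ^ 2 - z / (x + t) ^ 2).
  { replace (z / x ^ 2 - z / (x + t) ^ 2) with
      (t * (2 * z / x ^ 3) - z * (t * t * (3 * x + 2 * t) / (x ^ 3 * (x + t) ^ 2))) by (field; lra).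
    apply Rplus_le_compat_l. apply Ropp_le_contravar.
    replace (5 * z * e * e) with (z * (5 * e * e)) by ring. apply Rmult_le_compat_l; [lra|].
    assert (P : 0 < x ^ 3 * (x + t) ^ 2) by (apply Rmult_lt_0_compat; [easy|apply pow_lt; lra]).
    apply Rle_div_l; [easy|].
    assert (Q : x ^ 2 <= (x + t) ^ 2) by (simpl; nra).
    apply Rle_trans with (5 * e * e * (x ^ 3 * x ^ 2)).
    - replace (5 * e * e * (x ^ 3 * x ^ 2)) with (t * t * (5 * x)) by (unfold t; ring).
      apply Rmult_le_compat_l; [nra|lra].
    - apply Rmult_le_compat_l; [nra|]. apply Rmult_le_compat_l; lra. }
  replace (x ^ 2 * (D1 - 2 * z / x ^ 3)) with ((t * D1 - t * (2 * z / x ^ 3)) / e) by (unfold t; field; lra).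
  assert (Hup : t * D1 - t * (2 * z / x ^ 3) <= eps * e) by nra.
  assert (Hxe : t / x / 12 <= eps * e / 12).
  { replace (t / x) with (e * x) by (unfold t; field; lra). nra. }
  assert (Hlo : - (eps * e) <= t * D1 - t * (2 * z / x ^ 3)) by nra.
  apply Rabs_le. split.
  - apply Rle_div_r; [easy|]. lra.
  - apply Rle_div_l; [easy|]. lra.
Qed.

Lemma log_moment_1_lim' (eps : R) : 0 < eps ->
  exists del, 0 < del <= 1 /\ forall x, 0 < x < del ->
    Rabs (x ^ 3 * log_moment 1 x - 2 * inv_cube_sum) <= eps.
Proof.
  intro Heps. destruct (log_moment_1_lim eps Heps) as [d [Hd H]]. exists d. split; [easy|].
  intros x Hx. specialize (H x Hx).
  replace (x ^ 3 * log_moment 1 x - 2 * inv_cube_sum)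
    with (x * (x ^ 2 * (log_moment 1 x - 2 * inv_cube_sum / x ^ 3))) by (field; lra).
  rewrite Rabs_mult, (Rabs_pos_eq x) by lra.
  pose proof (Rabs_pos (x ^ 2 * (log_moment 1 x - 2 * inv_cube_sum / x ^ 3))). nra.
Qed.

(** Secants of the first moment between [x] and [x (1 - e)] or [x (1 + e)]. Relative precision
    suffices here, so a step proportional to [x] and the weaker form [log_moment_1_lim'] are
    enough. *)
Lemma log_moment_2_lim (eps : R) : 0 < eps ->
  exists del, 0 < del <= 1 /\ forall x, 0 < x < del ->
    Rabs (x ^ 4 * log_moment 2 x - 6 * inv_cube_sum) <= eps.
Proof.
  intro Heps. pose proof inv_cube_sum_pos as Hz. set (z := inv_cube_sum) in *.
  set (e := Rmin (1 / 2) (eps / (192 * z))).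
  assert (He : 0 < e) by (apply Rmin_pos; [lra|apply Rdiv_lt_0_compat; lra]).
  assert (He1 : e <= 1 / 2) by apply Rmin_l.
  assert (He2 : 96 * z * e <= eps / 2).
  { apply Rle_trans with (96 * z * (eps / (192 * z))); [apply Rmult_le_compat_l; [lra|apply Rmin_r]|].
    right. field. lra. }
  destruct (log_moment_1_lim' (e * eps / 18)) as [d [Hd H]].
  { apply Rdiv_lt_0_compat; [now apply Rmult_lt_0_compat|lra]. }
  fold z in H.
  exists (d / 2). split; [lra|]. intros x Hx.
  set (a := 1 - e). set (b := 1 + e).
  assert (Ha : 1 / 2 <= a < 1) by (unfold a; lra). assert (Hb : 1 < b <= 3 / 2) by (unfold b; lra).
  pose proof (H x ltac:(lra)) as R0. pose proof (H (x * a) ltac:(nra)) as Rm. pose proof (H (x * b) ltac:(nra)) as Rp.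
  pose proof (log_moment_convex 1 x (x * e) ltac:(lra) ltac:(nra)) as Cp.
  pose proof (log_moment_convex 1 x (- (x * e)) ltac:(lra) ltac:(nra)) as Cm.
  replace (x + - (x * e)) with (x * a) in Cm by (unfold a; ring).
  replace (x + x * e) with (x * b) in Cp by (unfold b; ring).
  set (D2 := log_moment 2 x) in *. set (M0 := log_moment 1 x) in *.
  set (Mm := log_moment 1 (x * a)) in *. set (Mp := log_moment 1 (x * b)) in *.
  apply Rabs_le_between in R0, Rm, Rp. rewrite Rpow_mult_distr in Rm, Rp.
  assert (X3 : 0 < x ^ 3) by (apply pow_lt; lra).
  assert (A3 : 1 / 8 <= a ^ 3) by (replace (1 / 8) with ((1 / 2) ^ 3) by field; apply pow_incr; lra).
  assert (B3 : 1 <= b ^ 3) by (rewrite <- (pow1 3); apply pow_incr; lra).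
  assert (Ap : (2 * z) / a ^ 3 - 2 * z <= 6 * z * e + 96 * z * e * e).
  { assert (E : 1 <= (1 + 3 * e + 48 * e * e) * a ^ 3).
    { unfold a. simpl. assert (0 <= e * e * (39 - 135 * e + 141 * e ^ 2 - 48 * e ^ 3)); [|simpl in *; nra].
      apply Rmult_le_pos; [nra|]. simpl. nra. }
    replace (2 * z / a ^ 3 - 2 * z) with (2 * z * (1 / a ^ 3 - 1)) by (field; lra).
    replace (6 * z * e + 96 * z * e * e) with (2 * z * (3 * e + 48 * e * e)) by ring.
    apply Rmult_le_compat_l; [lra|]. assert (1 / a ^ 3 <= 1 + 3 * e + 48 * e * e); [|lra].
    apply Rle_div_l; lra. }
  assert (Bp : 6 * z * e - 12 * z * e * e <= 2 * z - (2 * z) / b ^ 3).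
  { assert (E : 1 >= (1 - 3 * e + 6 * e * e) ). { nra. }
    assert (E2 : 1 <= (1 - 3 * e + 6 * e * e) * b ^ 3).
    { unfold b. simpl. assert (0 <= e ^ 3 * (10 + 15 * e + 6 * e ^ 2)); [|simpl in *; nra].
      apply Rmult_le_pos; [apply pow_le; lra|]. simpl. nra. }
    replace (2 * z - 2 * z / b ^ 3) with (2 * z * (1 - 1 / b ^ 3)) by (field; lra).
    replace (6 * z * e - 12 * z * e * e) with (2 * z * (3 * e - 6 * e * e)) by ring.
    apply Rmult_le_compat_l; [lra|]. assert (1 / b ^ 3 <= 1 - 3 * e + 6 * e * e); [|lra].
    apply Rle_div_l; lra. }
  assert (Hm : x ^ 3 * Mm <= 2 * z / a ^ 3 + 8 * (e * eps / 18)).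
  { assert (x ^ 3 * Mm <= (2 * z + e * eps / 18) / a ^ 3) by (apply (proj1 (Rle_div_r (x ^ 3 * Mm) _ (a ^ 3) ltac:(lra))); lra).
    assert ((2 * z + e * eps / 18) / a ^ 3 = 2 * z / a ^ 3 + (e * eps / 18) * / a ^ 3) by (field; lra).
    assert (/ a ^ 3 <= 8) by (rewrite <- (Rinv_inv 8); apply Rinv_le_contravar; lra).
    assert (0 < e * eps / 18) by (apply Rdiv_lt_0_compat; [now apply Rmult_lt_0_compat|lra]). pose proof (Rmult_le_compat_l (e * eps / 18) _ _ ltac:(lra) H2). lra. }
  assert (Hp : x ^ 3 * Mp <= 2 * z / b ^ 3 + e * eps / 18).
  { assert (x ^ 3 * Mp <= (2 * z + e * eps / 18) / b ^ 3) by (apply (proj1 (Rle_div_r (x ^ 3 * Mp) _ (b ^ 3) ltac:(lra))); lra).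
    assert ((2 * z + e * eps / 18) / b ^ 3 = 2 * z / b ^ 3 + (e * eps / 18) * / b ^ 3) by (field; lra).
    assert (/ b ^ 3 <= 1) by (rewrite <- Rinv_1; apply Rinv_le_contravar; lra).
    assert (0 < e * eps / 18) by (apply Rdiv_lt_0_compat; [now apply Rmult_lt_0_compat|lra]). pose proof (Rmult_le_compat_l (e * eps / 18) _ _ ltac:(lra) H2). lra. }
  assert (Um : e * (x ^ 4 * D2) <= x ^ 3 * Mm - x ^ 3 * M0).
  { replace (e * (x ^ 4 * D2)) with (x ^ 3 * (x * e * D2)) by ring.
    rewrite <- Rmult_minus_distr_l. apply Rmult_le_compat_l; lra. }
  assert (Up : x ^ 3 * M0 - x ^ 3 * Mp <= e * (x ^ 4 * D2)).
  { replace (e * (x ^ 4 * D2)) with (x ^ 3 * (x * e * D2)) by ring.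
    rewrite <- Rmult_minus_distr_l. apply Rmult_le_compat_l; lra. }
  pose proof (Rmult_le_compat_l e _ _ (Rlt_le _ _ He) He2) as He3.
  assert (0 < e * eps) by now apply Rmult_lt_0_compat. assert (0 < z * e * e) by (apply Rmult_lt_0_compat; [now apply Rmult_lt_0_compat|easy]).
  assert (F1 : e * (x ^ 4 * D2 - 6 * z) <= e * eps) by lra.
  assert (F2 : - (e * eps) <= e * (x ^ 4 * D2 - 6 * z)) by lra.
  apply Rabs_le. split; apply (Rmult_le_reg_l e); lra.
Qed.

(** Convexity gives [x/2 * log_moment 3 x <= log_moment 2 (x/2)]. An upper bound is enough, since
    the third moment only occurs in Taylor remainders. *)
Lemma log_moment_3_bound :
  exists C del, 0 < C /\ 0 < del <= 1 /\ forall x, 0 < x < del -> x ^ 5 * log_moment 3 x <= C.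
Proof.
  pose proof inv_cube_sum_pos as Hz.
  destruct (log_moment_2_lim 1 Rlt_0_1) as [d [Hd H]].
  exists (32 * (6 * inv_cube_sum + 1)), d. split; [lra|]. split; [easy|]. intros x Hx.
  pose proof (log_moment_convex 2 x (- (x / 2)) ltac:(lra) ltac:(lra)) as C.
  replace (x + - (x / 2)) with (x / 2) in C by field.
  pose proof (H (x / 2) ltac:(lra)) as H2. apply Rabs_le_between in H2.
  pose proof (log_moment_ge0 2 x ltac:(lra)).
  assert (X4 : 0 < x ^ 4) by (apply pow_lt; lra).
  replace ((x / 2) ^ 4) with (x ^ 4 / 16) in H2 by field.
  replace (x ^ 5 * log_moment 3 x) with (2 * (x ^ 4 * (x / 2 * log_moment 3 x))) by field.
  nra.
Qed.

(** * Expansion of the logarithm at small angles *)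

Lemma trig_taylor (t : R) : 0 <= t ->
  Rabs (cos t - 1 + t ^ 2 / 2) <= t ^ 3 / 6 /\ Rabs (sin t - t) <= t ^ 3 / 6 /\ Rabs (1 - cos t) <= t.
Proof.
  intro Ht.
  assert (S0 : forall s, 0 <= s -> Rabs (sin s) <= s).
  { intros s Hs. assert (G := derive_abs_le sin cos (fun u => u) (fun _ => 1) 0 s Hs).
    rewrite sin_0, !Rminus_0_r in G. apply G; intros u Hu.
    - apply is_derive_sin.
    - auto_derive; easy.
    - apply Rabs_le, COS_bound. }
  assert (C0 : forall s, 0 <= s -> Rabs (1 - cos s) <= s).
  { intros s Hs. assert (G := derive_abs_le (fun u => 1 - cos u) sin (fun u => u) (fun _ => 1) 0 s Hs).
    cbv beta in G. rewrite cos_0, !Rminus_0_r in G. replace (1 - cos s - (1 - 1)) with (1 - cos s) in G by ring.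
    apply G; intros u Hu.
    - auto_derive; [easy|ring].
    - auto_derive; easy.
    - apply Rabs_le, SIN_bound. }
  assert (C1 : forall s, 0 <= s -> Rabs (1 - cos s) <= s ^ 2 / 2).
  { intros s Hs. assert (G := derive_abs_le (fun u => 1 - cos u) sin (fun u => u ^ 2 / 2) (fun u => u) 0 s Hs).
    cbv beta in G. rewrite cos_0 in G. replace (1 - cos s - (1 - 1)) with (1 - cos s) in G by ring.
    replace (s ^ 2 / 2 - 0 ^ 2 / 2) with (s ^ 2 / 2) in G by field.
    apply G; intros u Hu.
    - auto_derive; [easy|ring].
    - auto_derive; [easy|field].
    - apply S0; lra. }
  assert (S1 : forall s, 0 <= s -> Rabs (s - sin s) <= s ^ 2 / 2).
  { intros s Hs. assert (G := derive_abs_le (fun u => u - sin u) (fun u => 1 - cos u) (fun u => u ^ 2 / 2) (fun u => u) 0 s Hs).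
    cbv beta in G. rewrite sin_0 in G. replace (s - sin s - (0 - 0)) with (s - sin s) in G by ring.
    replace (s ^ 2 / 2 - 0 ^ 2 / 2) with (s ^ 2 / 2) in G by field.
    apply G; intros u Hu.
    - auto_derive; [easy|ring].
    - auto_derive; [easy|field].
    - apply C0; lra. }
  repeat split.
  - assert (G := derive_abs_le (fun u => cos u - 1 + u ^ 2 / 2) (fun u => u - sin u) (fun u => u ^ 3 / 6) (fun u => u ^ 2 / 2) 0 t Ht).
    cbv beta in G. rewrite cos_0 in G.
    replace (cos t - 1 + t ^ 2 / 2 - (1 - 1 + 0 ^ 2 / 2)) with (cos t - 1 + t ^ 2 / 2) in G by field.
    replace (t ^ 3 / 6 - 0 ^ 3 / 6) with (t ^ 3 / 6) in G by field.
    apply G; intros u Hu.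
    + auto_derive; [easy|field].
    + auto_derive; [easy|field].
    + apply S1; lra.
  - assert (G := derive_abs_le (fun u => sin u - u) (fun u => cos u - 1) (fun u => u ^ 3 / 6) (fun u => u ^ 2 / 2) 0 t Ht).
    cbv beta in G. rewrite sin_0 in G.
    replace (sin t - t - (0 - 0)) with (sin t - t) in G by ring.
    replace (t ^ 3 / 6 - 0 ^ 3 / 6) with (t ^ 3 / 6) in G by field.
    apply G; intros u Hu.
    + auto_derive; [easy|ring].
    + auto_derive; [easy|field].
    + rewrite Rabs_minus_sym. apply C1; lra.
  - now apply C0.
Qed.

Lemma trig_taylor_abs (t : R) :
  Rabs (cos t - 1 + t ^ 2 / 2) <= Rabs t ^ 3 / 6 /\ Rabs (sin t - t) <= Rabs t ^ 3 / 6 /\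
  Rabs (1 - cos t) <= Rabs t /\ Rabs (sin t) <= Rabs t + Rabs t.
Proof.
  destruct (Rle_lt_dec 0 t) as [H|H].
  - rewrite (Rabs_pos_eq t) by easy. destruct (trig_taylor t H) as [H1 [H2 H3]]. repeat split; try easy.
    assert (G := derive_abs_le sin cos (fun u => u) (fun _ => 1) 0 t H).
    rewrite sin_0, !Rminus_0_r in G. apply Rle_trans with t; [|lra]. apply G; intros u Hu.
    + apply is_derive_sin.
    + auto_derive; easy.
    + apply Rabs_le, COS_bound.
  - rewrite (Rabs_left t) by easy. destruct (trig_taylor (- t) ltac:(lra)) as [H1 [H2 H3]].
    rewrite cos_neg in H1, H3. rewrite sin_neg in H2.
    replace ((- t) ^ 2) with (t ^ 2) in H1 by ring.
    replace (- sin t - - t) with (- (sin t - t)) in H2 by ring. rewrite Rabs_Ropp in H2.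
    repeat split; try easy.
    assert (G := derive_abs_le sin cos (fun u => u) (fun _ => 1) 0 (- t) ltac:(lra)).
    rewrite sin_0, !Rminus_0_r, sin_neg, Rabs_Ropp in G. apply Rle_trans with (- t); [|lra]. apply G; intros u Hu.
    + apply is_derive_sin.
    + auto_derive; easy.
    + apply Rabs_le, COS_bound.
Qed.

(** With [log_im], the real and imaginary parts of the power series [L] at [q = exp (- x + i y)]. *)
Definition log_re (x y : R) : R := PSeries (cos_coef sig_coef y) (exp (- x)).
Definition log_im (x y : R) : R := PSeries (sin_coef sig_coef y) (exp (- x)).

Lemma log_re_im_series (x y : R) : 0 < x ->
  is_series (fun n => sig_coef n * exp (- x) ^ n * cos (INR n * y)) (log_re x y) /\
  is_series (fun n => sig_coef n * exp (- x) ^ n * sin (INR n * y)) (log_im x y).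
Proof.
  intro Hx. pose proof (exp_neg_01 x Hx) as Hq. split.
  - assert (E := Series_correct _ (ex_series_cos_coef sig_coef y (exp (- x)) sig_coef_ge0 ltac:(lra) (ex_series_sig_coef (exp (- x)) ltac:(lra)))).
    apply is_series_ext with (2 := E). intro n. unfold cos_coef. eq_in_R. ring.
  - assert (E := Series_correct _ (ex_series_sin_coef sig_coef y (exp (- x)) sig_coef_ge0 ltac:(lra) (ex_series_sig_coef (exp (- x)) ltac:(lra)))).
    apply is_series_ext with (2 := E). intro n. unfold sin_coef. eq_in_R. ring.
Qed.

Lemma Rabs_series_le (a b : nat -> R) (la lb : R) :
  (forall n, Rabs (a n) <= b n) -> is_series a la -> is_series b lb -> Rabs la <= lb.
Proof.
  intros H Ha Hb. apply Rabs_le. split.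
  - apply (is_series_le (fun n => - b n) a); [|apply (is_series_opp (V := R_NormedModule) _ _ Hb)|exact Ha].
    intro n. specialize (H n). apply Rabs_le_between in H. lra.
  - apply (is_series_le a b); [|exact Ha|exact Hb].
    intro n. specialize (H n). apply Rabs_le_between in H. lra.
Qed.

(** Taylor's formula for cosine and sine at [n y] in each term; summing the cubic remainders gives
    the third moment. *)
Lemma log_re_im_taylor (x y : R) : 0 < x ->
  Rabs (log_re x y - log_moment 0 x + y ^ 2 / 2 * log_moment 2 x) <= Rabs y ^ 3 / 6 * log_moment 3 x /\
  Rabs (log_im x y - y * log_moment 1 x) <= Rabs y ^ 3 / 6 * log_moment 3 x.
Proof.
  intro Hx. destruct (log_re_im_series x y Hx) as [SA SB].
  assert (S := fun k => Series_correct _ (ex_series_log_moment k x Hx)).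
  assert (S3 := is_series_scal_l (K := R_AbsRing) (V := R_NormedModule) (Rabs y ^ 3 / 6) _ _ (S 3%nat)).
  assert (Hpos : forall n, 0 <= sig_coef n * exp (- x) ^ n)
    by (intro n; apply Rmult_le_pos; [apply sig_coef_ge0|apply pow_le; left; apply exp_pos]).
  assert (Eabs : forall n, Rabs (INR n * y) ^ 3 = INR n ^ 3 * Rabs y ^ 3).
  { intro n. rewrite Rabs_mult, Rpow_mult_distr, (Rabs_pos_eq (INR n)) by apply pos_INR. easy. }
  split.
  - assert (S2 := is_series_scal_l (K := R_AbsRing) (V := R_NormedModule) (y ^ 2 / 2) _ _ (S 2%nat)).
    assert (T := is_series_plus (V := R_NormedModule) _ _ _ _ (is_series_minus (V := R_NormedModule) _ _ _ _ SA (S 0%nat)) S2).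
    refine (Rabs_series_le _ _ _ _ _ T S3). intro n.
    change (Rabs ((sig_coef n * exp (- x) ^ n * cos (INR n * y) - sig_coef n * INR n ^ 0 * exp (- x) ^ n)
      + y ^ 2 / 2 * (sig_coef n * INR n ^ 2 * exp (- x) ^ n)) <= Rabs y ^ 3 / 6 * (sig_coef n * INR n ^ 3 * exp (- x) ^ n)).
    replace ((sig_coef n * exp (- x) ^ n * cos (INR n * y) - sig_coef n * INR n ^ 0 * exp (- x) ^ n)
      + y ^ 2 / 2 * (sig_coef n * INR n ^ 2 * exp (- x) ^ n)) with
      (sig_coef n * exp (- x) ^ n * (cos (INR n * y) - 1 + (INR n * y) ^ 2 / 2)) by (simpl; field).
    rewrite Rabs_mult, (Rabs_pos_eq _ (Hpos n)).
    replace (Rabs y ^ 3 / 6 * (sig_coef n * INR n ^ 3 * exp (- x) ^ n)) with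
      (sig_coef n * exp (- x) ^ n * (Rabs (INR n * y) ^ 3 / 6)) by (rewrite Eabs; field).
    apply Rmult_le_compat_l; [apply Hpos|apply trig_taylor_abs].
  - assert (S1 := is_series_scal_l (K := R_AbsRing) (V := R_NormedModule) y _ _ (S 1%nat)).
    assert (T := is_series_minus (V := R_NormedModule) _ _ _ _ SB S1).
    refine (Rabs_series_le _ _ _ _ _ T S3). intro n.
    change (Rabs (sig_coef n * exp (- x) ^ n * sin (INR n * y) - y * (sig_coef n * INR n ^ 1 * exp (- x) ^ n))
      <= Rabs y ^ 3 / 6 * (sig_coef n * INR n ^ 3 * exp (- x) ^ n)).
    replace (sig_coef n * exp (- x) ^ n * sin (INR n * y) - y * (sig_coef n * INR n ^ 1 * exp (- x) ^ n)) with
      (sig_coef n * exp (- x) ^ n * (sin (INR n * y) - INR n * y)) by ring.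
    rewrite Rabs_mult, (Rabs_pos_eq _ (Hpos n)).
    replace (Rabs y ^ 3 / 6 * (sig_coef n * INR n ^ 3 * exp (- x) ^ n)) with
      (sig_coef n * exp (- x) ^ n * (Rabs (INR n * y) ^ 3 / 6)) by (rewrite Eabs; field).
    apply Rmult_le_compat_l; [apply Hpos|apply trig_taylor_abs].
Qed.

(** * Decay of the modulus on the whole circle *)

Lemma Cseries_linear_rec (a b : nat -> C) (z la lb : C) :
  (forall n, a (S n) = z * a n + b n)%C -> Cseries a la -> Cseries b lb ->
  (la = a 0%nat + z * la + lb)%C.
Proof.
  intros E Ha Hb.
  assert (H1 : Cseries (fun n => a (S n)) (la - a 0%nat)%C).
  { apply (is_series_incr_1 (K := C_AbsRing) (V := C_NormedModule)).
    refine (eq_ind _ (fun l => is_series _ l) Ha _ _). eq_in_C. change (la = la - a 0%nat + a 0%nat)%C. ring. }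
  assert (H2 : Cseries (fun n => a (S n)) (z * la + lb)%C).
  { apply is_series_ext with (fun n => z * a n + b n)%C; [intro n; symmetry; apply E|].
    apply (is_series_plus (K := C_AbsRing) (V := C_NormedModule)); [|exact Hb].
    exact (is_series_scal_l (K := C_AbsRing) (V := C_NormedModule) z _ _ Ha). }
  pose proof (Cseries_unique _ _ _ H1 H2) as H.
  transitivity (a 0%nat + (la - a 0%nat))%C; [ring|]. rewrite H. ring.
Qed.

Lemma ex_series_INR_pow (q : R) : 0 <= q < 1 -> ex_series (fun n => INR n * q ^ n).
Proof.
  intro Hq. apply (ex_series_incr_1 (V := R_NormedModule)).
  apply ex_series_ext with (fun n => q * (INR (S n) * q ^ n)).
  - intro n. eq_in_R. rewrite <- tech_pow_Rmult. ring.
  - apply (ex_series_scal_l (K := R_AbsRing) (V := R_NormedModule)). now apply ex_series_pow_INR.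
Qed.

(** The series is the real part of [z / (1 - z)^2] at [z = q exp (i y)]. Its modulus is
    [q / |1 - z|^2], and the denominator in the bound is [|1 - z|^2]. Both geometric sums come from
    their linear recursions. *)
Lemma INR_pow_cos_sum (q y : R) : 0 <= q < 1 ->
  exists l, is_series (fun n => INR n * q ^ n * cos (INR n * y)) l /\
    l <= q / ((1 - q) ^ 2 + 2 * q * (1 - cos y)) /\
    (y = 0 -> l = q / (1 - q) ^ 2).
Proof.
  intro Hq. set (z := (RtoC q * cis y)%C).
  assert (Hz : Cmod z = q) by (unfold z; rewrite Cmod_mult, Cmod_cis, Cmod_R, Rabs_pos_eq; lra).
  assert (ga : ex_series (fun n => Cmod (pow_n (K := C_AbsRing) z n))).
  { apply ex_series_ext with (fun n => q ^ n); [intro n; now rewrite Cmod_pow_n, Hz|].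
    apply ex_series_geom. rewrite Rabs_pos_eq; lra. }
  destruct (Cseries_of_abs _ ga) as [G HG].
  set (b := fun n => (RtoC (INR n) * pow_n (K := C_AbsRing) z n)%C).
  assert (gb : ex_series (fun n => Cmod (b n))).
  { apply ex_series_ext with (fun n => INR n * q ^ n); [|now apply ex_series_INR_pow].
    intro n. unfold b. rewrite Cmod_mult, Cmod_pow_n, Hz, Cmod_R, Rabs_pos_eq; [easy|apply pos_INR]. }
  destruct (Cseries_of_abs _ gb) as [l Hl].
  assert (E1 : (G = RtoC 1 + z * G + RtoC 0)%C).
  { apply (Cseries_linear_rec (pow_n (K := C_AbsRing) z) (fun _ => RtoC 0) z G (RtoC 0)); [|exact HG|].
    - intro n. change (z * pow_n (K := C_AbsRing) z n = z * pow_n (K := C_AbsRing) z n + 0)%C. ring.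
    - apply Cseries_Re_Im. split; apply (is_series_finite (fun _ => 0) 0); easy. }
  assert (E2 : (l = RtoC 0 + z * l + z * G)%C).
  { assert (B0 : b 0%nat = RtoC 0) by (unfold b; simpl INR; apply Cmult_0_l).
    rewrite <- B0 at 1. apply (Cseries_linear_rec b (fun n => z * pow_n (K := C_AbsRing) z n)%C z l (z * G)%C).
    - intro n. unfold b. change (pow_n (K := C_AbsRing) z (S n)) with (z * pow_n (K := C_AbsRing) z n)%C.
      rewrite S_INR, RtoC_plus. ring.
    - exact Hl.
    - exact (is_series_scal_l (K := C_AbsRing) (V := C_NormedModule) z _ _ HG). }
  assert (E3 : ((1 - z) * (1 - z) * l = z)%C).
  { transitivity (z * ((1 - z) * G))%C.
    - transitivity ((1 - z) * (l - z * l))%C; [ring|]. rewrite E2 at 1. ring.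
    - assert (H : ((1 - z) * G = 1)%C) by (transitivity (G - z * G)%C; [ring|rewrite E1 at 1; ring]).
      rewrite H. ring. }
  assert (D : Cmod (1 - z)%C * Cmod (1 - z)%C = (1 - q) ^ 2 + 2 * q * (1 - cos y)).
  { unfold Cmod. rewrite sqrt_sqrt by (apply Rplus_le_le_0_compat; apply pow2_ge_0).
    unfold z, cis, RtoC; simpl. pose proof (sin2_cos2 y) as H. unfold Rsqr in H. nra. }
  assert (Dpos : 0 < (1 - q) ^ 2 + 2 * q * (1 - cos y)).
  { pose proof (COS_bound y). assert (0 < (1 - q) ^ 2) by (apply pow_lt; lra). nra. }
  exists (Re l). apply Cseries_Re_Im in Hl. destruct Hl as [Hl _]. split; [|split].
  - apply is_series_ext with (2 := Hl). intro n. unfold b, z. rewrite pow_n_cis. unfold cis, RtoC; simpl.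
    eq_in_R. ring.
  - apply Rle_trans with (Cmod l).
    + apply Rle_trans with (2 := re_le_Cmod l). apply Rle_abs.
    + apply Rle_div_r; [lra|]. rewrite <- D. apply (f_equal Cmod) in E3. rewrite !Cmod_mult, Hz in E3. lra.
  - intros ->. assert (Ez : z = RtoC q) by (unfold z; rewrite cis_0; apply Cmult_1_r).
    rewrite Ez in E3. apply (f_equal Re) in E3. destruct l as [u v]. unfold RtoC in E3. simpl in E3. simpl.
    assert (0 < (1 - q) ^ 2) by (apply pow_lt; lra).
    apply (Rmult_eq_reg_l ((1 - q) ^ 2)); [|lra]. transitivity q; [simpl; nra|]. field. lra.
Qed.

(** By [1 - cos y = 2 sin^2 (y/2)] and [sin u >= u / 3] on [[0, 2]]. *)
Lemma one_minus_cos_ge (y : R) : Rabs y <= PI -> y ^ 2 / 18 <= 1 - cos y.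
Proof.
  intro Hy. assert (H : forall u, 0 <= u <= 2 -> u / 3 <= sin u).
  { intros u Hu. destruct (trig_taylor u ltac:(lra)) as [_ [H _]]. apply Rabs_le_between in H.
    assert (u * (u * u) <= u * 4) by (apply Rmult_le_compat_l; nra). simpl in H. nra. }
  assert (E : forall u, 0 <= u <= PI -> u ^ 2 / 18 <= 1 - cos u).
  { intros u Hu. pose proof PI_4. specialize (H (u / 2) ltac:(lra)).
    replace u with (2 * (u / 2)) at 2 by field. rewrite cos_2a_sin. nra. }
  destruct (Rle_lt_dec 0 y) as [Hp|Hn].
  - apply E. rewrite Rabs_pos_eq in Hy; lra.
  - rewrite Rabs_left in Hy by easy. specialize (E (- y) ltac:(lra)). rewrite cos_neg in E.
    replace ((- y) ^ 2) with (y ^ 2) in E by ring. exact E.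
Qed.

(** Since [sig_coef n >= n], replacing the coefficients by [n] can only reduce the loss
    [L x - log_re x y], and for those the sum is explicit. For [x <= 1] one has [q >= 1/3], hence
    [2 q (1 - cos y) >= y^2 / 27]; the prefactor [q] brings 27 to 81. The bound is linear in [|t|],
    which already holds on the full circle because [x^2 |t| <= PI <= 4]. *)
Lemma log_re_decay (x t : R) : 0 < x <= 1 -> Rabs (x ^ 2 * t) <= PI ->
  log_re x (x ^ 2 * t) - log_moment 0 x <= (1 - Rabs t) / 81.
Proof.
  intros Hx Ht. set (y := x ^ 2 * t) in *.
  pose proof (exp_neg_01 x ltac:(lra)) as Hq. set (q := exp (- x)) in *.
  destruct (INR_pow_cos_sum q y ltac:(lra)) as [l [Hl [Bl _]]].
  destruct (INR_pow_cos_sum q 0 ltac:(lra)) as [l0 [Hl0 [_ B0]]]. specialize (B0 eq_refl).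
  destruct (log_re_im_series x y ltac:(lra)) as [SA _]. fold q in SA.
  pose proof (Series_correct _ (ex_series_log_moment 0 x ltac:(lra))) as S0. fold (log_moment 0 x) q in S0.
  assert (H1 : l0 - l <= log_moment 0 x - log_re x y).
  { apply (is_series_le (fun n => INR n * q ^ n * cos (INR n * 0) - INR n * q ^ n * cos (INR n * y))
             (fun n => sig_coef n * INR n ^ 0 * q ^ n - sig_coef n * q ^ n * cos (INR n * y))).
    - intro n. rewrite Rmult_0_r, cos_0.
      pose proof (COS_bound (INR n * y)). pose proof (sig_coef_ge n).
      assert (0 <= q ^ n) by (apply pow_le; lra).
      assert (0 <= (sig_coef n - INR n) * (q ^ n * (1 - cos (INR n * y)))) by
        (apply Rmult_le_pos; [lra|apply Rmult_le_pos; lra]).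
      simpl. lra.
    - exact (is_series_minus (V := R_NormedModule) _ _ _ _ Hl0 Hl).
    - exact (is_series_minus (V := R_NormedModule) _ _ _ _ S0 SA). }
  assert (Q3 : 1 / 3 <= q).
  { unfold q. rewrite exp_Ropp. replace (1 / 3) with (/ 3) by lra. apply Rinv_le_contravar; [apply exp_pos|].
    apply Rle_trans with (exp 1); [apply exp_le_compat; lra|apply exp_le_3]. }
  assert (Qx : 1 - q <= x) by (pose proof (exp_ineq1_le (- x)); unfold q; lra).
  pose proof (one_minus_cos_ge y Ht) as Cy.
  set (w := 2 * q * (1 - cos y)) in *.
  assert (Hw : y ^ 2 / 27 <= w) by (unfold w; nra).
  pose proof (pow2_ge_0 y) as Y2.
  assert (X2 : 0 < x ^ 2) by (apply pow_lt; lra).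
  assert (D2 : 0 < (1 - q) ^ 2 <= x ^ 2) by (split; [apply pow_lt; lra|apply pow_incr; lra]).
  assert (Aty : Rabs y = x ^ 2 * Rabs t) by (unfold y; rewrite Rabs_mult, (Rabs_pos_eq (x ^ 2)); lra).
  pose proof (Rabs_pos t) as At. pose proof PI_4 as P4.
  assert (H2 : (Rabs t - 1) / 81 <= q / (1 - q) ^ 2 - q / ((1 - q) ^ 2 + w)).
  { set (d := (1 - q) ^ 2) in *.
    assert (W1 : (Rabs t - 1) / 27 <= w / (d * (d + w))).
    { apply (proj1 (Rle_div_r _ _ (d * (d + w)) ltac:(apply Rmult_lt_0_compat; lra))).
      destruct (Rle_lt_dec (Rabs t) 1) as [T1|T1]; [assert (0 <= d * (d + w)) by (apply Rmult_le_pos; lra); nra|].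
      set (X := x ^ 2) in *. set (T := Rabs t) in *.
      assert (Yt : y ^ 2 = X ^ 2 * T ^ 2) by (rewrite <- pow2_abs, Aty; ring).
      rewrite Yt in Hw.
      apply Rle_trans with ((T - 1) / 27 * (X * (X + w))).
      - apply Rmult_le_compat_l; [lra|]. apply Rmult_le_compat; lra.
      - assert (XT : X * T <= 4) by lra.
        assert (P1 : (T - 1) * X * 4 <= 16) by nra.
        assert (P2 : (T - 1) * X * w <= 4 * w) by (apply Rmult_le_compat_r; nra).
        assert (P3 : (T - 1) * X ^ 2 <= X ^ 2 * T ^ 2) by (rewrite Rmult_comm; apply Rmult_le_compat_l; nra).
        simpl in *. nra. }
    replace (q / d - q / (d + w)) with (q * (w / (d * (d + w)))) by (field; lra).
    assert (0 <= w / (d * (d + w))) by (apply Rdiv_le_0_compat; [lra|apply Rmult_lt_0_compat; lra]).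
    nra. }
  lra.
Qed.

(** * The Cauchy integral at the saddle point *)

Definition step_factor (h : nat) (x y : R) : C :=
  (RtoC 1 - Cexp (- (INR h * x), INR h * y)%R)%C.

(** The integrand [P(q) q^(-nu) (1 - q^h)^r] at [q = exp (- x + i y)], where [P] is the generating
    function. *)
Definition pp_kernel (h r : nat) (nu x y : R) : C :=
  (Cexp (log_re x y + nu * x, log_im x y - nu * y)%R *
   pow_n (K := C_AbsRing) (step_factor h x y) r)%C.

(** Shifting the index by [h] multiplies the integrand by [q^h], so each backward difference
    contributes one factor [1 - q^h]. *)
Lemma pp_kernel_diff (h r n : nat) (x y : R) : (h <= n)%nat ->
  (pp_kernel h r (INR n) x y - pp_kernel h r (INR (n - h)) x y =
   pp_kernel h (S r) (INR n) x y)%C.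
Proof.
  intro Hn. unfold pp_kernel.
  change (pow_n (K := C_AbsRing) (step_factor h x y) (S r)) with
    (step_factor h x y * pow_n (K := C_AbsRing) (step_factor h x y) r)%C.
  assert (E : Cexp (log_re x y + INR (n - h) * x, log_im x y - INR (n - h) * y)%R =
    (Cexp (log_re x y + INR n * x, log_im x y - INR n * y)%R * Cexp (- (INR h * x), INR h * y)%R)%C).
  { rewrite <- Cexp_plus. f_equal. unfold Cplus; simpl. rewrite minus_INR by easy. f_equal; ring. }
  rewrite E. unfold step_factor. ring.
Qed.

(** Coefficient extraction on the circle of radius [exp (- x)]; the integrand is the real part of
    [P(q) q^(-n)], put in closed form by [pp_complex_gf]. *)
Lemma is_RInt_pp (n : nat) (x : R) : 0 < x ->
  is_RInt (fun y => exp (log_re x y + INR n * x) * cos (log_im x y - INR n * y)) (- PI) PI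
    (2 * PI * INR (pp n)).
Proof.
  intro Hx. pose proof (exp_neg_01 x Hx) as Hq. set (q := exp (- x)) in *.
  set (al := fun m => INR (pp m) * q ^ m).
  assert (Ha : ex_series (fun m => Rabs (al m))).
  { apply ex_series_ext with al; [|apply ex_series_pp; lra].
    intro m. symmetry. apply Rabs_pos_eq, Rmult_le_pos; [apply pos_INR|apply pow_le; lra]. }
  assert (Hb : ex_series (fun m : nat => Rabs ((fun _ => 0) m))).
  { apply ex_series_ext with (fun _ => 0); [intros _; symmetry; apply Rabs_R0|].
    exists 0. apply (is_series_finite (fun _ => 0) 0). easy. }
  assert (H := is_RInt_scal (V := R_NormedModule) _ _ _ (exp (INR n * x)) _ (is_RInt_fourier al (fun _ => 0) n Ha Hb)).
  refine (eq_ind _ (fun l => is_RInt _ _ _ l) (is_RInt_ext _ _ _ _ _ _ H) _ _).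
  2:{ change (exp (INR n * x) * (2 * PI * al n) = 2 * PI * INR (pp n)).
      unfold al, q. rewrite exp_pow. replace (INR n * - x) with (- (INR n * x)) by ring.
      rewrite exp_Ropp. field. apply Rgt_not_eq, exp_pos. }
  intros y _. change (exp (INR n * x) *
    Series (fun m => al m * cos ((INR m - INR n) * y) + 0 * sin ((INR m - INR n) * y)) =
    exp (log_re x y + INR n * x) * cos (log_im x y - INR n * y)).
  destruct (pp_complex_gf y q ltac:(lra)) as [G1 G2].
  assert (P1 := Series_correct _ (ex_series_cos_coef (fun n => INR (pp n)) y q ltac:(intro; apply pos_INR) ltac:(lra) (ex_series_pp q ltac:(lra)))).
  assert (P2 := Series_correct _ (ex_series_sin_coef (fun n => INR (pp n)) y q ltac:(intro; apply pos_INR) ltac:(lra) (ex_series_pp q ltac:(lra)))).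
  change (Series (fun n0 => cos_coef (fun n => INR (pp n)) y n0 * q ^ n0)) with
    (PSeries (cos_coef (fun n => INR (pp n)) y) q) in P1.
  change (Series (fun n0 => sin_coef (fun n => INR (pp n)) y n0 * q ^ n0)) with
    (PSeries (sin_coef (fun n => INR (pp n)) y) q) in P2.
  rewrite G1 in P1. rewrite G2 in P2. fold (log_re x y) (log_im x y) in P1, P2.
  assert (S1 := is_series_scal_l (K := R_AbsRing) (V := R_NormedModule) (cos (INR n * y)) _ _ P1).
  assert (S2 := is_series_scal_l (K := R_AbsRing) (V := R_NormedModule) (sin (INR n * y)) _ _ P2).
  assert (S := is_series_plus (V := R_NormedModule) _ _ _ _ S1 S2).
  apply is_series_unique in S.
  rewrite (Series_ext _ (fun m => cos (INR n * y) * (cos_coef (fun n => INR (pp n)) y m * q ^ m) +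
     sin (INR n * y) * (sin_coef (fun n => INR (pp n)) y m * q ^ m))).
  - apply (f_equal (Rmult (exp (INR n * x)))) in S. refine (eq_trans S _).
    change (exp (INR n * x) * (cos (INR n * y) * (exp (log_re x y) * cos (log_im x y)) +
      sin (INR n * y) * (exp (log_re x y) * sin (log_im x y))) =
      exp (log_re x y + INR n * x) * cos (log_im x y - INR n * y)).
    rewrite exp_plus, cos_minus. ring.
  - intro m. unfold cos_coef, sin_coef, al. rewrite Rmult_minus_distr_r, cos_minus. ring.
Qed.

Lemma is_RInt_bdiff_pp (h r n : nat) (x : R) : 0 < x -> (h * r <= n)%nat ->
  is_RInt (fun y => Re (pp_kernel h r (INR n) x y)) (- PI) PI
    (2 * PI * bdiff h r (fun n => INR (pp n)) n).
Proof.
  intro Hx. revert n. induction r as [|r IH]; intros n Hn.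
  - apply is_RInt_ext with (2 := is_RInt_pp n x Hx). intros y _. eq_in_R.
    unfold pp_kernel, Cexp. simpl. ring.
  - assert (H1 := IH n ltac:(nia)). assert (H2 := IH (n - h)%nat ltac:(nia)).
    assert (H := is_RInt_minus (V := R_NormedModule) _ _ _ _ _ _ H1 H2).
    refine (eq_ind _ (fun l => is_RInt _ _ _ l) (is_RInt_ext _ _ _ _ _ _ H) _ _).
    + intros y _. rewrite <- (pp_kernel_diff h r n) by nia. easy.
    + cbn [bdiff]. unfold bdiff1.
      change (2 * PI * bdiff h r (fun n => INR (pp n)) n - 2 * PI * bdiff h r (fun n => INR (pp n)) (n - h)%nat
       = 2 * PI * (bdiff h r (fun n => INR (pp n)) n - bdiff h r (fun n => INR (pp n)) (n - h)%nat)).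
      ring.
Qed.

(** The filter of [x] tending to 0 from the right, uniformly in [|t| <= T]. Encoding uniformity as a
    filter on pairs lets limits be multiplied and composed as usual. *)
Definition strip (T : R) (P : R * R -> Prop) : Prop :=
  exists del, 0 < del /\ forall x t, 0 < x < del -> Rabs t <= T -> P (x, t).

Global Instance strip_filter (T : R) : Filter (strip T).
Proof.
  constructor.
  - exists 1. split; [lra|easy].
  - intros P Q [d [Hd HP]] [d' [Hd' HQ]]. exists (Rmin d d'). split; [now apply Rmin_pos|].
    intros x t Hx Ht. pose proof (Rmin_l d d'). pose proof (Rmin_r d d').
    split; [apply HP|apply HQ]; lra.
  - intros P Q H [d [Hd HP]]. exists d. split; [easy|]. intros x t Hx Ht. apply H. now apply HP.
Qed.

Lemma filterlim_strip (T : R) (f : R * R -> R) (l : R) :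
  (forall eps, 0 < eps -> exists del, 0 < del /\
     forall x t, 0 < x < del -> Rabs t <= T -> Rabs (f (x, t) - l) <= eps) ->
  filterlim f (strip T) (locally l).
Proof.
  intro H. apply (filterlim_locally (U := R_UniformSpace)). intro eps.
  destruct (H (pos_div_2 eps) (cond_pos _)) as [d [Hd B]].
  exists d. split; [easy|]. intros x t Hx Ht. specialize (B x t Hx Ht).
  change (Rabs (f (x, t) - l) < eps). simpl in B. pose proof (cond_pos eps). lra.
Qed.

Lemma filterlim_strip_linear (T C d : R) (f : R * R -> R) (l : R) : 0 <= C -> 0 < d ->
  (forall x t, 0 < x < d -> Rabs t <= T -> Rabs (f (x, t) - l) <= C * x) ->
  filterlim f (strip T) (locally l).
Proof.
  intros HC Hd H. apply filterlim_strip. intros eps Heps.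
  assert (Hp : 0 < eps / (C + 1)) by (apply Rdiv_lt_0_compat; lra).
  exists (Rmin d (eps / (C + 1))). split; [now apply Rmin_pos|].
  intros x t Hx Ht. pose proof (Rmin_l d (eps / (C + 1))). pose proof (Rmin_r d (eps / (C + 1))).
  apply Rle_trans with (1 := H x t ltac:(lra) Ht).
  apply Rle_trans with ((C + 1) * (eps / (C + 1))); [nra|]. right. field. lra.
Qed.

Definition tends_1 (T : R) (f : R * R -> C) : Prop :=
  filterlim (fun p => Re (f p)) (strip T) (locally 1) /\
  filterlim (fun p => Im (f p)) (strip T) (locally 0).

Lemma filterlim_strip_mult (T : R) (f g : R * R -> R) (a b : R) :
  filterlim f (strip T) (locally a) -> filterlim g (strip T) (locally b) ->
  filterlim (fun p => f p * g p) (strip T) (locally (a * b)).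
Proof.
  intros Hf Hg. exact (filterlim_comp_2 f g Rmult Hf Hg (filterlim_mult (K := R_AbsRing) a b)).
Qed.

Lemma filterlim_strip_plus (T : R) (f g : R * R -> R) (a b : R) :
  filterlim f (strip T) (locally a) -> filterlim g (strip T) (locally b) ->
  filterlim (fun p => f p + g p) (strip T) (locally (a + b)).
Proof.
  intros Hf Hg. exact (filterlim_comp_2 f g Rplus Hf Hg (filterlim_plus (V := R_NormedModule) a b)).
Qed.

Lemma tends_1_mult (T : R) (f g : R * R -> C) :
  tends_1 T f -> tends_1 T g -> tends_1 T (fun p => f p * g p)%C.
Proof.
  intros [Hf1 Hf2] [Hg1 Hg2]. split.
  - replace 1 with (1 * 1 + (-1) * (0 * 0)) by ring.
    apply filterlim_ext with (fun p => Re (f p) * Re (g p) + (-1) * (Im (f p) * Im (g p))).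
    { intro p. unfold Re, Im, Cmult; simpl. ring. }
    apply filterlim_strip_plus; [now apply filterlim_strip_mult|].
    apply filterlim_strip_mult; [apply filterlim_const|now apply filterlim_strip_mult].
  - replace 0 with (1 * 0 + 0 * 1) by ring.
    apply filterlim_ext with (fun p => Re (f p) * Im (g p) + Im (f p) * Re (g p)).
    { intro p. unfold Re, Im, Cmult; simpl. ring. }
    apply filterlim_strip_plus; now apply filterlim_strip_mult.
Qed.

Lemma tends_1_pow (T : R) (f : R * R -> C) (r : nat) :
  tends_1 T f -> tends_1 T (fun p => pow_n (K := C_AbsRing) (f p) r).
Proof.
  intro Hf. induction r as [|r IH].
  - split; [exact (filterlim_const (T := R * R) (U := R_UniformSpace) (F := strip T) 1)|
      exact (filterlim_const (T := R * R) (U := R_UniformSpace) (F := strip T) 0)].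
  - apply (tends_1_mult T f _ Hf IH).
Qed.

Lemma tends_1_Cexp (T : R) (u v : R * R -> R) :
  filterlim u (strip T) (locally 0) -> filterlim v (strip T) (locally 0) ->
  tends_1 T (fun p => Cexp (u p, v p)).
Proof.
  intros Hu Hv.
  assert (E : filterlim (fun p => exp (u p)) (strip T) (locally 1)).
  { rewrite <- exp_0. apply (filterlim_comp _ _ _ u exp _ (locally 0)); [exact Hu|].
    apply (ex_derive_continuous exp 0). auto_derive; easy. }
  assert (Co : filterlim (fun p => cos (v p)) (strip T) (locally 1)).
  { rewrite <- cos_0. apply (filterlim_comp _ _ _ v cos _ (locally 0)); [exact Hv|].
    apply (ex_derive_continuous cos 0). auto_derive; easy. }
  assert (Si : filterlim (fun p => sin (v p)) (strip T) (locally 0)).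
  { rewrite <- sin_0 at 1. apply (filterlim_comp _ _ _ v sin _ (locally 0)); [exact Hv|].
    apply (ex_derive_continuous sin 0). auto_derive; easy. }
  split; simpl.
  - replace 1 with (1 * 1) by ring. now apply filterlim_strip_mult.
  - replace 0 with (1 * 0) by ring. now apply filterlim_strip_mult.
Qed.

Lemma one_minus_exp_bounds (s : R) : 0 < s -> s - s ^ 2 <= 1 - exp (- s) <= s.
Proof.
  intro Hs. split; [|pose proof (exp_ineq1_le (- s)); lra].
  rewrite exp_Ropp. pose proof (exp_ineq1_le s).
  assert (/ exp s <= / (1 + s)) by (apply Rinv_le_contravar; lra).
  assert (/ (1 + s) <= 1 - s + s ^ 2); [|lra].
  apply (Rmult_le_reg_l (1 + s)); [lra|]. rewrite Rinv_r by lra.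
  assert (0 < s ^ 3) by now apply pow_lt. replace ((1 + s) * (1 - s + s ^ 2)) with (1 + s ^ 3) by ring. lra.
Qed.

(** The factor [1 - q^h] at the angle [y = x^2 t], normalised by its size [h x]. *)
Definition unit_step (h : nat) (p : R * R) : C :=
  (RtoC (/ (INR h * fst p)) * step_factor h (fst p) (fst p ^ 2 * snd p))%C.

(** The angle [h x^2 t] is of smaller order than [h x], so on bounded [t] the differencing factor
    behaves as on the real axis. *)
Lemma unit_step_tends_1 (h : nat) (T : R) : (1 <= h)%nat -> tends_1 T (unit_step h).
Proof.
  intro Hh. assert (H1 : 1 <= INR h) by (apply (le_INR 1); exact Hh).
  assert (R0 := Rabs_pos T). pose proof (Rle_abs T) as AT.
  split.
  - apply filterlim_strip_linear with (C := INR h + Rabs T) (d := 1); [lra|lra|].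
    intros x t Hx Ht. unfold unit_step, step_factor, Cexp; simpl.
    set (s := INR h * x). set (g := INR h * (x * (x * 1) * t)).
    assert (Hs : 0 < s) by (apply Rmult_lt_0_compat; lra).
    pose proof (one_minus_exp_bounds s Hs) as B. pose proof (exp_neg_01 s Hs) as B0.
    destruct (trig_taylor_abs g) as [_ [_ [G _]]].
    assert (Hg : Rabs g <= s * (x * Rabs T)).
    { unfold g, s. rewrite !Rabs_mult, Rabs_R1, (Rabs_pos_eq (INR h)), (Rabs_pos_eq x) by lra.
      replace (INR h * (x * (x * 1) * Rabs t)) with (INR h * x * (x * Rabs t)) by ring.
      apply Rmult_le_compat_l; [fold s; lra|]. apply Rmult_le_compat_l; lra. }
    match goal with |- Rabs ?e <= _ => replace e with
      ((1 - exp (- s) - s + exp (- s) * (1 - cos g)) / s) by (field; lra) end.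
    unfold Rdiv. rewrite Rabs_mult, (Rabs_pos_eq (/ s)) by (left; now apply Rinv_0_lt_compat).
    apply (Rmult_le_reg_r s); [easy|]. rewrite Rmult_assoc, Rinv_l, Rmult_1_r by lra.
    apply Rle_trans with (1 := Rabs_triang _ _). rewrite Rabs_mult, (Rabs_pos_eq (exp (- s))) by lra.
    replace ((INR h + Rabs T) * x * s) with (s ^ 2 + s * (x * Rabs T)) by (unfold s; ring).
    apply Rplus_le_compat; [apply Rabs_le; simpl in *; lra|].
    pose proof (Rabs_pos (1 - cos g)). nra.
  - apply filterlim_strip_linear with (C := 2 * Rabs T) (d := 1); [lra|lra|].
    intros x t Hx Ht. unfold unit_step, step_factor, Cexp; simpl.
    set (s := INR h * x). set (g := INR h * (x * (x * 1) * t)).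
    assert (Hs : 0 < s) by (apply Rmult_lt_0_compat; lra).
    pose proof (exp_neg_01 s Hs) as B0.
    destruct (trig_taylor_abs g) as [_ [_ [_ G]]].
    assert (Hg : Rabs g <= s * (x * Rabs T)).
    { unfold g, s. rewrite !Rabs_mult, Rabs_R1, (Rabs_pos_eq (INR h)), (Rabs_pos_eq x) by lra.
      replace (INR h * (x * (x * 1) * Rabs t)) with (INR h * x * (x * Rabs t)) by ring.
      apply Rmult_le_compat_l; [fold s; lra|]. apply Rmult_le_compat_l; lra. }
    match goal with |- Rabs ?e <= _ => replace e with (- ((exp (- s) * sin g) / s)) by (field; lra) end.
    rewrite Rabs_Ropp. unfold Rdiv. rewrite Rabs_mult, (Rabs_pos_eq (/ s)) by (left; now apply Rinv_0_lt_compat).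
    apply (Rmult_le_reg_r s); [easy|]. rewrite Rmult_assoc, Rinv_l, Rmult_1_r by lra.
    rewrite Rabs_mult, (Rabs_pos_eq (exp (- s))) by lra.
    pose proof (Rabs_pos (sin g)). nra.
Qed.

Lemma step_factor_bound (h : nat) (x y : R) : 0 < x -> (1 <= h)%nat ->
  Cmod (step_factor h x y) <= INR h * x + 3 * (INR h * Rabs y).
Proof.
  intros Hx Hh. assert (H1 : 1 <= INR h) by (apply (le_INR 1); exact Hh).
  assert (Hs : 0 < INR h * x) by (apply Rmult_lt_0_compat; lra).
  pose proof (one_minus_exp_bounds _ Hs) as B. pose proof (exp_neg_01 _ Hs) as B0.
  destruct (trig_taylor_abs (INR h * y)) as [_ [_ [G1 G2]]].
  rewrite Rabs_mult, (Rabs_pos_eq (INR h)) in G1, G2 by lra.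
  apply Rle_trans with (1 := Cmod_le_Re_Im _). unfold step_factor, Cexp; simpl.
  set (e := exp (- (INR h * x))) in *. set (g := INR h * y) in *.
  replace (1 + - (e * cos g)) with ((1 - e) + e * (1 - cos g)) by ring.
  replace (0 + - (e * sin g)) with (- (e * sin g)) by ring.
  rewrite Rabs_Ropp. pose proof (Rabs_triang (1 - e) (e * (1 - cos g))) as Tr.
  rewrite Rabs_mult, (Rabs_pos_eq e), (Rabs_pos_eq (1 - e)) in Tr by lra.
  rewrite Rabs_mult, (Rabs_pos_eq e) by lra.
  pose proof (Rabs_pos (1 - cos g)). pose proof (Rabs_pos (sin g)).
  assert (e * Rabs (1 - cos g) <= INR h * Rabs y) by nra.
  assert (e * Rabs (sin g) <= INR h * Rabs y + INR h * Rabs y) by nra. lra.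
Qed.

Lemma pow_n_scal (a : R) (w : C) (r : nat) :
  pow_n (K := C_AbsRing) (RtoC a * w)%C r = (RtoC (a ^ r) * pow_n (K := C_AbsRing) w r)%C.
Proof.
  induction r as [|r IH]; [symmetry; apply Cmult_1_l|].
  change (pow_n (K := C_AbsRing) (RtoC a * w)%C (S r)) with ((RtoC a * w) * pow_n (K := C_AbsRing) (RtoC a * w)%C r)%C.
  change (pow_n (K := C_AbsRing) w (S r)) with (w * pow_n (K := C_AbsRing) w r)%C.
  rewrite IH. simpl pow. rewrite RtoC_mult. eq_in_C. ring.
Qed.

(** * The normalised integrand and its limit *)

(** What remains of the exponent after removing its value at [t = 0] and the Gaussian. Likewise
    [saddle_im] is the phase left once the frequency [nu = 2 zeta(3) / x^3] cancels the leading
    linear term. *)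
Definition saddle_re (x t : R) : R :=
  log_re x (x ^ 2 * t) - log_moment 0 x + 3 * inv_cube_sum * t ^ 2.
Definition saddle_im (x t : R) : R :=
  log_im x (x ^ 2 * t) - 2 * inv_cube_sum / x ^ 3 * (x ^ 2 * t).

Definition saddle_kernel (h r : nat) (x t : R) : R :=
  exp (- (3 * inv_cube_sum * t ^ 2)) *
  Re (Cexp (saddle_re x t, saddle_im x t) * pow_n (K := C_AbsRing) (unit_step h (x, t)) r)%C.

Lemma pp_kernel_saddle (h r : nat) (nu x t : R) : 0 < x -> (1 <= h)%nat ->
  nu = 2 * inv_cube_sum / x ^ 3 ->
  Re (pp_kernel h r nu x (x ^ 2 * t)) =
  exp (log_moment 0 x + nu * x) * (INR h * x) ^ r * saddle_kernel h r x t.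
Proof.
  intros Hx Hh Hnu. assert (H1 : 1 <= INR h) by (apply (le_INR 1); exact Hh).
  assert (Hs : 0 < INR h * x) by (apply Rmult_lt_0_compat; lra).
  unfold pp_kernel, saddle_kernel.
  assert (E : step_factor h x (x ^ 2 * t) = (RtoC (INR h * x) * unit_step h (x, t))%C).
  { unfold unit_step. cbn [fst snd]. rewrite Cmult_assoc, <- RtoC_mult, Rinv_r by lra. symmetry. apply Cmult_1_l. }
  rewrite E, pow_n_scal.
  assert (E2 : Cexp (log_re x (x ^ 2 * t) + nu * x, log_im x (x ^ 2 * t) - nu * (x ^ 2 * t))%R =
    (RtoC (exp (log_moment 0 x + nu * x) * exp (- (3 * inv_cube_sum * t ^ 2))) *
     Cexp (saddle_re x t, saddle_im x t))%C).
  { rewrite <- exp_plus. unfold Cexp, Cmult, RtoC, saddle_re, saddle_im. rewrite <- Hnu. simpl.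
    match goal with |- (exp ?a * ?c, _) = (exp ?b * (exp ?d * _) - _, _) => replace a with (b + d) by ring end.
    rewrite exp_plus. f_equal; ring. }
  rewrite E2. set (p := pow_n (K := C_AbsRing) (unit_step h (x, t)) r). unfold RtoC.
  generalize (Cexp (saddle_re x t, saddle_im x t)) p. intros [a b] [c d]. simpl. ring.
Qed.

(** With [y = x^2 t], the Taylor remainder is of order [x^6 * x^(-5) = x]. The real part then needs
    the second moment up to [o(x^(-4))], and the phase needs the first moment up to [o(x^(-2))]. *)
Lemma saddle_re_im_tends_0 (T : R) : 0 < T ->
  filterlim (fun p => saddle_re (fst p) (snd p)) (strip T) (locally 0) /\
  filterlim (fun p => saddle_im (fst p) (snd p)) (strip T) (locally 0).
Proof.
  intro HT. destruct log_moment_3_bound as [C [d3 [HC [Hd3 B3]]]].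
  assert (HT3 : 0 < T ^ 3) by now apply pow_lt.
  assert (HT2 : 0 < T ^ 2) by now apply pow_lt.
  set (K := T ^ 3 / 6 * C).
  assert (HK : 0 < K) by (unfold K; apply Rmult_lt_0_compat; lra).
  assert (R3 : forall x t, 0 < x < d3 -> Rabs t <= T -> Rabs (x ^ 2 * t) ^ 3 / 6 * log_moment 3 x <= K * x).
  { intros x t Hx Ht. rewrite Rabs_mult, (Rabs_pos_eq (x ^ 2)) by (apply pow_le; lra).
    replace ((x ^ 2 * Rabs t) ^ 3 / 6 * log_moment 3 x) with (Rabs t ^ 3 / 6 * (x ^ 5 * log_moment 3 x) * x) by (simpl; field).
    apply Rmult_le_compat_r; [lra|]. unfold K. apply Rmult_le_compat.
    - apply Rmult_le_pos; [apply pow_le, Rabs_pos|lra].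
    - apply Rmult_le_pos; [apply pow_le; lra|apply log_moment_ge0; lra].
    - apply Rmult_le_compat_r; [lra|]. apply pow_incr. split; [apply Rabs_pos|easy].
    - now apply B3. }
  split; apply filterlim_strip; intros eps Heps.
  - destruct (log_moment_2_lim (eps / T ^ 2)) as [d2 [Hd2 B2]]; [now apply Rdiv_lt_0_compat|].
    assert (HeK : 0 < eps / (2 * K)) by (apply Rdiv_lt_0_compat; lra).
    exists (Rmin (Rmin d2 d3) (eps / (2 * K))). split; [repeat apply Rmin_pos; lra|].
    intros x t Hx Ht. cbn [fst snd].
    pose proof (Rmin_l (Rmin d2 d3) (eps / (2 * K))) as M1. pose proof (Rmin_r (Rmin d2 d3) (eps / (2 * K))) as M2.
    pose proof (Rmin_l d2 d3) as M3. pose proof (Rmin_r d2 d3) as M4.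
    specialize (B2 x ltac:(lra)). specialize (R3 x t ltac:(lra) Ht).
    destruct (log_re_im_taylor x (x ^ 2 * t) ltac:(lra)) as [E _].
    unfold saddle_re.
    replace (log_re x (x ^ 2 * t) - log_moment 0 x + 3 * inv_cube_sum * t ^ 2 - 0) with
      ((log_re x (x ^ 2 * t) - log_moment 0 x + (x ^ 2 * t) ^ 2 / 2 * log_moment 2 x)
       - t ^ 2 / 2 * (x ^ 4 * log_moment 2 x - 6 * inv_cube_sum)) by (simpl; field).
    apply Rle_trans with (1 := Rabs_triang _ _). rewrite Rabs_Ropp, Rabs_mult.
    assert (T2 : Rabs (t ^ 2 / 2) <= T ^ 2 / 2).
    { rewrite Rabs_pos_eq by (pose proof (pow2_ge_0 t); lra). rewrite <- (pow2_abs t).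
      assert (Rabs t ^ 2 <= T ^ 2) by (apply pow_incr; split; [apply Rabs_pos|easy]). lra. }
    assert (F : Rabs (t ^ 2 / 2) * Rabs (x ^ 4 * log_moment 2 x - 6 * inv_cube_sum) <= T ^ 2 / 2 * (eps / T ^ 2))
      by (apply Rmult_le_compat; [apply Rabs_pos|apply Rabs_pos|easy|easy]).
    replace (T ^ 2 / 2 * (eps / T ^ 2)) with (eps / 2) in F by (field; lra).
    assert (G : K * x <= K * (eps / (2 * K))) by (apply Rmult_le_compat_l; lra).
    replace (K * (eps / (2 * K))) with (eps / 2) in G by (field; lra). lra.
  - destruct (log_moment_1_lim (eps / (2 * T))) as [d1 [Hd1 B1]]; [apply Rdiv_lt_0_compat; lra|].
    assert (HeK : 0 < eps / (2 * K)) by (apply Rdiv_lt_0_compat; lra).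
    exists (Rmin (Rmin d1 d3) (eps / (2 * K))). split; [repeat apply Rmin_pos; lra|].
    intros x t Hx Ht. cbn [fst snd].
    pose proof (Rmin_l (Rmin d1 d3) (eps / (2 * K))) as M1. pose proof (Rmin_r (Rmin d1 d3) (eps / (2 * K))) as M2.
    pose proof (Rmin_l d1 d3) as M3. pose proof (Rmin_r d1 d3) as M4.
    specialize (B1 x ltac:(lra)). specialize (R3 x t ltac:(lra) Ht).
    destruct (log_re_im_taylor x (x ^ 2 * t) ltac:(lra)) as [_ E].
    unfold saddle_im.
    replace (log_im x (x ^ 2 * t) - 2 * inv_cube_sum / x ^ 3 * (x ^ 2 * t) - 0) with
      ((log_im x (x ^ 2 * t) - x ^ 2 * t * log_moment 1 x)
       + t * (x ^ 2 * (log_moment 1 x - 2 * inv_cube_sum / x ^ 3))) by (field; lra).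
    apply Rle_trans with (1 := Rabs_triang _ _). rewrite (Rabs_mult t).
    assert (F : Rabs t * Rabs (x ^ 2 * (log_moment 1 x - 2 * inv_cube_sum / x ^ 3)) <= T * (eps / (2 * T)))
      by (apply Rmult_le_compat; [apply Rabs_pos|apply Rabs_pos|easy|easy]).
    replace (T * (eps / (2 * T))) with (eps / 2) in F by (field; lra).
    assert (G : K * x <= K * (eps / (2 * K))) by (apply Rmult_le_compat_l; lra).
    replace (K * (eps / (2 * K))) with (eps / 2) in G by (field; lra). lra.
Qed.

Lemma saddle_kernel_lim (h r : nat) (T eps : R) : (1 <= h)%nat -> 0 < T -> 0 < eps ->
  exists del, 0 < del /\ forall x t, 0 < x < del -> Rabs t <= T ->
    Rabs (saddle_kernel h r x t - exp (- (3 * inv_cube_sum * t ^ 2))) <= eps.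
Proof.
  intros Hh HT Heps. destruct (saddle_re_im_tends_0 T HT) as [U V].
  assert (H := tends_1_mult T _ _ (tends_1_Cexp T _ _ U V) (tends_1_pow T _ r (unit_step_tends_1 h T Hh))).
  destruct H as [H _].
  destruct (proj1 (filterlim_locally (U := R_UniformSpace) _ _) H (mkposreal eps Heps)) as [d [Hd B]].
  exists d. split; [easy|]. intros x t Hx Ht. specialize (B x t Hx Ht). unfold saddle_kernel.
  match type of B with ball _ _ ?e => change (Rabs (e - 1) < eps) in B end. cbn [fst snd] in B.
  match type of B with Rabs (?e - 1) < eps => set (c := e) in * end.
  set (g := exp (- (3 * inv_cube_sum * t ^ 2))).
  replace (g * c - g) with (g * (c - 1)) by ring.
  assert (Hg : 0 < g <= 1).
  { split; [apply exp_pos|]. unfold g. rewrite <- exp_0. apply exp_le_compat.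
    pose proof inv_cube_sum_pos. pose proof (pow2_ge_0 t). nra. }
  rewrite Rabs_mult, (Rabs_pos_eq g) by lra. pose proof (Rabs_pos (c - 1)). nra.
Qed.

(** The Gaussian cancels against [saddle_re], leaving the decay [exp (- |t| / 81)] of
    [log_re_decay]. Half of it absorbs the polynomial growth [(1 + 3 |t|)^r] of the differencing
    factors. *)
Lemma saddle_kernel_bound (h r : nat) : (1 <= h)%nat ->
  exists M, 0 < M /\ forall x t, 0 < x <= 1 -> Rabs (x ^ 2 * t) <= PI ->
    Rabs (saddle_kernel h r x t) <= M * exp (- (Rabs t / 162)).
Proof.
  intro Hh. assert (H1 : 1 <= INR h) by (apply (le_INR 1); exact Hh).
  (* Each of the [r] factors may use the rate [1 / (162 k)]; taking [k = r + 1] keeps this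
     meaningful for [r = 0]. The constant 486 is [3 * 162]. *)
  set (k := INR (S r)). assert (Hk : 1 <= k) by (apply (le_INR 1); lia).
  exists (exp (1 / 81) * (486 * k) ^ r). split; [apply Rmult_lt_0_compat; [apply exp_pos|apply pow_lt; lra]|].
  intros x t Hx Ht. pose proof (log_re_decay x t Hx Ht) as D.
  assert (R0 := Rabs_pos t). set (a := Rabs t) in *.
  assert (U : Cmod (unit_step h (x, t)) <= 1 + 3 * a).
  { unfold unit_step. cbn [fst snd]. rewrite Cmod_mult, Cmod_R.
    assert (Hs : 0 < INR h * x) by (apply Rmult_lt_0_compat; lra).
    rewrite Rabs_pos_eq by (left; now apply Rinv_0_lt_compat).
    apply (Rmult_le_reg_l (INR h * x)); [easy|]. rewrite <- Rmult_assoc, Rinv_r, Rmult_1_l by lra.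
    apply Rle_trans with (1 := step_factor_bound h x _ ltac:(lra) Hh).
    rewrite Rabs_mult, (Rabs_pos_eq (x ^ 2)) by (apply pow_le; lra). fold a.
    assert (0 <= INR h * x * a * (1 - x)) by (apply Rmult_le_pos; [apply Rmult_le_pos; lra|lra]).
    simpl. lra. }
  assert (U2 : 1 + 3 * a <= 486 * k * exp (a / (162 * k))).
  { pose proof (exp_ineq1_le (a / (162 * k))) as E.
    apply Rle_trans with (486 * k * (1 + a / (162 * k))); [|apply Rmult_le_compat_l; lra].
    replace (486 * k * (1 + a / (162 * k))) with (486 * k + 3 * a) by (field; lra). lra. }
  unfold saddle_kernel.
  rewrite Rabs_mult, (Rabs_pos_eq (exp (- (3 * inv_cube_sum * t ^ 2)))) by (left; apply exp_pos).
  match goal with |- _ * Rabs (Re ?w) <= _ => apply Rle_trans with (exp (- (3 * inv_cube_sum * t ^ 2)) * Cmod w) end.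
  { apply Rmult_le_compat_l; [left; apply exp_pos|apply re_le_Cmod]. }
  rewrite Cmod_mult, Cmod_Cexp, Cmod_pow_n. simpl Re. rewrite <- Rmult_assoc, <- exp_plus. unfold saddle_re.
  replace (- (3 * inv_cube_sum * t ^ 2) + (log_re x (x ^ 2 * t) - log_moment 0 x + 3 * inv_cube_sum * t ^ 2))
    with (log_re x (x ^ 2 * t) - log_moment 0 x) by ring.
  apply Rle_trans with (exp ((1 - a) / 81) * (486 * k * exp (a / (162 * k))) ^ r).
  - apply Rmult_le_compat; [left; apply exp_pos|apply pow_le, Cmod_ge_0|now apply exp_le_compat|].
    apply pow_incr. split; [apply Cmod_ge_0|lra].
  - rewrite Rpow_mult_distr, exp_pow.
    replace ((1 - a) / 81) with (1 / 81 + - (a / 81)) by field. rewrite exp_plus.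
    set (p := exp (1 / 81)). set (m := (486 * k) ^ r).
    match goal with |- p * ?q * (m * ?e) <= _ => replace (p * q * (m * e)) with (p * m * (q * e)) by ring end.
    apply Rmult_le_compat_l; [apply Rmult_le_pos; [left; apply exp_pos|apply pow_le; lra]|].
    rewrite <- exp_plus. apply exp_le_compat.
    assert (INR r * (a / (162 * k)) <= a / 162); [|lra].
    assert (Er : INR r = k - 1) by (unfold k; rewrite S_INR; ring). rewrite Er.
    apply (Rmult_le_reg_r (162 * k)); [lra|]. replace ((k - 1) * (a / (162 * k)) * (162 * k)) with ((k - 1) * a) by (field; lra).
    replace (a / 162 * (162 * k)) with (k * a) by field. lra.
Qed.

(** The integral is cut at [|t| = T]: the exponential bound controls both tails independently of
    [x], and the middle converges uniformly. The limit [G] of the Gaussian integrals is a parameter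
    here. *)
Lemma saddle_integral_lim (h r : nat) (G : R) : (1 <= h)%nat ->
  (forall eps, 0 < eps -> exists T0, forall T, T0 <= T -> exists l : R,
     is_RInt (fun t => exp (- (3 * inv_cube_sum * t ^ 2))) (- T) T l /\ Rabs (l - G) <= eps) ->
  forall eps, 0 < eps -> exists del, 0 < del <= 1 /\ forall x I : R, 0 < x < del ->
    is_RInt (saddle_kernel h r x) (- (PI / x ^ 2)) (PI / x ^ 2) I -> Rabs (I - G) <= eps.
Proof.
  intros Hh HG eps Heps. destruct (saddle_kernel_bound h r Hh) as [M [HM BM]].
  destruct (HG (eps / 4) ltac:(lra)) as [T0 HT0].
  (* The last entry makes each tail [162 M exp (- T / 162)] at most [eps / 8], with
     [1296 = 8 * 162]. *)
  set (T := Rmax 1 (Rmax T0 (162 * (1296 * M / eps)))).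
  assert (HT1 : 1 <= T) by apply Rmax_l.
  assert (HT2 : T0 <= T) by (apply Rle_trans with (2 := Rmax_r _ _); apply Rmax_l).
  assert (HT3 : 162 * (1296 * M / eps) <= T) by (apply Rle_trans with (2 := Rmax_r _ _); apply Rmax_r).
  assert (Htail : 162 * M * exp (- (T / 162)) <= eps / 8).
  { rewrite exp_Ropp. pose proof (exp_ineq1_le (T / 162)) as E.
    assert (P : 0 < 1296 * M / eps) by (apply Rdiv_lt_0_compat; lra).
    assert (E2 : / exp (T / 162) <= / (1296 * M / eps)) by (apply Rinv_le_contravar; lra).
    apply Rle_trans with (162 * M * / (1296 * M / eps)); [apply Rmult_le_compat_l; lra|].
    right. field. lra. }
  destruct (HT0 T HT2) as [l [Hl Bl]].
  destruct (saddle_kernel_lim h r T (eps / (8 * T)) Hh ltac:(lra) ltac:(apply Rdiv_lt_0_compat; lra)) as [d [Hd B]].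
  (* The bound [x < 1 / T] ensures that [[- T, T]] lies inside the rescaled circle
     [|t| <= PI / x^2]. *)
  exists (Rmin (Rmin d 1) (/ T)).
  assert (HiT : 0 < / T) by (apply Rinv_0_lt_compat; lra).
  pose proof (Rmin_l (Rmin d 1) (/ T)) as M1. pose proof (Rmin_r (Rmin d 1) (/ T)) as M2.
  pose proof (Rmin_l d 1) as M3. pose proof (Rmin_r d 1) as M4.
  split; [split; [repeat apply Rmin_pos; lra|lra]|].
  intros x I Hx HI. set (E := PI / x ^ 2) in *.
  assert (X2 : 0 < x ^ 2) by (apply pow_lt; lra).
  assert (HTE : T <= E).
  { unfold E. apply (proj1 (Rle_div_r T PI (x ^ 2) X2)).
    assert (T * x <= 1) by (rewrite <- (Rinv_r T) by lra; apply Rmult_le_compat_l; lra).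
    pose proof PI2_1. pose proof PI_RGT_0. simpl.
    assert (T * x * x <= 1 * 1) by (apply Rmult_le_compat; nra). unfold PI2 in *. lra. }
  assert (Hdom : forall t, - E <= t <= E -> Rabs (saddle_kernel h r x t) <= M * exp (- (Rabs t / 162))).
  { intros t Ht. apply BM; [lra|]. rewrite Rabs_mult, (Rabs_pos_eq (x ^ 2)) by lra.
    apply Rle_trans with (x ^ 2 * E); [apply Rmult_le_compat_l; [lra|now apply Rabs_le]|]. right. unfold E. field. lra. }
  assert (Hex : ex_RInt (saddle_kernel h r x) (- E) E) by (now exists I).
  assert (X1 : ex_RInt (saddle_kernel h r x) (- E) (- T)) by (apply (ex_RInt_Chasles_1 (V := R_CompleteNormedModule) _ _ _ E); [lra|easy]).
  assert (X23 : ex_RInt (saddle_kernel h r x) (- T) E) by (apply (ex_RInt_Chasles_2 (V := R_CompleteNormedModule) _ (- E)); [lra|easy]).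
  assert (X2' : ex_RInt (saddle_kernel h r x) (- T) T) by (apply (ex_RInt_Chasles_1 (V := R_CompleteNormedModule) _ _ _ E); [lra|easy]).
  assert (X3 : ex_RInt (saddle_kernel h r x) T E) by (apply (ex_RInt_Chasles_2 (V := R_CompleteNormedModule) _ (- T)); [lra|easy]).
  destruct X1 as [I1 H1], X2' as [I2 H2], X3 as [I3 H3].
  assert (HI' := is_RInt_Chasles (V := R_NormedModule) _ _ _ _ _ _ (is_RInt_Chasles (V := R_NormedModule) _ _ _ _ _ _ H1 H2) H3).
  assert (EI : I = I1 + I2 + I3).
  { rewrite <- (is_RInt_unique (V := R_CompleteNormedModule) _ _ _ _ HI).
    exact (is_RInt_unique (V := R_CompleteNormedModule) _ _ _ _ HI'). }
  assert (B3 : Rabs I3 <= eps / 8).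
  { apply Rle_trans with (- 162 * M * exp (- (E / 162)) - - 162 * M * exp (- (T / 162))).
    - apply (norm_RInt_le (V := R_NormedModule) (saddle_kernel h r x) (fun t => M * exp (- (t / 162))) T E); [lra| |exact H3|].
      + intros t Ht. assert (G0 := Hdom t ltac:(lra)). rewrite (Rabs_pos_eq t) in G0 by lra. exact G0.
      + apply (is_RInt_derive (V := R_CompleteNormedModule) (fun t => - 162 * M * exp (- (t / 162)))).
        * intros t Ht. auto_derive; [easy|]. unfold Rdiv. field.
        * intros t Ht. apply (ex_derive_continuous (V := R_NormedModule)). auto_derive; easy.
    - assert (0 < M * exp (- (E / 162))) by (apply Rmult_lt_0_compat; [lra|apply exp_pos]). lra. }
  assert (B1 : Rabs I1 <= eps / 8).
  { apply Rle_trans with (162 * M * exp (- T / 162) - 162 * M * exp (- E / 162)).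
    - apply (norm_RInt_le (V := R_NormedModule) (saddle_kernel h r x) (fun t => M * exp (t / 162)) (- E) (- T)); [lra| |exact H1|].
      + intros t Ht. assert (G0 := Hdom t ltac:(lra)). rewrite (Rabs_left1 t) in G0 by lra.
        replace (- (- t / 162)) with (t / 162) in G0 by field. exact G0.
      + apply (is_RInt_derive (V := R_CompleteNormedModule) (fun t => 162 * M * exp (t / 162))).
        * intros t Ht. auto_derive; [easy|]. unfold Rdiv. field.
        * intros t Ht. apply (ex_derive_continuous (V := R_NormedModule)). auto_derive; easy.
    - assert (0 < M * exp (- E / 162)) by (apply Rmult_lt_0_compat; [lra|apply exp_pos]).
      replace (- T / 162) with (- (T / 162)) by field. lra. }
  assert (B2 : Rabs (I2 - l) <= eps / 4).
  { replace (eps / 4) with ((T - - T) * (eps / (8 * T))) by (field; lra).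
    apply (norm_RInt_le_const (V := R_NormedModule) (fun t => minus (saddle_kernel h r x t) (exp (- (3 * inv_cube_sum * t ^ 2)))) (- T) T); [lra| |].
    - intros t Ht. apply B; [lra|]. now apply Rabs_le.
    - exact (is_RInt_minus (V := R_NormedModule) _ _ _ _ _ _ H2 Hl). }
  rewrite EI. apply Rabs_le_between in B1, B2, B3, Bl. apply Rabs_le. lra.
Qed.

(** * The Gaussian integral *)

Definition gauss (t : R) : R := exp (- t ^ 2).

Lemma ex_RInt_smooth (f : R -> R) (a b : R) : (forall t, ex_derive f t) -> ex_RInt f a b.
Proof.
  intro H. apply (ex_RInt_continuous (V := R_CompleteNormedModule)). intros t _.
  apply (ex_derive_continuous (V := R_NormedModule)). apply H.
Qed.

Lemma ex_derive_gauss (t : R) : ex_derive gauss t.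
Proof. unfold gauss. auto_derive. easy. Qed.

Definition gauss_int (x : R) : R := RInt gauss 0 x.

Lemma is_derive_gauss_int (x : R) : is_derive gauss_int x (gauss x).
Proof.
  apply (is_derive_RInt (V := R_NormedModule) gauss gauss_int 0 x).
  - apply filter_forall. intro y.
    apply (RInt_correct (V := R_CompleteNormedModule)), ex_RInt_smooth, ex_derive_gauss.
  - apply (ex_derive_continuous (V := R_NormedModule)), ex_derive_gauss.
Qed.

(** The classical auxiliary integrand: [gauss_int x ^ 2] plus its integral over [[0, 1]] does not
    depend on [x]. At [x = 0] this is the integral of [1 / (1 + t^2)], and for large [x] the second
    summand vanishes. *)
Definition gauss_arc (x t : R) : R := exp (- (x ^ 2 * (1 + t ^ 2))) / (1 + t ^ 2).

Lemma is_derive_gauss_arc (x t : R) :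
  is_derive (fun u => gauss_arc u t) x (- (2 * x) * exp (- (x ^ 2 * (1 + t ^ 2)))).
Proof.
  unfold gauss_arc. pose proof (pow2_ge_0 t). auto_derive; [lra|]. simpl. field. simpl in *. lra.
Qed.

Lemma ex_RInt_gauss_arc (x a b : R) : ex_RInt (gauss_arc x) a b.
Proof.
  apply ex_RInt_smooth. intro t. unfold gauss_arc. pose proof (pow2_ge_0 t). auto_derive. simpl in *. lra.
Qed.

(** Differentiation under the integral sign, followed by the substitution [u = x t], which turns the
    result into a multiple of [gauss_int x]. *)
Lemma is_derive_gauss_arc_int (x : R) :
  is_derive (fun u => RInt (gauss_arc u) 0 1) x (- 2 * gauss x * gauss_int x).
Proof.
  assert (H : is_derive (fun u => RInt (fun t => gauss_arc u t) 0 1) x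
    (RInt (fun t => Derive (fun u => gauss_arc u t) x) 0 1)).
  { apply is_derive_RInt_param.
    - apply filter_forall. intros y t _. eexists. apply is_derive_gauss_arc.
    - intros t _.
      apply continuity_2d_pt_ext with (fun u v => - (2 * u) * exp (- (u * u * (1 + v * v)))).
      + intros u v. symmetry. apply is_derive_unique.
        assert (E := is_derive_gauss_arc u v). simpl in E. rewrite !Rmult_1_r in E. exact E.
      + apply continuity_2d_pt_mult.
        * apply continuity_2d_pt_opp, continuity_2d_pt_mult; [apply continuity_2d_pt_const|apply continuity_2d_pt_id1].
        * apply (continuity_1d_2d_pt_comp exp (fun u v => - (u * u * (1 + v * v)))).
          -- apply derivable_continuous_pt, derivable_pt_exp.
          -- apply continuity_2d_pt_opp. apply continuity_2d_pt_mult.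
             ++ apply continuity_2d_pt_mult; apply continuity_2d_pt_id1.
             ++ apply continuity_2d_pt_plus; [apply continuity_2d_pt_const|].
                apply continuity_2d_pt_mult; apply continuity_2d_pt_id2.
    - apply filter_forall. intro y. apply ex_RInt_gauss_arc. }
  refine (eq_ind _ (fun l => is_derive _ x l) H _ _).
  assert (G : is_RInt gauss (x * 0 + 0) (x * 1 + 0) (gauss_int x)).
  { rewrite Rmult_0_r, Rmult_1_r, !Rplus_0_r.
    apply (RInt_correct (V := R_CompleteNormedModule)), ex_RInt_smooth, ex_derive_gauss. }
  apply (is_RInt_comp_lin (V := R_NormedModule)) in G.
  apply (is_RInt_scal (V := R_NormedModule) _ _ _ (- 2 * gauss x)) in G.
  apply (is_RInt_unique (V := R_CompleteNormedModule)).
  apply is_RInt_ext with (2 := G). intros t _.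
  refine (eq_trans _ (eq_sym (is_derive_unique _ _ _ (is_derive_gauss_arc x t)))).
  change (- 2 * gauss x * (x * gauss (x * t + 0)) = - (2 * x) * exp (- (x ^ 2 * (1 + t ^ 2)))).
  unfold gauss. replace (- (x ^ 2 * (1 + t ^ 2))) with (- x ^ 2 + - (x * t + 0) ^ 2) by ring.
  rewrite exp_plus. ring.
Qed.

Lemma gauss_int_square (x : R) : 0 <= x -> gauss_int x ^ 2 + RInt (gauss_arc x) 0 1 = PI / 4.
Proof.
  intro Hx. transitivity (gauss_int 0 ^ 2 + RInt (gauss_arc 0) 0 1).
  - apply (is_derive_zero_eq (fun u => gauss_int u ^ 2 + RInt (gauss_arc u) 0 1) x Hx).
    intros t _. pose proof (is_derive_gauss_int t) as D1. pose proof (is_derive_gauss_arc_int t) as D2.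
    assert (D3 := is_derive_pow gauss_int 2 t _ D1).
    assert (D := is_derive_plus (K := R_AbsRing) (V := R_NormedModule) _ _ _ _ _ D3 D2).
    refine (eq_ind _ (fun l => is_derive _ t l) D _ _).
    change (INR 2 * gauss t * gauss_int t ^ 1 + - 2 * gauss t * gauss_int t = 0). simpl. ring.
  - unfold gauss_int. rewrite (RInt_point (V := R_CompleteNormedModule)). change (@zero R_CompleteNormedModule) with 0.
    assert (A : is_RInt (gauss_arc 0) 0 1 (atan 1 - atan 0)).
    { apply is_RInt_ext with (fun t => / (1 + t ^ 2)).
      - intros t _. unfold gauss_arc. eq_in_R. pose proof (pow2_ge_0 t).
        replace (- (0 ^ 2 * (1 + t ^ 2))) with 0 by ring. rewrite exp_0. field. simpl in *. lra.
      - apply (is_RInt_derive (V := R_CompleteNormedModule) atan).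
        + intros t _. assert (D := is_derive_atan t). unfold Rsqr in D. simpl. rewrite Rmult_1_r. exact D.
        + intros t _. apply (ex_derive_continuous (V := R_NormedModule)). pose proof (pow2_ge_0 t). auto_derive. simpl in *. lra. }
    apply (is_RInt_unique (V := R_CompleteNormedModule)) in A.
    apply (f_equal (Rplus (0 ^ 2))) in A. refine (eq_trans A _).
    rewrite atan_0, atan_1. eq_in_R. simpl. field.
Qed.

Lemma gauss_arc_int_bounds (x : R) : 0 <= RInt (gauss_arc x) 0 1 <= gauss x.
Proof.
  assert (P : forall t, 0 <= gauss_arc x t <= gauss x).
  { intro t. unfold gauss_arc, gauss. pose proof (pow2_ge_0 t) as T2. pose proof (pow2_ge_0 x).
    split; [left; apply Rdiv_lt_0_compat; [apply exp_pos|lra]|].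
    apply Rle_div_l; [lra|]. apply Rle_trans with (exp (- x ^ 2) * 1).
    - rewrite Rmult_1_r. apply exp_le_compat. assert (0 <= x ^ 2 * t ^ 2) by (now apply Rmult_le_pos). lra.
    - apply Rmult_le_compat_l; [left; apply exp_pos|lra]. }
  assert (H := RInt_correct (V := R_CompleteNormedModule) _ _ _ (ex_RInt_gauss_arc x 0 1)).
  split.
  - apply (is_RInt_le (fun _ => 0) (gauss_arc x) 0 1); [lra| |exact H|intros; apply P].
    refine (eq_ind _ (fun l => is_RInt _ 0 1 l) (is_RInt_const (V := R_NormedModule) 0 1 0) _ _).
    change ((1 - 0) * 0 = 0). ring.
  - apply (is_RInt_le (gauss_arc x) (fun _ => gauss x) 0 1); [lra|exact H| |intros; apply P].
    refine (eq_ind _ (fun l => is_RInt _ 0 1 l) (is_RInt_const (V := R_NormedModule) 0 1 (gauss x)) _ _).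
    change ((1 - 0) * gauss x = gauss x). ring.
Qed.

Lemma gauss_int_ge0 (x : R) : 0 <= x -> 0 <= gauss_int x.
Proof.
  intro Hx. apply RInt_ge_0; [easy|apply ex_RInt_smooth, ex_derive_gauss|].
  intros t _. left. apply exp_pos.
Qed.

Lemma gauss_int_lim (eps : R) : 0 < eps ->
  exists X, forall x, X <= x -> Rabs (gauss_int x - sqrt PI / 2) <= eps.
Proof.
  intro Heps. exists (Rmax 1 (2 / eps)). intros x Hx.
  pose proof (Rmax_l 1 (2 / eps)) as X1. pose proof (Rmax_r 1 (2 / eps)) as X2.
  pose proof (gauss_int_square x ltac:(lra)) as Sq. pose proof (gauss_arc_int_bounds x) as B.
  pose proof (gauss_int_ge0 x ltac:(lra)) as G0.
  assert (Hs : sqrt PI * sqrt PI = PI) by (apply sqrt_sqrt; pose proof PI_RGT_0; lra).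
  assert (S1 : 1 <= sqrt PI) by (rewrite <- sqrt_1; apply sqrt_le_1_alt; pose proof PI2_1; unfold PI2 in *; lra).
  set (s := sqrt PI / 2) in *. assert (Hss : s * s = PI / 4) by (unfold s; lra).
  set (g := gauss_int x) in *.
  assert (Gx : gauss x <= eps / 2).
  { unfold gauss. rewrite exp_Ropp.
    replace (eps / 2) with (/ (2 / eps)) by (field; lra).
    assert (0 < 2 / eps) by (apply Rdiv_lt_0_compat; lra).
    apply Rinv_le_contravar; [easy|]. pose proof (exp_ineq1_le (x ^ 2)). simpl in *. nra. }
  (* Difference of squares: the product equals minus the [gauss_arc] integral, and dividing by
     [g + s >= 1/2] costs a factor 2. *)
  assert (Hd : - (eps / 2) <= (g - s) * (g + s) <= 0) by (simpl in Sq; nra).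
  assert (Hgs : 1 / 2 <= g + s) by (unfold s; lra).
  apply Rabs_le. split; nra.
Qed.

Lemma is_RInt_gauss_scaled (k T : R) : 0 < k ->
  is_RInt (fun t => exp (- (k * t ^ 2))) (- T) T (2 * (gauss_int (sqrt k * T) / sqrt k)).
Proof.
  intro Hk. pose proof (sqrt_lt_R0 k Hk) as Hs. pose proof (sqrt_sqrt k ltac:(lra)) as Hss.
  assert (G : is_RInt gauss (sqrt k * 0 + 0) (sqrt k * T + 0) (gauss_int (sqrt k * T))).
  { rewrite Rmult_0_r, !Rplus_0_r.
    apply (RInt_correct (V := R_CompleteNormedModule)), ex_RInt_smooth, ex_derive_gauss. }
  apply (is_RInt_comp_lin (V := R_NormedModule)) in G.
  apply (is_RInt_scal (V := R_NormedModule) _ _ _ (/ sqrt k)) in G.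
  assert (P : is_RInt (fun t => exp (- (k * t ^ 2))) 0 T (gauss_int (sqrt k * T) / sqrt k)).
  { refine (eq_ind _ (fun l => is_RInt _ _ _ l) (is_RInt_ext _ _ _ _ _ _ G) _ _).
    - intros t _. change (/ sqrt k * (sqrt k * gauss (sqrt k * t + 0)) = exp (- (k * t ^ 2))).
      unfold gauss. rewrite <- Rmult_assoc, Rinv_l, Rmult_1_l by lra. f_equal. rewrite <- Hss at 2. ring.
    - change (/ sqrt k * gauss_int (sqrt k * T) = gauss_int (sqrt k * T) / sqrt k). field. lra. }
  assert (N : is_RInt (fun t => exp (- (k * t ^ 2))) 0 (- T) (- (gauss_int (sqrt k * T) / sqrt k))).
  { assert (P' : is_RInt (fun t => exp (- (k * t ^ 2))) (- 0) (- - T) (gauss_int (sqrt k * T) / sqrt k))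
      by (rewrite Ropp_0, Ropp_involutive; exact P).
    apply (is_RInt_comp_opp (V := R_NormedModule)) in P'.
    apply (is_RInt_opp (V := R_NormedModule)) in P'.
    apply is_RInt_ext with (2 := P'). intros t _.
    change (- - exp (- (k * (- t) ^ 2)) = exp (- (k * t ^ 2))). rewrite Ropp_involutive. f_equal. ring. }
  apply (is_RInt_swap (V := R_NormedModule)) in N.
  assert (A := is_RInt_Chasles (V := R_NormedModule) _ _ _ _ _ _ N P).
  refine (eq_ind _ (fun l => is_RInt _ _ _ l) A _ _).
  match goal with |- plus (opp (- ?a)) ?a = _ => change (- - a + a = 2 * a) end. ring.
Qed.

Lemma gauss_scaled_lim (k eps : R) : 0 < k -> 0 < eps ->
  exists T0, forall T, T0 <= T -> exists l : R,
    is_RInt (fun t => exp (- (k * t ^ 2))) (- T) T l /\ Rabs (l - sqrt (PI / k)) <= eps.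
Proof.
  intros Hk Heps. pose proof (sqrt_lt_R0 k Hk) as Hs.
  destruct (gauss_int_lim (eps * sqrt k / 2)) as [X HX].
  { apply Rdiv_lt_0_compat; [now apply Rmult_lt_0_compat|lra]. }
  exists (X / sqrt k). intros T HT. eexists. split; [now apply is_RInt_gauss_scaled|].
  assert (HT' : X <= sqrt k * T).
  { replace X with (sqrt k * (X / sqrt k)) by (field; lra). apply Rmult_le_compat_l; lra. }
  specialize (HX _ HT'). rewrite sqrt_div_alt by easy.
  replace (2 * (gauss_int (sqrt k * T) / sqrt k) - sqrt PI / sqrt k) with
    (2 / sqrt k * (gauss_int (sqrt k * T) - sqrt PI / 2)) by (field; lra).
  rewrite Rabs_mult, (Rabs_pos_eq (2 / sqrt k)) by (left; apply Rdiv_lt_0_compat; lra).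
  replace eps with (2 / sqrt k * (eps * sqrt k / 2)) by (field; lra).
  apply Rmult_le_compat_l; [left; apply Rdiv_lt_0_compat; lra|easy].
Qed.

(** * Assembly *)

(** The minimiser of [zeta(3) / x^2 + n x], not of the exact exponent. The first moment at this
    point differs from [n] by [o(x^(-2))], which is negligible on the scale [y = x^2 t]. *)
Definition saddle_point (n : nat) : R := Rpower (2 * inv_cube_sum / INR n) (1 / 3).

Lemma ln_saddle_point (n : nat) : (1 <= n)%nat ->
  ln (saddle_point n) = (ln 2 + ln inv_cube_sum - ln (INR n)) / 3.
Proof.
  intro Hn. assert (H1 : 1 <= INR n) by (apply (le_INR 1); exact Hn). pose proof inv_cube_sum_pos.
  unfold saddle_point, Rpower. rewrite ln_exp, ln_div, ln_mult by lra. field.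
Qed.

Lemma saddle_point_exp (n k : nat) : (1 <= n)%nat ->
  saddle_point n ^ k = exp (INR k * ((ln 2 + ln inv_cube_sum - ln (INR n)) / 3)).
Proof.
  intro Hn. rewrite <- ln_saddle_point by easy. rewrite <- exp_pow, exp_ln by apply exp_pos. easy.
Qed.

Lemma saddle_point_eq (n : nat) : (1 <= n)%nat -> INR n = 2 * inv_cube_sum / saddle_point n ^ 3.
Proof.
  intro Hn. assert (H1 : 1 <= INR n) by (apply (le_INR 1); exact Hn). pose proof inv_cube_sum_pos.
  rewrite saddle_point_exp by easy.
  replace (INR 3 * ((ln 2 + ln inv_cube_sum - ln (INR n)) / 3)) with (ln (2 * inv_cube_sum / INR n))
    by (rewrite ln_div, ln_mult by lra; simpl; field).
  rewrite exp_ln by (apply Rdiv_lt_0_compat; lra). field. lra.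
Qed.

Lemma saddle_point_small (del : R) : 0 < del ->
  exists N, forall n, (N <= n)%nat -> (1 <= n)%nat /\ 0 < saddle_point n < del.
Proof.
  intro Hd. pose proof inv_cube_sum_pos as Hz.
  assert (D3 : 0 < del ^ 3) by now apply pow_lt.
  destruct (INR_unbounded (2 * inv_cube_sum / del ^ 3)) as [N HN].
  exists (S N). intros n Hn. split; [lia|]. split; [apply exp_pos|].
  destruct (Rlt_le_dec (saddle_point n) del) as [H|H]; [easy|exfalso].
  assert (del ^ 3 <= saddle_point n ^ 3) by (apply pow_incr; lra).
  assert (E := saddle_point_eq n ltac:(lia)).
  assert (2 * inv_cube_sum / saddle_point n ^ 3 <= 2 * inv_cube_sum / del ^ 3).
  { apply Rmult_le_compat_l; [lra|]. apply Rinv_le_contravar; easy. }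
  assert (INR N <= INR n) by (apply le_INR; lia). lra.
Qed.

(** The factor [x ^ 2] is the Jacobian of [y = x^2 t]; the rest is the factor split off in
    [pp_kernel_saddle]. *)
Definition saddle_scale (h r n : nat) : R :=
  let x := saddle_point n in x ^ 2 * (exp (log_moment 0 x + INR n * x) * (INR h * x) ^ r).

Lemma saddle_scale_pos (h r n : nat) : (1 <= h)%nat -> 0 < saddle_scale h r n.
Proof.
  intro Hh. assert (H1 : 1 <= INR h) by (apply (le_INR 1); exact Hh).
  assert (Hx : 0 < saddle_point n) by apply exp_pos. unfold saddle_scale.
  apply Rmult_lt_0_compat; [now apply pow_lt|]. apply Rmult_lt_0_compat; [apply exp_pos|].
  apply pow_lt, Rmult_lt_0_compat; lra.
Qed.

Lemma is_RInt_saddle_kernel (h r n : nat) : (1 <= h)%nat -> (1 <= n)%nat -> (h * r <= n)%nat ->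
  let x := saddle_point n in
  is_RInt (saddle_kernel h r x) (- (PI / x ^ 2)) (PI / x ^ 2)
    (2 * PI * bdiff h r (fun n => INR (pp n)) n / saddle_scale h r n).
Proof.
  intros Hh Hn Hr x. assert (Hx : 0 < x) by apply exp_pos.
  assert (X2 : 0 < x ^ 2) by now apply pow_lt.
  pose proof (saddle_scale_pos h r n Hh) as HS.
  assert (G := is_RInt_bdiff_pp h r n x Hx Hr).
  assert (G' : is_RInt (fun y => Re (pp_kernel h r (INR n) x y))
    (x ^ 2 * (- (PI / x ^ 2)) + 0) (x ^ 2 * (PI / x ^ 2) + 0) (2 * PI * bdiff h r (fun n => INR (pp n)) n)).
  { replace (x ^ 2 * (- (PI / x ^ 2)) + 0) with (- PI) by (field; lra).
    replace (x ^ 2 * (PI / x ^ 2) + 0) with PI by (field; lra). exact G. }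
  apply (is_RInt_comp_lin (V := R_NormedModule)) in G'.
  apply (is_RInt_scal (V := R_NormedModule) _ _ _ (/ saddle_scale h r n)) in G'.
  refine (eq_ind _ (fun l => is_RInt _ _ _ l) (is_RInt_ext _ _ _ _ _ _ G') _ _).
  - intros t _.
    change (/ saddle_scale h r n * (x ^ 2 * Re (pp_kernel h r (INR n) x (x ^ 2 * t + 0))) = saddle_kernel h r x t).
    rewrite Rplus_0_r, (pp_kernel_saddle h r (INR n) x t Hx Hh (saddle_point_eq n Hn)).
    transitivity (/ saddle_scale h r n * saddle_scale h r n * saddle_kernel h r x t).
    + unfold saddle_scale. fold x. ring.
    + rewrite Rinv_l by lra. ring.
  - match goal with |- scal ?a ?b = _ => change (a * b = b / saddle_scale h r n) end. apply Rmult_comm.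
Qed.

Lemma sqrt_gauss_const (z : R) : 0 < z ->
  sqrt (PI / (3 * z)) / (2 * PI) = exp (- ln 2 - ln z / 2) / sqrt (3 * PI).
Proof.
  intro Hz. pose proof PI_RGT_0 as HP.
  assert (H3 : 0 < sqrt 3) by (apply sqrt_lt_R0; lra).
  assert (HsP : 0 < sqrt PI) by now apply sqrt_lt_R0.
  assert (HPP : sqrt PI * sqrt PI = PI) by (apply sqrt_sqrt; lra).
  assert (Ez : sqrt z = exp (ln z / 2)).
  { apply Rsqr_inj; [apply sqrt_pos|left; apply exp_pos|]. unfold Rsqr. rewrite sqrt_sqrt by lra.
    rewrite <- exp_plus. replace (ln z / 2 + ln z / 2) with (ln z) by field. now rewrite exp_ln. }
  rewrite sqrt_div_alt by lra. rewrite !sqrt_mult by lra. rewrite Ez.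
  unfold Rminus. rewrite exp_plus, !exp_Ropp, exp_ln by lra.
  rewrite <- HPP at 2. pose proof (exp_pos (ln z / 2)). field. repeat split; lra.
Qed.

(** An exact identity, with the whole asymptotic error in the last factor. The Jacobian [x^2] and
    the [x^(1/12)] from the logarithm give [(2 + 1/12) / 3 = 25/36]. The Gaussian constant lowers
    the exponents of zeta(3) and of 2 by 1/2 and 1, to 7/36 and - 11/36. Each factor [h x] gives
    [(2 h A / 3) n^(-1/3)]. *)
Lemma saddle_scale_eq (zeta : C -> C) (h r n : nat) : is_riemann_zeta zeta ->
  (1 <= h)%nat -> (1 <= n)%nat ->
  saddle_scale h r n * (sqrt (PI / (3 * inv_cube_sum)) / (2 * PI)) =
  constC1 zeta * (2 * INR h * constA zeta / 3) ^ r *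
    (exp (constA zeta * Rpower (INR n) (2 / 3)) / Rpower (INR n) (INR r / 3 + 25 / 36)) *
    exp (log_rem (saddle_point n)).
Proof.
  intros Hzeta Hh Hn. pose proof inv_cube_sum_pos as Hz.
  assert (H1 : 1 <= INR n) by (apply (le_INR 1); exact Hn).
  set (x := saddle_point n). assert (Hx : 0 < x) by apply exp_pos.
  pose proof (saddle_point_exp n) as Ek. fold x in Ek.
  pose proof (ln_saddle_point n Hn) as El. fold x in El.
  set (l := ln (INR n)) in *. set (la := ln inv_cube_sum) in *. set (ta := ln 2) in *.
  assert (EA : constA zeta = 3 * exp (la / 3 - 2 * ta / 3)).
  { unfold constA. rewrite zeta3_eq by easy. unfold Rpower. fold la ta.
    replace (la / 3 - 2 * ta / 3) with (1 / 3 * la + - (2 / 3 * ta)) by field.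
    rewrite exp_plus, exp_Ropp. field. apply Rgt_not_eq, exp_pos. }
  (* At the saddle point [n x] is twice [zeta(3) / x^2], so the exponent is [3 zeta(3) / x^2]. *)
  assert (Hzx : inv_cube_sum / x ^ 2 + INR n * x = constA zeta * Rpower (INR n) (2 / 3)).
  { assert (En : INR n * x = 2 * (inv_cube_sum * / x ^ 2)).
    { rewrite (saddle_point_eq n Hn) at 1. fold x. field. lra. }
    rewrite En. transitivity (3 * (inv_cube_sum * / x ^ 2)); [field; lra|].
    rewrite EA, Rmult_assoc. f_equal. rewrite Ek by easy. rewrite <- (exp_ln inv_cube_sum Hz) at 1. fold la.
    unfold Rpower. fold l. rewrite <- exp_Ropp, <- !exp_plus. f_equal. simpl. field. }
  assert (EL : log_moment 0 x + INR n * x =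
    constA zeta * Rpower (INR n) (2 / 3) + ln x / 12 + zeta'_m1 zeta + log_rem x).
  { rewrite <- Hzx, zeta'_m1_eq by easy. unfold log_rem. ring. }
  unfold saddle_scale. fold x. rewrite EL, sqrt_gauss_const by easy. fold la ta.
  rewrite !exp_plus, Rpow_mult_distr, !Ek by easy. rewrite El.
  replace (2 * INR h * constA zeta / 3) with (INR h * exp (ta / 3 + la / 3)).
  2:{ rewrite EA. replace (ta / 3 + la / 3) with (ta + (la / 3 - 2 * ta / 3)) by field.
      rewrite exp_plus. unfold ta at 1. rewrite exp_ln by lra. field. }
  rewrite Rpow_mult_distr, exp_pow. unfold constC1. rewrite zeta3_eq by easy.
  unfold Rpower at 2 3 5. fold la ta l.
  set (e1 := exp (constA zeta * Rpower (INR n) (2 / 3))). set (e2 := exp (zeta'_m1 zeta)).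
  set (e3 := exp (log_rem x)). set (hr := INR h ^ r).
  assert (H3 : 0 < sqrt (3 * PI)) by (apply sqrt_lt_R0; pose proof PI_RGT_0; lra).
  set (s := sqrt (3 * PI)) in *.
  set (u := (ta + la - l) / 3).
  transitivity (e1 * e2 * e3 * hr / s * (exp (INR 2 * u) * exp (u / 12) * exp (INR r * u) * exp (- ta - la / 2)));
    [field; lra|].
  transitivity (e1 * e2 * e3 * hr / s * (exp (7 / 36 * la) * / exp (11 / 36 * ta) * exp (INR r * (ta / 3 + la / 3)) *
    / exp ((INR r / 3 + 25 / 36) * l))).
  2:{ field. repeat split; try (apply Rgt_not_eq, exp_pos). lra. }
  f_equal. rewrite <- !exp_Ropp, <- !exp_plus. f_equal. unfold u. simpl. field.
Qed.

Theorem theorem1p10 (zeta : C -> C) (hzeta : is_riemann_zeta zeta)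
    (r h : nat) (hr : (1 <= r)%nat) (hh : (1 <= h)%nat) :
  asymp_equiv
    (bdiff h r (fun n : nat => INR (pp n)))
    (fun n : nat =>
       constC1 zeta * (2 * INR h * constA zeta / 3) ^ r *
       (exp (constA zeta * Rpower (INR n) (2 / 3)) /
        Rpower (INR n) (INR r / 3 + 25 / 36))).
Proof.
  pose proof inv_cube_sum_pos as Hz. pose proof PI_RGT_0 as HP.
  set (G := sqrt (PI / (3 * inv_cube_sum))).
  assert (HG : 0 < G) by (apply sqrt_lt_R0, Rdiv_lt_0_compat; lra).
  set (v := fun n : nat => constC1 zeta * (2 * INR h * constA zeta / 3) ^ r *
       (exp (constA zeta * Rpower (INR n) (2 / 3)) / Rpower (INR n) (INR r / 3 + 25 / 36))).
  set (b := bdiff h r (fun n : nat => INR (pp n))).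
  assert (L1 : is_lim_seq (fun n => 2 * PI * b n / saddle_scale h r n) G).
  { apply is_lim_seq_spec. intros [eps Heps]. simpl.
    destruct (saddle_integral_lim h r G hh
      (fun e He => gauss_scaled_lim (3 * inv_cube_sum) e ltac:(lra) He) (eps / 2) ltac:(lra)) as [d [Hd B]].
    destruct (saddle_point_small d ltac:(lra)) as [N HN].
    (* Adding [h * r] keeps every truncated subtraction in [bdiff] exact. *)
    exists (N + h * r)%nat. intros n Hn. destruct (HN n ltac:(lia)) as [Hn1 Hx].
    assert (E := B (saddle_point n) _ Hx (is_RInt_saddle_kernel h r n hh Hn1 ltac:(lia))). unfold b. lra. }
  assert (L2 : is_lim_seq (fun n => exp (log_rem (saddle_point n))) 1).
  { rewrite <- exp_0. apply is_lim_seq_continuous; [apply derivable_continuous_pt, derivable_pt_exp|].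
    apply is_lim_seq_spec. intros [eps Heps]. simpl.
    destruct (log_rem_lim (eps / 2) ltac:(lra)) as [d [Hd B]].
    destruct (saddle_point_small d ltac:(lra)) as [N HN].
    exists N. intros n Hn. destruct (HN n Hn) as [Hn1 Hx]. specialize (B _ Hx). rewrite Rminus_0_r. lra. }
  assert (L := is_lim_seq_mult' _ _ _ _ (is_lim_seq_scal_r _ (/ G) _ L1) L2).
  simpl in L. rewrite Rinv_r, Rmult_1_r in L by lra.
  unfold asymp_equiv. apply is_lim_seq_ext_loc with (2 := L). exists 1%nat. intros n Hn.
  assert (E := saddle_scale_eq zeta h r n hzeta hh Hn). fold G in E. fold (v n) in E. fold (v n).
  pose proof (saddle_scale_pos h r n hh) as HS. pose proof (exp_pos (log_rem (saddle_point n))) as HR.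
  set (e := exp (log_rem (saddle_point n))) in *. set (S := saddle_scale h r n) in *.
  (* Nonvanishing of the comparison sequence follows from positivity of the other side of
     [saddle_scale_eq]. *)
  assert (Hv : v n <> 0).
  { intro H0. rewrite H0, Rmult_0_l in E. assert (0 < S * (G / (2 * PI))); [|lra].
    apply Rmult_lt_0_compat; [easy|apply Rdiv_lt_0_compat; lra]. }
  apply (Rmult_eq_reg_r (v n)); [|easy].
  transitivity (b n); [|unfold Rdiv; rewrite Rmult_assoc, Rinv_l by easy; ring].
  transitivity (2 * PI * b n / S * / G * (v n * e)); [ring|]. rewrite <- E. field. repeat split; lra.
Qed.
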